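(* Let $A$ be a separable $C^*$-algebra endowed with its standard quantization, and let $I$ be a closed left ideal of $A$. Consider $I$ as a left (Banach) Q-module over $A$, with the Q-norm inherited from $A$ as a subspace and with the multiplication of $A$ as outer multiplication. Then $I$ is relatively projective.
   Context: Notation. $L$ is a fixed separable infinite-dimensional Hilbert space, $\mathcal{B}=\mathcal{B}(L)$ is the algebra of bounded operators on $L$, and $\mathcal{F}\subset\mathcal{B}$ is the (non-closed) two-sided ideal of bounded finite rank operators with the operator norm. For a complex linear space $E$ its amplification is the algebraic tensor product $\mathcal{F}E:=\mathcal{F}\otimes E$; elementary tensors are written $ax$ ($a\in\mathcal{F}$, $x\in E$). $\mathcal{F}E$ is a $\mathcal{B}$-bimodule via $a\cdot(bx)=(ab)x$, $(bx)\cdot a=(ba)x$. An orthogonal projection $P\in\mathcal{B}$ is a support of $u\in\mathcal{F}E$ if $P\cdot u=u=u\cdot P$. Q-spaces. A Q-norm on $E$ is a norm on $\mathcal{F}E$ such that (i) $\|a\cdot u\cdot b\|\le\|a\|\|u\|\|b\|$ for $a,b\in\mathcal{B}$, $u\in\mathcal{F}E$; (ii) $\|u+v\|=\max\{\|u\|,\|v\|\}$ whenever $u,v\in\mathcal{F}E$ have supports that are mutually orthogonal. A Q-space is a linear space with a Q-norm. Its underlying norm is $\|x\|:=\|px\|$, where $p$ is any rank one orthogonal projection (the result does not depend on $p$). A Q-space is complete (Banach) if its underlying normed space is complete. A subspace $E_0\subset E$ inherits a Q-norm by restriction to $\mathcal{F}E_0\subset \mathcal{F}E$. Completely bounded maps.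 For a linear operator $\varphi:E\to F$ between Q-spaces put $\varphi_\infty:=\mathbf{1}_{\mathcal{F}}\otimes\varphi:\mathcal{F}E\to\mathcal{F}F$, $ax\mapsto a\varphi(x)$; $\varphi$ is completely bounded if $\varphi_\infty$ is bounded, and $\|\varphi\|_{cb}:=\|\varphi_\infty\|$. Fix a unitary isomorphism $\iota$ from the Hilbert tensor square of $L$ onto $L$, and for $a,b\in\mathcal{B}$ put $a\diamondsuit b:=\iota(a\otimes b)\iota^{-1}\in\mathcal{B}$ (where $a\otimes b$ is the Hilbert tensor product of operators). For a bilinear operator $\mathcal{R}:E\times F\to G$ its amplification $\mathcal{R}_\infty:\mathcal{F}E\times\mathcal{F}F\to\mathcal{F}G$ is the bilinear operator well defined by $\mathcal{R}_\infty(ax,by)=(a\diamondsuit b)\mathcal{R}(x,y)$. $\mathcal{R}$ is completely bounded (completely contractive) if $\mathcal{R}_\infty$ is bounded (contractive). Q-algebras and Q-modules. A Q-algebra is a complex associative algebra that is also a Q-space and whose multiplication is a completely contractive bilinear operator. A left Q-module over a Q-algebra $A$ is a left $A$-module that is also a Q-space and whose outer multiplication is a completely contractive bilinear operator. They are called Banach if the Q-space is complete. A morphism of Q-modules is a completely bounded $A$-module map. Standard quantization. For a $C^*$-algebra $A$, the involutive algebra $\mathcal{F}\otimes A$ has a unique norm with the $C^*$-property (the restriction of the norm of the $C^*$-tensor product of the compact operators on $L$ with $A$); this is a Q-norm on $A$, called standard. With it $A$ is a Banach Q-algebra. Relative projectivity. A morphism $\tau:Y\to X$ of Banach Q-modules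 is admissible if there is a completely bounded operator $\rho:X\to Y$ (not necessarily a module morphism) with $\tau\rho=\mathbf{1}_X$. A left Banach Q-module $P$ over a Banach Q-algebra $A$ is relatively projective if for every admissible morphism $\tau:Y\to X$ of left Banach Q-modules over $A$ and every morphism $\varphi:P\to X$ there exists a morphism $\psi:P\to Y$ with $\tau\psi=\varphi$. *)

(* Defs.v *)
From HB Require Import structures.
From mathcomp Require Import all_boot all_order all_algebra.
From mathcomp Require Import generic_quotient sesquilinear complex.
From mathcomp Require Import mathcomp_extra boolp classical_sets functions cardinality.
From mathcomp Require Import reals topology normedtype.

Set Implicit Arguments.
Unset Strict Implicit.
Unset Printing Implicit Defensive.

Import Order.TTheory GRing.Theory Num.Theory.
Import numFieldNormedType.Exports.

Local Open Scope classical_set_scope.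
Local Open Scope ring_scope.
Local Open Scope quotient_scope.

(* A sequence of pairs stands for a finite sum of elementary tensors; [tens_rel]
   is the congruence generated by the bilinearity relations. *)

Section Tensor.
Variables (K : fieldType) (U V : lmodType K).

Inductive tens_rel : seq (U * V) -> seq (U * V) -> Prop :=
| TensRefl s : tens_rel s s
| TensSym s t : tens_rel s t -> tens_rel t s
| TensTrans s t r : tens_rel s t -> tens_rel t r -> tens_rel s r
| TensCat s s' t t' :
    tens_rel s s' -> tens_rel t t' -> tens_rel (s ++ t) (s' ++ t')
| TensCatC s t : tens_rel (s ++ t) (t ++ s)
| TensAddl a b x : tens_rel [:: (a + b, x)] [:: (a, x); (b, x)]
| TensAddr a x y : tens_rel [:: (a, x + y)] [:: (a, x); (a, y)]
| TensScale c a x : tens_rel [:: (c *: a, x)] [:: (a, c *: x)]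
| TensZero x : tens_rel [:: (0, x)] [::].

Definition tens_eq : rel (seq (U * V)) := fun s t => `[< tens_rel s t >].

Lemma tens_eq_refl : reflexive tens_eq.
Proof. by move=> s; apply/asboolP; apply: TensRefl. Qed.

Lemma tens_eq_sym : symmetric tens_eq.
Proof.
by move=> s t; apply/idP/idP => /asboolP st; apply/asboolP; apply: TensSym.
Qed.

Lemma tens_eq_trans : transitive tens_eq.
Proof.
by move=> t s r /asboolP st /asboolP tr; apply/asboolP; apply: TensTrans tr.
Qed.

Canonical tens_equiv := EquivRel tens_eq tens_eq_refl tens_eq_sym tens_eq_trans.

Definition tensor := {eq_quot tens_equiv}.

HB.instance Definition _ := Choice.on tensor.

Definition tens_of (s : seq (U * V)) : tensor := \pi_tensor s.

Definition tens (a : U) (x : V) : tensor := tens_of [:: (a, x)].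

Lemma tens_ofP s t : tens_rel s t <-> tens_of s = tens_of t.
Proof.
split=> [st|/eqmodP/asboolP//].
by apply/eqmodP/asboolP.
Qed.

Lemma tens_ofK (u : tensor) : tens_of (repr u) = u.
Proof. exact: reprK. Qed.

Lemma tens_repr s : tens_rel (repr (tens_of s)) s.
Proof. by apply/tens_ofP; rewrite tens_ofK. Qed.

Definition tens_scale_seq (c : K) (s : seq (U * V)) :=
  [seq (c *: p.1, p.2) | p <- s].

Definition tens_add (u v : tensor) := tens_of (repr u ++ repr v).
Definition tens_scale c (u : tensor) := tens_of (tens_scale_seq c (repr u)).
Definition tens_opp (u : tensor) := tens_scale (- 1) u.

Lemma tens_of_cat s t : tens_of (s ++ t) = tens_add (tens_of s) (tens_of t).
Proof.
by apply/tens_ofP; apply: TensCat; apply: TensSym; apply: tens_repr.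
Qed.

Lemma tens_scale_rel c s t :
  tens_rel s t -> tens_rel (tens_scale_seq c s) (tens_scale_seq c t).
Proof.
elim=> {s t} /=.
- by move=> s; apply: TensRefl.
- by move=> s t _; apply: TensSym.
- by move=> s t r _ st _; apply: TensTrans.
- by move=> s s' t t' _ IH1 _ IH2; rewrite /tens_scale_seq !map_cat; apply: TensCat.
- by move=> s t; rewrite /tens_scale_seq !map_cat; apply: TensCatC.
- by move=> a b x; rewrite scalerDr; apply: TensAddl.
- by move=> a x y; apply: TensAddr.
- by move=> d a x; rewrite scalerA mulrC -scalerA; apply: TensScale.
- by move=> x; rewrite scaler0; apply: TensZero.
Qed.

Lemma tens_of_scale c s : tens_scale c (tens_of s) = tens_of (tens_scale_seq c s).
Proof. by apply/tens_ofP/tens_scale_rel/tens_repr. Qed.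

Lemma tens_addA : associative tens_add.
Proof.
by move=> u v w; rewrite -(tens_ofK u) -(tens_ofK v) -(tens_ofK w) -!tens_of_cat catA.
Qed.

Lemma tens_addC : commutative tens_add.
Proof.
move=> u v; rewrite -(tens_ofK u) -(tens_ofK v) -!tens_of_cat.
by apply/tens_ofP/TensCatC.
Qed.

Lemma tens_add0 : left_id (tens_of [::]) tens_add.
Proof. by move=> u; rewrite -(tens_ofK u) -tens_of_cat. Qed.

Lemma tens_ofE s : tens_of s = \big[tens_add/tens_of [::]]_(p <- s) tens p.1 p.2.
Proof.
elim: s => [|[a x] s IH]; first by rewrite big_nil.
by rewrite big_cons -cat1s tens_of_cat IH.
Qed.

Lemma tens_scaleDl u c d :
  tens_scale (c + d) u = tens_add (tens_scale c u) (tens_scale d u).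
Proof.
rewrite -(tens_ofK u); elim: (repr u) => [|[a x] s IH].
  by rewrite !tens_of_scale tens_add0.
have e b : tens_of (tens_scale_seq b ((a, x) :: s)) =
  tens_add (tens_of [:: (b *: a, x)]) (tens_scale b (tens_of s)).
  by rewrite tens_of_scale -tens_of_cat.
rewrite !(tens_of_scale _ (_ :: _)) !e IH scalerDl.
have -> : tens_of [:: (c *: a + d *: a, x)] =
  tens_add (tens_of [:: (c *: a, x)]) (tens_of [:: (d *: a, x)]).
  by rewrite -tens_of_cat; apply/tens_ofP/TensAddl.
rewrite !tens_addA; congr tens_add.
by rewrite -!tens_addA; congr tens_add; rewrite tens_addC.
Qed.

Lemma tens_scale0 u : tens_scale 0 u = tens_of [::].
Proof.
rewrite -(tens_ofK u) tens_of_scale; apply/tens_ofP.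
elim: (repr u) => [|[a x] s IH] /=; first exact: TensRefl.
rewrite scale0r -cat1s -[X in tens_rel _ X]cat0s.
by apply: TensCat => //; apply: TensZero.
Qed.

Lemma tens_scale1 : left_id 1 tens_scale.
Proof.
move=> u; rewrite -{1}(tens_ofK u) tens_of_scale -[RHS]tens_ofK; congr tens_of.
by elim: (repr u) => //= -[a x] s ->; rewrite scale1r.
Qed.

Lemma tens_scaleA c d u : tens_scale c (tens_scale d u) = tens_scale (c * d) u.
Proof.
rewrite -(tens_ofK u) !tens_of_scale /tens_scale_seq -map_comp; congr tens_of.
by apply: eq_map => p /=; rewrite scalerA.
Qed.

Lemma tens_scaleDr : right_distributive tens_scale tens_add.
Proof.
move=> c u v; rewrite -(tens_ofK u) -(tens_ofK v) -tens_of_cat !tens_of_scale.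
by rewrite -tens_of_cat /tens_scale_seq map_cat.
Qed.

Lemma tens_addN : left_inverse (tens_of [::]) tens_opp tens_add.
Proof.
move=> u; rewrite /tens_opp -{2}(tens_scale1 u) -tens_scaleDl addNr.
exact: tens_scale0.
Qed.

HB.instance Definition _ :=
  GRing.isZmodule.Build tensor tens_addA tens_addC tens_add0 tens_addN.

HB.instance Definition _ := GRing.Zmodule_isLmodule.Build K tensor
  tens_scaleA tens_scale1 tens_scaleDr tens_scaleDl.

End Tensor.

Section TensorTheory.
Variables (K : fieldType) (U V : lmodType K).
Implicit Types (a b : U) (x y : V) (u v : tensor U V).

Lemma tensDl a b x : tens (a + b) x = tens a x + tens b x.
Proof. by rewrite [RHS](esym (tens_of_cat _ _)); apply/tens_ofP/TensAddl. Qed.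

Lemma tensDr a x y : tens a (x + y) = tens a x + tens a y.
Proof. by rewrite [RHS](esym (tens_of_cat _ _)); apply/tens_ofP/TensAddr. Qed.

Lemma tensZl c a x : tens (c *: a) x = c *: tens a x.
Proof. by rewrite [RHS]tens_of_scale. Qed.

Lemma tensZr c a x : tens a (c *: x) = c *: tens a x.
Proof. by rewrite -tensZl; apply/esym/tens_ofP/TensScale. Qed.

Lemma tens_is_bilinear : bilinear_for *:%R *:%R (@tens K U V).
Proof. by split=> ? c ? ? /=; rewrite ?tensDl ?tensDr ?tensZl ?tensZr. Qed.

HB.instance Definition _ :=
  bilinear_isBilinear.Build K U V (tensor U V) *:%R *:%R (@tens K U V)
    tens_is_bilinear.

Lemma tensor_sum u : u = \sum_(p <- repr u) tens p.1 p.2.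
Proof. by rewrite -{1}(tens_ofK u) tens_ofE. Qed.

Lemma tensor_ind (P : tensor U V -> Prop) :
  P 0 -> (forall a x u, P u -> P (tens a x + u)) -> forall u, P u.
Proof.
move=> P0 PS u; rewrite (tensor_sum u).
by elim: (repr u) => [|p s IH]; rewrite ?big_nil ?big_cons //; apply: PS.
Qed.

Variables (W : lmodType K) (B : {bilinear U -> V -> W}).

Definition tlift u : W := \sum_(p <- repr u) B p.1 p.2.

Lemma tlift_rel s t :
  tens_rel s t -> \sum_(p <- s) B p.1 p.2 = \sum_(p <- t) B p.1 p.2.
Proof.
elim=> {s t} /=.
- by [].
- by [].
- by move=> s t r _ -> _ ->.
- by move=> s s' t t' _ IH1 _ IH2; rewrite !big_cat IH1 IH2.
- by move=> s t; rewrite !big_cat /= addrC.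
- by move=> a b x; rewrite !big_cons !big_nil /= !addr0 linearDl.
- by move=> a x y; rewrite !big_cons !big_nil /= !addr0 linearDr.
- by move=> c a x; rewrite !big_cons !big_nil /= linearZl_LR linearZr_LR.
- by move=> x; rewrite !big_cons !big_nil /= linear0l addr0.
Qed.

Lemma tlift_of s : tlift (tens_of s) = \sum_(p <- s) B p.1 p.2.
Proof. exact/tlift_rel/tens_repr. Qed.

Lemma tliftE a x : tlift (tens a x) = B a x.
Proof. by rewrite tlift_of big_seq1. Qed.

Lemma tlift_is_linear : linear tlift.
Proof.
move=> c u v; rewrite -(tens_ofK u) -(tens_ofK v).
rewrite [c *: _]tens_of_scale [X in tlift X](esym (tens_of_cat _ _)) !tlift_of.
rewrite big_cat /= big_map scaler_sumr; congr (_ + _).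
by apply: eq_bigr => p _ /=; rewrite linearZl_LR.
Qed.

HB.instance Definition _ :=
  GRing.isLinear.Build K (tensor U V) W *:%R tlift tlift_is_linear.

End TensorTheory.

Section TensorMap.
Variables (K : fieldType) (U V U' V' : lmodType K).
Variables (f : {linear U -> U'}) (g : {linear V -> V'}).

Definition tmap_fun (a : U) (x : V) : tensor U' V' := tens (f a) (g x).

Lemma tmap_fun_bilinear : bilinear_for *:%R *:%R tmap_fun.
Proof.
split=> z c u v /=; rewrite /tmap_fun linearP.
  by rewrite tensDl tensZl.
by rewrite tensDr tensZr.
Qed.

HB.instance Definition _ := bilinear_isBilinear.Build K U V (tensor U' V')
  *:%R *:%R tmap_fun tmap_fun_bilinear.

Definition tmap : tensor U V -> tensor U' V' := tlift tmap_fun.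

HB.instance Definition _ := GRing.Linear.on tmap.

Lemma tmapE a x : tmap (tens a x) = tens (f a) (g x).
Proof. by rewrite /tmap tliftE. Qed.

End TensorMap.

Section Hilbert.
Variable R : realType.
Local Notation C := R[i].

Record hilbert := Hilbert {
  hilb_car :> completeNormedModType C;
  hdot : {dot hilb_car for (@Num.conj C)};
  hdotE : forall x : hilb_car, hdot x x = `|x| ^+ 2 }.

Definition rnorm (V : normedModType C) (x : V) : R := complex.Re `|x|.

Definition rmod (c : C) : R := complex.Re `|c|.

Definition separable (T : topologicalType) :=
  exists D : set T, countable D /\ dense D.

Definition finite_rank (U V : lmodType C) (a : U -> V) :=
  exists (n : nat) (e : 'I_n -> V),
    forall x, exists c : 'I_n -> C, a x = \sum_(i < n) c i *: e i.

Definition infinite_dimensional (V : lmodType C) := ~ finite_rank (@idfun V).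

Definition bounded_op (U V : normedModType C) (a : U -> V) :=
  exists M : R, forall x, rnorm (a x) <= M * rnorm x.

Record bop (H : hilbert) := Bop {
  bop_fun :> {linear H -> H};
  bop_bounded : bounded_op bop_fun }.

Definition op_norm (H : hilbert) (a : bop H) : R :=
  sup [set rnorm (a x) | x in [set x : H | rnorm x <= 1]].

Definition op_adjoint (H : hilbert) (a b : H -> H) :=
  forall x y, hdot _ (a x) y = hdot _ x (b y).

Definition oprojection (H : hilbert) (P : H -> H) :=
  (forall x, P (P x) = P x) /\ op_adjoint P P.

End Hilbert.

Section FinOp.
Variables (R : realType) (H : hilbert R).
Local Notation C := R[i].

Definition fin_pred : {pred (H -> H)} :=
  fun a => `[< [/\ linear a, bounded_op a & finite_rank a] >].

Lemma rnormD (V : normedModType C) (x y : V) :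
  rnorm (x + y) <= rnorm x + rnorm y.
Proof.
rewrite /rnorm -raddfD /=; have := ler_normD x y.
by rewrite lecE => /andP[].
Qed.

Lemma rmodM c d : rmod (c * d : C) = rmod c * rmod d.
Proof.
rewrite /rmod normrM [`|c|]complexE [`|d|]complexE /=.
by rewrite !(mul0r, mulr0, subr0, addr0).
Qed.

Lemma rnormZ (V : normedModType C) c (x : V) :
  rnorm (c *: x) = rmod c * rnorm x.
Proof.
rewrite /rnorm /rmod normrZ.
have /ger0_Im nx : 0 <= `|x| by [].
rewrite [`|x|]complexE [`|c|]complexE nx /=.
by rewrite !(mul0r, mulr0, subr0, addr0).
Qed.

Lemma rnorm_ge0 (V : normedModType C) (x : V) : 0 <= rnorm x.
Proof. by have := normr_ge0 x; rewrite lecE => /andP[]. Qed.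

Lemma rmod_ge0 (c : C) : 0 <= rmod c.
Proof. by have := normr_ge0 c; rewrite lecE => /andP[]. Qed.

Lemma fin_submod_closed : submod_closed fin_pred.
Proof.
split=> [|c a b].
  apply/asboolP; split.
  - by move=> d x y /=; rewrite /GRing.zero /= scaler0 addr0.
  - by exists 0 => x; rewrite mul0r /rnorm normr0.
  - exists 0, (fun=> 0) => x; exists (fun=> 0).
    by rewrite big_ord0.
move=> /asboolP[la [M aM] [m [e ae]]] /asboolP[lb [N bN] [n [f bf]]].
apply/asboolP; split.
- move=> d x y; rewrite !addrfctE !scalrfctE la lb !scalerDr !scalerA mulrC.
  rewrite -!addrA; congr (_ + _).
  by rewrite addrCA.
- exists (rmod c * M + N) => x; rewrite addrfctE scalrfctE.
  rewrite (le_trans (rnormD _ _))// mulrDl lerD// rnormZ -mulrA.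
  by rewrite ler_wpM2l// rmod_ge0.
- exists (m + n)%N, (fun i => match fintype.split i with inl j => e j | inr j => f j end).
  move=> x; have [s as_] := ae x; have [t bt] := bf x.
  exists (fun i => match fintype.split i with inl j => c * s j | inr j => t j end).
  rewrite addrfctE scalrfctE as_ bt big_split_ord /= scaler_sumr.
  by congr (_ + _); apply: eq_bigr => i _;
    rewrite ?(unsplitK (inl _)) ?(unsplitK (inr _)) ?scalerA.
Qed.

HB.instance Definition _ := GRing.isSubmodClosed.Build C (H -> H) fin_pred
  fin_submod_closed.

Definition fin_op := {a : H -> H | a \in fin_pred}.

HB.instance Definition _ := Choice.on fin_op.
HB.instance Definition _ := SubType.on fin_op.
HB.instance Definition _ := [SubChoice_isSubLmodule of fin_op by <:].

Definition fin_fun (a : fin_op) : H -> H := val a.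

Coercion fin_fun : fin_op >-> Funclass.

Lemma fin_opP (a : fin_op) : [/\ linear a, bounded_op a & finite_rank a].
Proof. by apply/asboolP; exact: (valP a). Qed.

Lemma fin_linear (a : fin_op) : linear a.
Proof. by case: (fin_opP a). Qed.

HB.instance Definition _ (a : fin_op) :=
  GRing.isLinear.Build C H H *:%R (fin_fun a) (fin_linear a).

Lemma fin_op_ext (a b : fin_op) : a =1 b -> a = b.
Proof. by move=> ab; apply/val_inj/funext. Qed.

Definition mk_fin (a : H -> H) (la : linear a) (ba : bounded_op a)
  (fa : finite_rank a) : fin_op := exist _ a (asboolT (And3 la ba fa)).

Lemma bounded_op_ge0 (U V : normedModType C) (a : U -> V) : bounded_op a ->
  exists2 M : R, 0 <= M & forall x, rnorm (a x) <= M * rnorm x.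
Proof.
case=> M aM; exists `|M| => // x; apply: (le_trans (aM x)).
by rewrite ler_wpM2r ?rnorm_ge0 ?ler_norm.
Qed.

Lemma bounded_op_comp (a b : H -> H) :
  bounded_op a -> bounded_op b -> bounded_op (a \o b).
Proof.
move=> /bounded_op_ge0[M M0 aM] [N bN]; exists (M * N) => x.
by rewrite (le_trans (aM _))// -mulrA ler_wpM2l.
Qed.

Lemma linear_compf (a b : H -> H) : linear a -> linear b -> linear (a \o b).
Proof. by move=> la lb c x y /=; rewrite lb la. Qed.

Lemma finite_rank_compl (a : {linear H -> H}) (b : H -> H) :
  finite_rank b -> finite_rank (a \o b).
Proof.
move=> [n [e be]]; exists n, (a \o e) => x; have [c /= ->] := be x.
by exists c; rewrite linear_sum; apply: eq_bigr => i _; rewrite linearZ.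
Qed.

Lemma finite_rank_compr (a b : H -> H) : finite_rank a -> finite_rank (a \o b).
Proof. by move=> [n [e ae]]; exists n, e => x; exact: ae. Qed.

Definition fin_lmul (a : bop H) (b : fin_op) : fin_op :=
  mk_fin (linear_compf (linearP a) (fin_linear b))
    (bounded_op_comp (bop_bounded a) (let: And3 _ bd _ := fin_opP b in bd))
    (finite_rank_compl a (let: And3 _ _ fr := fin_opP b in fr)).

Definition fin_rmul (a : bop H) (b : fin_op) : fin_op :=
  mk_fin (linear_compf (fin_linear b) (linearP a))
    (bounded_op_comp (let: And3 _ bd _ := fin_opP b in bd) (bop_bounded a))
    (finite_rank_compr a (let: And3 _ _ fr := fin_opP b in fr)).

Lemma fin_lmul_linear a : linear (fin_lmul a).
Proof.
move=> c b b'; apply: fin_op_ext => x.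
rewrite /fin_lmul /fin_fun /= !(addrfctE, scalrfctE) /=.
exact: linearP.
Qed.

Lemma fin_rmul_linear a : linear (fin_rmul a).
Proof. by move=> c b b'; apply: fin_op_ext. Qed.

HB.instance Definition _ a :=
  GRing.isLinear.Build C fin_op fin_op *:%R (fin_lmul a) (fin_lmul_linear a).
HB.instance Definition _ a :=
  GRing.isLinear.Build C fin_op fin_op *:%R (fin_rmul a) (fin_rmul_linear a).

Definition fin_bop (a : fin_op) : bop H :=
  Bop (bop_fun := fin_fun a) (let: And3 _ bd _ := fin_opP a in bd).

Definition rank_one_projection (p : fin_op) :=
  oprojection p /\
  exists2 e : H, e != 0 & range p = [set c *: e | c in setT].

Definition fin_tensor (E : lmodType C) := tensor fin_op E.

Definition flmul E (a : bop H) : {linear fin_tensor E -> fin_tensor E} :=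
  tmap (fin_lmul a) (@idfun E).

Definition frmul E (a : bop H) : {linear fin_tensor E -> fin_tensor E} :=
  tmap (fin_rmul a) (@idfun E).

Definition ampl (E F : lmodType C) (phi : {linear E -> F}) :
    {linear fin_tensor E -> fin_tensor F} :=
  tmap (@idfun fin_op) phi.

End FinOp.

Section Slices.
Variables (R : realType) (H : hilbert R) (E : lmodType R[i]).
Implicit Types (u : fin_tensor H E) (z w : H).

Definition slice_fun z w (a : fin_op H) (x : E) : E := hdot H (a z) w *: x.

Lemma slice_fun_bilinear z w : bilinear_for *:%R *:%R (slice_fun z w).
Proof.
split=> [x c a b|a c x y] /=; rewrite /slice_fun; last first.
  by rewrite scalerDr !scalerA mulrC.
have -> : fin_fun (c *: a + b) z = c *: fin_fun a z + fin_fun b z by [].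
by rewrite linearPl scalerDl scalerA.
Qed.

HB.instance Definition _ z w := bilinear_isBilinear.Build R[i] (fin_op H) E E
  *:%R *:%R (slice_fun z w) (slice_fun_bilinear z w).

Definition slice z w : {linear fin_tensor H E -> E} := tlift (slice_fun z w).

Lemma slice_eq0 u : (forall z w, slice z w u = 0) -> u = 0.
Proof.
have slE z w s : slice z w (tens_of s) = \sum_(p <- s) slice_fun z w p.1 p.2.
  exact: tlift_of.
suff H0 n (a : 'I_n -> fin_op H) (x : 'I_n -> E) :
    (forall z w, \sum_(i < n) slice_fun z w (a i) (x i) = 0) ->
    \sum_(i < n) tens (a i) (x i) = 0.
  move=> u0; rewrite (tensor_sum u) (big_nth (0, 0)) big_mkord; apply: H0 => z w.
  rewrite -[RHS](u0 z w) -[in RHS](tens_ofK u) slE.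
  by rewrite [RHS](big_nth (0, 0)) big_mkord.
elim: n a x => [|n IH] a x ax0; first by rewrite big_ord0.
have [a0|an0] := eqVneq (a ord_max) 0.
  rewrite big_ord_recr /= a0 linear0l addr0; apply: IH => z w.
  have := ax0 z w; rewrite big_ord_recr /= a0.
  by rewrite linear0l addr0.
have [z [w azw]] : exists z w, hdot H (a ord_max z) w != 0.
  apply: contrapT => aN; case/eqP: an0; apply: fin_op_ext => z.
  apply/eqP; rewrite -normr_eq0 -sqrf_eq0 -hdotE; apply: contrapT => /negP ne0.
  by apply: aN; exists z, (a ord_max z).
pose d i := hdot H (a i z) w / hdot H (a ord_max z) w.
pose b (i : 'I_n) := a (widen_ord (leqnSn n) i).
pose y (i : 'I_n) := x (widen_ord (leqnSn n) i).
pose e (i : 'I_n) := d (widen_ord (leqnSn n) i).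
have xn : x ord_max = - \sum_(i < n) e i *: y i.
  have := ax0 z w; rewrite big_ord_recr /= {2}/slice_fun => /eqP.
  rewrite addrC addr_eq0 => /eqP/(congr1 ( *:%R (hdot H (a ord_max z) w)^-1)).
  rewrite scalerA mulVf// scale1r => ->; rewrite scalerN scaler_sumr.
  by congr (- _); apply: eq_bigr => i _; rewrite scalerA mulrC.
have key (W : lmodType R[i]) (B : {bilinear fin_op H -> E -> W}) :
    \sum_(i < n.+1) B (a i) (x i) =
    \sum_(i < n) B (b i - e i *: a ord_max) (y i).
  rewrite big_ord_recr /= xn linearNr linear_sumr -sumrB; apply: eq_bigr => i _.
  by rewrite linearBl linearZl_LR linearZr_LR.
rewrite (key _ (@tens _ _ _)); apply: IH => z' w'.
rewrite -(key _ (slice_fun z' w')); exact: ax0.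
Qed.

End Slices.

Lemma slice_ampl (R : realType) (H : hilbert R) (E F : lmodType R[i])
  (phi : {linear E -> F}) (z w : H) (u : fin_tensor H E) :
  slice _ z w (ampl H phi u) = phi (slice _ z w u).
Proof.
elim/tensor_ind: u => [|a x u IH]; first by rewrite !linear0.
rewrite !linearD IH /=; congr (_ + _).
by rewrite tmapE !tliftE /= /slice_fun linearZ.
Qed.

Lemma ampl_inj (R : realType) (H : hilbert R) (E F : lmodType R[i])
  (phi : {linear E -> F}) : injective phi -> injective (ampl H phi).
Proof.
move=> phiI u v /eqP; rewrite -subr_eq0 -linearB => /eqP uv0.
apply/eqP; rewrite -subr_eq0; apply/eqP/slice_eq0 => z w.
by apply: phiI; rewrite -slice_ampl uv0 !linear0.
Qed.

Section QSpace.
Variables (R : realType) (L : hilbert R).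
Local Notation C := R[i].

Definition is_support (E : lmodType C) (P : bop L) (u : fin_tensor L E) :=
  [/\ oprojection P, flmul E P u = u & frmul E P u = u].

Record is_qnorm (E : lmodType C) (q : fin_tensor L E -> R) : Prop := IsQnorm {
  qnorm_triangle : forall u v, q (u + v) <= q u + q v;
  qnorm_scale : forall c u, q (c *: u) = rmod c * q u;
  qnorm_definite : forall u, q u = 0 -> u = 0;
  qnorm_bimodule : forall (a b : bop L) u,
    q (flmul E a (frmul E b u)) <= op_norm a * q u * op_norm b;
  qnorm_orthogonal : forall (P Q : bop L) u v,
    is_support P u -> is_support Q v ->
    (forall x, P (Q x) = 0) -> (forall x, Q (P x) = 0) ->
    q (u + v) = Num.max (q u) (q v) }.

Record qspace := QSpace {
  qs_car :> lmodType C;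
  qnorm : fin_tensor L qs_car -> R;
  qnormP : is_qnorm qnorm }.

Definition underlying_norm (E : qspace) (p : fin_op L) (x : E) : R :=
  qnorm (tens p x).

Definition complete_for (E : lmodType C) (nrm : E -> R) :=
  forall s : nat -> E,
    (forall eps : R, 0 < eps -> exists N, forall m n, (N <= m)%N -> (N <= n)%N ->
       nrm (s m - s n) < eps) ->
    exists l, forall eps : R, 0 < eps -> exists N, forall n, (N <= n)%N ->
       nrm (s n - l) < eps.

(* The underlying norm does not depend on the rank one projection [p]. *)
Definition q_complete (E : qspace) :=
  forall p, rank_one_projection p -> complete_for (@underlying_norm E p).

Definition completely_bounded (E F : qspace) (phi : {linear E -> F}) :=
  exists M : R, forall u, qnorm (ampl L phi u) <= M * qnorm u.

Section Subspace.
Variables (F : qspace) (E : lmodType C) (i : {linear E -> F}).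
Hypothesis iI : injective i.

Lemma ampl_flmul a (u : fin_tensor L E) :
  ampl L i (flmul E a u) = flmul F a (ampl L i u).
Proof.
elim/tensor_ind: u => [|b x u IH]; first by rewrite !linear0.
by rewrite !linearD IH /= !tmapE.
Qed.

Lemma ampl_frmul a (u : fin_tensor L E) :
  ampl L i (frmul E a u) = frmul F a (ampl L i u).
Proof.
elim/tensor_ind: u => [|b x u IH]; first by rewrite !linear0.
by rewrite !linearD IH /= !tmapE.
Qed.

Lemma ampl_support P (u : fin_tensor L E) :
  is_support P u -> is_support P (ampl L i u).
Proof. by case=> PP Pu uP; split=> //; rewrite -?ampl_flmul -?ampl_frmul ?Pu ?uP. Qed.

Lemma sub_is_qnorm : is_qnorm (fun u : fin_tensor L E => qnorm (ampl L i u)).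
Proof.
have [tri sc df bi ort] := qnormP F; split=> /=.
- by move=> u v; rewrite linearD; apply: tri.
- by move=> c u; rewrite linearZ; apply: sc.
- by move=> u /df u0; apply: (ampl_inj iI); rewrite linear0; exact: u0.
- by move=> a b u; rewrite ampl_flmul ampl_frmul; apply: bi.
- move=> P Q u v /ampl_support Pu /ampl_support Qv PQ QP.
  by rewrite linearD; apply: (ort P Q).
Qed.

Definition sub_qspace : qspace := QSpace sub_is_qnorm.

End Subspace.

End QSpace.

Section Setting.
Variable R : realType.
Local Notation C := R[i].

(* The Hilbert tensor product, i.e. the completion of the algebraic one for
   the inner product multiplicative on elementary tensors: it is determined,
   up to a unique unitary isomorphism, by the conditions below. *)
Record hilbert_tensor (H K : hilbert R) := HilbertTensor {
  ht_space :> hilbert R;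
  ht_tens : {bilinear H -> K -> ht_space};
  ht_dot : forall x x' y y', hdot ht_space (ht_tens x y) (ht_tens x' y') =
                             hdot H x x' * hdot K y y';
  ht_dense : dense [set u : ht_space | exists s : seq (H * K),
                      u = \sum_(p <- s) ht_tens p.1 p.2] }.

(* At most one operator satisfies the conditions below, by density. *)
Definition op_tensor (H K : hilbert R) (T : hilbert_tensor H K)
    (a : H -> H) (b : K -> K) : T -> T :=
  xget 0 [set c : T -> T | [/\ linear c, bounded_op c &
    forall x y, c (ht_tens T x y) = ht_tens T (a x) (b y)]].

Record setting := Setting {
  st_L :> hilbert R;
  st_separable : separable st_L;
  st_infinite : infinite_dimensional st_L;
  st_square : hilbert_tensor st_L st_L;
  st_iota : {linear st_square -> st_L};
  st_iotaV : st_L -> st_square;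
  st_iotaK : cancel st_iota st_iotaV;
  st_iotaVK : cancel st_iotaV st_iota;
  st_unitary : forall u v, hdot st_L (st_iota u) (st_iota v) =
                           hdot st_square u v }.

Variable S : setting.

(* [insubd 0] only recasts the operator, which has finite rank when [a] and
   [b] do, as an element of [fin_op S]. *)
Definition diamond (a b : fin_op S) : fin_op S :=
  insubd (0 : fin_op S)
    (fun x => st_iota S (@op_tensor _ _ (st_square S) a b (st_iotaV x))).

(* There is exactly one such [Bi]. *)
Definition is_bilinear_ampl (E F G : lmodType C) (B : E -> F -> G)
    (Bi : fin_tensor S E -> fin_tensor S F -> fin_tensor S G) :=
  bilinear_for *:%R *:%R Bi /\
  forall a b x y, Bi (tens a x) (tens b y) = tens (diamond a b) (B x y).

Definition completely_contractive (E F G : qspace S) (B : E -> F -> G) :=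
  exists2 Bi, is_bilinear_ampl B Bi &
    forall u v, qnorm (Bi u v) <= qnorm u * qnorm v.

End Setting.

Section QModules.
Variables (R : realType) (S : setting R).

Record mul_qspace := MulQSpace {
  mq_space :> qspace S;
  mq_mul : {bilinear mq_space -> mq_space -> mq_space} }.

Definition banach_qalgebra (A : mul_qspace) :=
  [/\ associative (mq_mul A), completely_contractive (mq_mul A) & q_complete A].

Record act_qspace (A : mul_qspace) := ActQSpace {
  aq_space :> qspace S;
  aq_act : {bilinear A -> aq_space -> aq_space} }.

Definition banach_left_qmodule (A : mul_qspace) (X : act_qspace A) :=
  [/\ forall a b x, aq_act X (mq_mul A a b) x = aq_act X a (aq_act X b x),
      completely_contractive (aq_act X) & q_complete X].

Definition qmorphism (A : mul_qspace) (X Y : act_qspace A)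
    (phi : {linear X -> Y}) :=
  completely_bounded phi /\
  forall a x, phi (aq_act X a x) = aq_act Y a (phi x).

Definition admissible (A : mul_qspace) (Y X : act_qspace A)
    (tau : {linear Y -> X}) :=
  exists2 rho : {linear X -> Y}, completely_bounded rho & cancel rho tau.

Definition relatively_projective (A : mul_qspace) (P : act_qspace A) :=
  [/\ banach_qalgebra A, banach_left_qmodule P &
      forall (X Y : act_qspace A) (tau : {linear Y -> X}) (phi : {linear P -> X}),
        banach_left_qmodule X -> banach_left_qmodule Y ->
        qmorphism tau -> admissible tau -> qmorphism phi ->
        exists2 psi : {linear P -> Y}, qmorphism psi & tau \o psi =1 phi].

End QModules.

Section CStar.
Variable R : realType.
Local Notation C := R[i].

(* Not necessarily unital. *)
Record cstar_algebra := CStarAlgebra {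
  cs_car :> completeNormedModType C;
  cs_mul : {bilinear cs_car -> cs_car -> cs_car};
  cs_star : cs_car -> cs_car;
  cs_mulA : associative cs_mul;
  cs_normM : forall x y, `|cs_mul x y| <= `|x| * `|y|;
  cs_starP : forall c x y, cs_star (c *: x + y) = c^* *: cs_star x + cs_star y;
  cs_starK : involutive cs_star;
  cs_starM : forall x y, cs_star (cs_mul x y) = cs_mul (cs_star y) (cs_star x);
  cs_cstar : forall x, `|cs_mul (cs_star x) x| = `|x| ^+ 2 }.

Variables (S : setting R) (A : cstar_algebra).
Local Notation FA := (fin_tensor S A).

Definition is_fin_mul (m : FA -> FA -> FA) :=
  bilinear_for *:%R *:%R m /\
  forall a b x y, m (tens a x) (tens b y) =
    tens (fin_lmul (fin_bop a) b) (cs_mul A x y).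

Definition is_fin_star (st : FA -> FA) :=
  (forall u v, st (u + v) = st u + st v) /\
  forall (a b : fin_op S) x, op_adjoint a b ->
    st (tens a x) = tens b (cs_star x).

(* The C*-norm on the amplification of a C*-algebra is unique; [m] and [st] are
   uniquely determined too, since elementary tensors span and bounded
   operators have adjoints. *)
Record standard_quantization := StandardQuantization {
  sq_norm : FA -> R;
  sq_qnorm : is_qnorm sq_norm;
  sq_cstar : exists m st, [/\ is_fin_mul m, is_fin_star st,
    forall u v, sq_norm (m u v) <= sq_norm u * sq_norm v &
    forall u, sq_norm (m (st u) u) = sq_norm u ^+ 2] }.

Definition std_qspace (q : standard_quantization) : qspace S :=
  QSpace (sq_qnorm q).

Definition std_qalgebra (q : standard_quantization) : mul_qspace S :=
  @MulQSpace R S (std_qspace q) (cs_mul A).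

Record closed_left_ideal := ClosedLeftIdeal {
  li_set :> set A;
  li_submod : 0 \in li_set /\
    forall c x y, x \in li_set -> y \in li_set -> c *: x + y \in li_set;
  li_mul : forall a x, x \in li_set -> cs_mul A a x \in li_set;
  li_closed : closed li_set }.

Section Ideal.
Variable I : closed_left_ideal.

Definition li_pred : {pred A} := fun x => x \in li_set I.

Lemma li_submod_closed : submod_closed li_pred.
Proof. by case: (li_submod I) => I0 IP; split. Qed.

HB.instance Definition _ := GRing.isSubmodClosed.Build C A li_pred
  li_submod_closed.

Definition li_type := {x : A | x \in li_pred}.

HB.instance Definition _ := Choice.on li_type.
HB.instance Definition _ := SubType.on li_type.
HB.instance Definition _ := [SubChoice_isSubLmodule of li_type by <:].

Definition li_incl : {linear li_type -> A} := \val.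

Definition li_act (a : A) (x : li_type) : li_type :=
  exist _ (cs_mul A a (val x)) (li_mul a (valP x)).

Lemma li_act_bilinear : bilinear_for *:%R *:%R li_act.
Proof.
by split=> z c x y; apply: val_inj; rewrite /= ?linearPl ?linearPr.
Qed.

HB.instance Definition _ := bilinear_isBilinear.Build C A li_type li_type
  *:%R *:%R li_act li_act_bilinear.

Definition ideal_qspace (q : standard_quantization) : qspace S :=
  @sub_qspace R S (std_qspace q) li_type li_incl val_inj.

Definition ideal_qmodule (q : standard_quantization) :
    act_qspace (std_qalgebra q) :=
  @ActQSpace R S (std_qalgebra q) (ideal_qspace q) li_act.

End Ideal.

End CStar.

(* Main.v *)
Require Import Defs.
From HB Require Import structures.
From mathcomp Require Import all_boot all_order all_algebra.
From mathcomp Require Import sesquilinear complex ring lra.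
From mathcomp Require Import boolp classical_sets cardinality.
From mathcomp Require Import reals topology normedtype.

(** Let [rho] be a completely bounded section of [tau] and [sigma = rho \o phi]. If [I]
   had a self-adjoint element [d] with [x = x d d] for all [x], the module map
   [psi x = (x d) . sigma d] would be completely bounded and lift [phi], because
   [tau (psi x) = (x d) . phi d = phi (x d d)]. In general a sequence [d k] of
   self-adjoint elements of [I] plays this role, with [x = \sum_k x (d k) (d k)] for [x]
   in [I] and
     [psi x = \sum_k (x (d k)) . sigma (d k)].

   The difficulty is the complete boundedness of [psi]. The outer multiplication is
   contractive only after amplification by the diamond, so that the norm of a sum of
   terms cannot be bounded through rows and columns. Instead, a finite sum of this form
   is the mean, over all choices of signs, of the maps [x -> (x D) . sigma D] with
   [D = \sum_k +- d k] ([diagonal_le]), and each of these is completely bounded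
   by the square of the norm of [D] times the bound of [sigma] ([piece_le]). So it is
   enough that the signed sums of the [d k] are bounded ([partial_lift_le]).

   Such a sequence is found in [bounded_partition]. Separability gives a strictly
   positive [h] in [I] ([strictly_positive]); functions [U k] of [h] with [x (U k)]
   tending to [x] for [x] in [I] are obtained from averages of powers of [1 - h^2], and
   [d k] is the product of [U k] and of the [sqrt (1 - U j ^2)], [j < k]. The squares
   then telescope ([sum_bumps]), and if the [U k] grow fast enough with [k], [d j] and
   [d k] are almost orthogonal as soon as [j + 2 <= k]. Signed sums over the indices of
   one parity then have a square close to the sum of the squares, which is at most the
   unit.

   The C*-theory behind this is elementary, without spectra: all functions are obtained
   from sums, products and the square root [sqrt_exists] given by an iteration. The
   contractivity of square roots comes from unitaries ([rotation_contraction]), and the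
   inequality [0 <= a <= b -> |a| <= |b|], for sums of squares, from the quantization
   itself: a sum of squares is the square of a column, and cutting a column down is
   multiplication by a projection ([sum_squares_le]).

   Two facts connect the quantization with [A]. A C*-norm on a C*-algebra is unique
   ([cnorm_unique]), so the underlying norm of the standard quantization is the norm of
   [A], and completeness follows. The diamond product of [u] and [v] is the product in
   the amplified algebra of [u] tensored with a support of [v] and of a support of [u]
   tensored with [v]; by the axiom on orthogonal supports these two factors have norms
   at most those of [u] and [v], so multiplication is completely contractive
   ([mul_contractive]). *)

Set Implicit Arguments.
Unset Strict Implicit.
Unset Printing Implicit Defensive.

Import Order.TTheory GRing.Theory Num.Theory.
Import numFieldNormedType.Exports.

Local Open Scope classical_set_scope.
Local Open Scope ring_scope.

(** * Seminorms and convergence of sequences *)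

Section Seminorms.
Variable R : realType.
Local Notation C := R[i].

Record seminorm (E : lmodType C) (nu : E -> R) : Prop := Seminorm {
  semiD : forall x y, nu (x + y) <= nu x + nu y;
  semiZ : forall c x, nu (c *: x) = rmod c * nu x }.

Lemma rmod_real (r : R) : rmod (r%:C)%C = `|r|.
Proof. by rewrite /rmod normc_def /= expr0n addr0 sqrtr_sqr. Qed.

Lemma rmodE (c : C) : (rmod c)%:C%C = `|c|.
Proof. by rewrite /rmod normc_def. Qed.

Lemma rmodN1 : rmod (-1 : C) = 1.
Proof. by rewrite /rmod normrN1. Qed.

Lemma rmod1 : rmod (1 : C) = 1.
Proof. by rewrite /rmod normr1. Qed.

Lemma rmod0 : rmod (0 : C) = 0.
Proof. by rewrite /rmod normr0. Qed.

Lemma rmod_nat n : rmod (n%:R : C) = n%:R.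
Proof. by rewrite -(rmorph_nat (real_complex R)) rmod_real ger0_norm. Qed.

Lemma rmodV (c : C) : rmod c^-1 = (rmod c)^-1.
Proof.
have [->|c0] := eqVneq c 0; first by rewrite invr0 rmod0 invr0.
have cc : rmod c * rmod c^-1 = 1 by rewrite -rmodM divff // rmod1.
have c1 : rmod c != 0 by apply/eqP => z; move: cc; rewrite z mul0r => /esym/eqP; rewrite oner_eq0.
by rewrite -[LHS](mulKf c1) cc mulr1.
Qed.

Lemma half_add (V : lmodType C) (x : V) : (2^-1 : C) *: (x + x) = x.
Proof.
have -> : x + x = (2 : C) *: x by rewrite scaler_nat mulr2n.
by rewrite scalerA mulVf ?scale1r // pnatr_eq0.
Qed.

Section SeminormTheory.
Variables (E : lmodType C) (nu : E -> R).
Hypothesis nuP : seminorm nu.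

Lemma semi0 : nu 0 = 0.
Proof. by rewrite -(scale0r 0) (semiZ nuP) rmod0 mul0r. Qed.

Lemma semiN x : nu (- x) = nu x.
Proof. by rewrite -scaleN1r (semiZ nuP) rmodN1 mul1r. Qed.

Lemma semi_ge0 x : 0 <= nu x.
Proof. by have := semiD nuP x (- x); rewrite subrr semi0 semiN; lra. Qed.

Lemma semi_sum I (r : seq I) (P : pred I) (F : I -> E) :
  nu (\sum_(i <- r | P i) F i) <= \sum_(i <- r | P i) nu (F i).
Proof.
elim/big_rec2: _ => [|i y x _ le]; first by rewrite semi0.
by rewrite (le_trans (semiD nuP _ _)) // lerD2l.
Qed.

Lemma semiB x y : nu (x - y) <= nu x + nu y.
Proof. by rewrite -(semiN y) (semiD nuP). Qed.

Lemma semi_distC x y : nu (x - y) = nu (y - x).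
Proof. by rewrite -semiN opprB. Qed.

Lemma semi_tri x y z : nu (x - z) <= nu (x - y) + nu (y - z).
Proof. by rewrite -[x - z](subrKA y) (semiD nuP). Qed.

Lemma semiMn x n : nu (x *+ n) = nu x *+ n.
Proof. by rewrite -scaler_nat (semiZ nuP) rmod_nat mulr_natl. Qed.

End SeminormTheory.

Definition cv (E : lmodType C) (nu : E -> R) (s : nat -> E) (l : E) :=
  forall eps : R, 0 < eps -> exists N, forall n, (N <= n)%N -> nu (s n - l) < eps.

Definition cauchy_for (E : lmodType C) (nu : E -> R) (s : nat -> E) :=
  forall eps : R, 0 < eps -> exists N, forall m n, (N <= m)%N -> (N <= n)%N ->
    nu (s m - s n) < eps.

Section Convergence.
Variables (E : lmodType C) (nu : E -> R).
Hypothesis nuP : seminorm nu.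
Implicit Types (s t : nat -> E) (l : E).

Lemma cvD s t l l' : cv nu s l -> cv nu t l' -> cv nu (fun n => s n + t n) (l + l').
Proof.
move=> sl tl e e0; have e2 : 0 < e / 2 by lra.
have [N1 H1] := sl _ e2; have [N2 H2] := tl _ e2.
exists (maxn N1 N2) => n; rewrite geq_max => /andP[/H1 h1 /H2 h2].
rewrite opprD addrACA (le_lt_trans (semiD nuP _ _)) //; lra.
Qed.

Lemma cv_lip (F : lmodType C) (mu : F -> R) (f : E -> F) (M : R) s l :
  (forall x y, mu (f x - f y) <= M * nu (x - y)) -> cv nu s l -> cv mu (f \o s) (f l).
Proof.
move=> fM sl e e0; have M1 : 0 < `|M| + 1 by rewrite ltr_wpDl.
have [N HN] := sl (e / (`|M| + 1)) (divr_gt0 e0 M1); exists N => n /HN.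
rewrite ltr_pdivlMr // => h; rewrite (le_lt_trans _ h) // (le_trans (fM _ _)) //.
rewrite mulrC ler_wpM2l ?(semi_ge0 nuP) //.
by rewrite (le_trans (ler_norm _)) // lerDl.
Qed.

Lemma cv_unique s l l' : (forall x, nu x = 0 -> x = 0) ->
  cv nu s l -> cv nu s l' -> l = l'.
Proof.
move=> df sl sl'; apply/eqP; rewrite -subr_eq0; apply/eqP/df/eqP.
rewrite eq_le (semi_ge0 nuP) andbT leNgt; apply/negP => h.
have h2 : 0 < nu (l - l') / 2 by lra.
have [N1 H1] := sl _ h2; have [N2 H2] := sl' _ h2.
have {H1} := H1 _ (leq_maxl N1 N2); have {H2} := H2 _ (leq_maxr N1 N2).
have := semi_tri nuP l (s (maxn N1 N2)) l'; rewrite (semi_distC nuP l (s _)); lra.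
Qed.

Lemma cv_le s l M N : (forall n, (N <= n)%N -> nu (s n) <= M) -> cv nu s l -> nu l <= M.
Proof.
move=> sM sl; apply/ler_addgt0Pr => e e0; have [N1 H1] := sl _ e0.
have := H1 _ (leq_maxl N1 N); have := sM _ (leq_maxr N1 N).
set n := maxn _ _; have := semiB nuP (s n) (s n - l); rewrite subKr; lra.
Qed.

Lemma cv_comp s l (f : nat -> nat) : (forall n, (n <= f n)%N) -> cv nu s l ->
  cv nu (s \o f) l.
Proof.
move=> ff sl e e0; have [N HN] := sl _ e0; exists N => n Nn /=.
by apply: HN; apply: leq_trans (ff n).
Qed.

Lemma cauchy_mono s : (forall eps : R, 0 < eps -> exists N, forall n k, (N <= n)%N ->
    nu (s (n + k)%N - s n) < eps) -> cauchy_for nu s.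
Proof.
move=> H e e0; have [N HN] := H _ e0; exists N => m n Nm Nn.
wlog nm : m n Nm Nn / (n <= m)%N.
  by move=> W; case/orP: (leq_total n m) => h; [|rewrite (semi_distC nuP)]; apply: W.
by rewrite -(subnKC nm); apply: HN.
Qed.

End Convergence.

Definition invS (n : nat) : R := n.+1%:R^-1.

Lemma invS_gt0 n : 0 < invS n.
Proof. by rewrite invr_gt0 ltr0n. Qed.

Lemma small_inv (e : R) : 0 < e -> exists N, forall n, (N <= n)%N -> invS n < e.
Proof.
rewrite /invS.
move=> e0; exists (Num.truncn e^-1) => n Nn.
have h : e^-1 < n.+1%:R.
  by rewrite (lt_le_trans (truncnS_gt _)) // ler_nat ltnS.
by rewrite -[e]invrK ltf_pV2 // posrE // invr_gt0.
Qed.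

Lemma pow_half_lt n : (2^-1 : R) ^+ n <= invS n.
Proof.
rewrite /invS exprVn lef_pV2 ?posrE ?exprn_gt0 ?ltr0n //.
by rewrite -natrX ler_nat; exact: ltn_expl.
Qed.

Lemma rnormE (V : normedModType C) (x : V) : (rnorm x)%:C%C = `|x|.
Proof. by rewrite /rnorm RRe_real // ger0_real. Qed.

Lemma rnorm_seminorm (V : normedModType C) : seminorm (@rnorm R V).
Proof. by split=> *; rewrite ?rnormD ?rnormZ. Qed.

Lemma rnorm_eq0 (V : normedModType C) (x : V) : rnorm x = 0 -> x = 0.
Proof. by move=> x0; apply/eqP; rewrite -normr_eq0 -rnormE x0. Qed.

Lemma rnorm_ball (V : normedModType C) (x y : V) (e : R) :
  ball x (e%:C)%C y = (rnorm (x - y) < e) :> Prop.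
Proof. by rewrite -ball_normE /ball_ /= -rnormE ltcR. Qed.

Lemma posc (c : C) : 0 < c -> exists2 e : R, 0 < e & c = (e%:C)%C.
Proof.
move=> c0; exists (complex.Re c); first by move: c0; rewrite ltcE => /andP[].
by rewrite RRe_real // gtr0_real.
Qed.

Lemma rnorm_complete (V : completeNormedModType C) : complete_for (@rnorm R V).
Proof.
move=> s sC; pose F := s @ \oo.
have FC : cauchy F.
  apply: cauchy_exP => _ /posc[r r0 ->].
  have [N HN] := sC _ r0; exists (s N); exists N => // n /= Nn.
  by rewrite rnorm_ball; apply: HN.
have Fc : cvg F by exact: (@cauchy_cvg _ F).
exists (lim F) => e e0.
have := Fc; rewrite cvgrPdist_lt => /(_ (e%:C)%C); rewrite ltcR => /(_ e0) [N _ HN].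
exists N => n Nn; have := HN n Nn; rewrite /= -rnormE ltcR => h.
by rewrite (semi_distC (rnorm_seminorm V)).
Qed.

End Seminorms.

(** * Hilbert space geometry *)

Section HilbertGeometry.
Variables (R : realType) (H : hilbert R).
Local Notation C := R[i].
Local Notation "<[ x , y ]>" := (hdot H x y).
Implicit Types (x y z e : H).

Lemma hdotC x y : <[x, y]> = (<[y, x]>)^*.
Proof. by rewrite hermC expr0 mul1r. Qed.

Lemma hdotZr c x y : <[x, c *: y]> = c^* * <[x, y]>.
Proof. by rewrite linearZr_LR. Qed.

Lemma hdotZl c x y : <[c *: x, y]> = c * <[x, y]>.
Proof. by rewrite linearZl_LR. Qed.

Lemma hdotBr x y z : <[x, y - z]> = <[x, y]> - <[x, z]>.
Proof. by rewrite linearBr. Qed.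

Lemma hdotBl x y z : <[x - y, z]> = <[x, z]> - <[y, z]>.
Proof. by rewrite linearBl. Qed.

Lemma hdotDr x y z : <[x, y + z]> = <[x, y]> + <[x, z]>.
Proof. by rewrite linearDr. Qed.

Lemma hdotDl x y z : <[x + y, z]> = <[x, z]> + <[y, z]>.
Proof. by rewrite linearDl. Qed.

Lemma hdot0l y : <[0, y]> = 0.
Proof. by rewrite linear0l. Qed.

Lemma hdot0r y : <[y, 0]> = 0.
Proof. by rewrite linear0r. Qed.

Lemma hdot_suml I (r : seq I) (P : pred I) (F : I -> H) y :
  <[\sum_(i <- r | P i) F i, y]> = \sum_(i <- r | P i) <[F i, y]>.
Proof. by rewrite linear_sumlz. Qed.

Lemma hdot_sumr I (r : seq I) (P : pred I) (F : I -> H) y :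
  <[y, \sum_(i <- r | P i) F i]> = \sum_(i <- r | P i) <[y, F i]>.
Proof. by rewrite linear_sumr. Qed.

Lemma hdot_rnorm x : <[x, x]> = ((rnorm x ^+ 2)%:C)%C.
Proof. by rewrite hdotE -rnormE rmorphXn. Qed.

Lemma hdot_ext x y : (forall z, <[z, x]> = <[z, y]>) -> x = y.
Proof.
move=> xy; apply/eqP; rewrite -subr_eq0 -(dnorm_eq0 (hdot H)) hdotBr xy subrr eqxx //.
Qed.

(** Pythagoras for the component of [x] orthogonal to the unit vector [e]. *)
Lemma rnorm_residual x e : rnorm e = 1 ->
  rnorm (x - <[x, e]> *: e) ^+ 2 = rnorm x ^+ 2 - rmod <[x, e]> ^+ 2.
Proof.
move=> e1; apply: (@complexI R); rewrite -hdot_rnorm rmorphB /= -hdot_rnorm.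
rewrite rmorphXn /= rmodE dnormB dnormZ (hdot_rnorm e) e1 expr1n mulr1 hdotZr.
have -> : <[x, e]>^* * <[x, e]> = `|<[x, e]>| ^+ 2 by rewrite normCK mulrC.
have -> : (`|<[x, e]>| ^+ 2)^* = `|<[x, e]>| ^+ 2.
  by apply: conj_Creal; rewrite rpredX // normr_real.
by ring.
Qed.

Lemma CauchySchwarz_rnorm x y : rmod <[x, y]> <= rnorm x * rnorm y.
Proof.
have [->|y0] := eqVneq y 0.
  by rewrite linear0r rmod0 mulr_ge0 // rnorm_ge0.
have ny : 0 < rnorm y.
  by rewrite lt_neqAle rnorm_ge0 andbT eq_sym; apply: contra_neq y0 => /rnorm_eq0.
pose c : C := ((rnorm y)^-1)%:C%C.
have mc : rmod c = (rnorm y)^-1 by rewrite rmod_real ger0_norm // invr_ge0 rnorm_ge0.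
have e1 : rnorm (c *: y) = 1 by rewrite rnormZ mc mulVf // gt_eqF.
have h : rmod <[x, c *: y]> <= rnorm x.
  have := rnorm_residual x e1; have := sqr_ge0 (rnorm (x - <[x, c *: y]> *: (c *: y))).
  move=> h1 h2; rewrite -ler_sqr ?nnegrE ?rnorm_ge0 ?rmod_ge0 //; lra.
move: h; rewrite hdotZr rmodM.
have -> : rmod c^* = (rnorm y)^-1 by rewrite /rmod norm_conjC -/(rmod c).
by rewrite mulrC ler_pdivrMr.
Qed.

Definition bounded_form (phi : H -> C) := exists M : R, forall x, rmod (phi x) <= M * rnorm x.

Lemma parallelogram x y :
  rnorm (x - y) ^+ 2 = 2 * rnorm x ^+ 2 + 2 * rnorm y ^+ 2 - rnorm (x + y) ^+ 2.
Proof.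
have dbl (a : R) : ((2 * a)%:C = 2 * a%:C)%C by rewrite rmorphM rmorph_nat.
apply: (@complexI R); rewrite rmorphB rmorphD /= !dbl -!hdot_rnorm.
by rewrite dnormB dnormD; ring.
Qed.

(** Completeness enters here: a minimizing sequence is Cauchy by the parallelogram
   law. The minimizer [y] is orthogonal to the kernel of [phi] since moving along
   the kernel cannot shorten it. *)
Lemma least_norm (phi : {scalar H}) : bounded_form phi ->
  (exists x, phi x = 1) ->
  exists2 y, phi y = 1 & forall z, phi z = 0 -> <[z, y]> = 0.
Proof.
move=> [M phiM] [x1 phi1].
pose S := [set r | exists2 x, phi x = 1 & r = rnorm x ^+ 2].
have S0 : S !=set0 by exists (rnorm x1 ^+ 2), x1.
have lb0 : lbound S 0 by move=> _ [x _ ->]; exact: sqr_ge0.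
have lbS : has_lbound S by exists 0.
pose d := inf S; have d0 : 0 <= d by apply: lb_le_inf.
have dS x : phi x = 1 -> d <= rnorm x ^+ 2 by move=> px; apply: ge_inf => //; exists x.
have /choice[s sP] n : exists x, phi x = 1 /\ rnorm x ^+ 2 < d + invS R n.
  have [_ [x px ->] xd] := inf_adherent (invS_gt0 R n) (conj S0 lbS).
  by exists x.
(* Midpoints of the minimizing sequence stay on the hyperplane. *)
have mid : forall m n, 4 * d <= rnorm (s m + s n) ^+ 2.
  move=> m n.
  have /dS : phi ((2^-1 : C) *: (s m + s n)) = 1.
    by rewrite linearZ linearD /= (sP m).1 (sP n).1; field.
  rewrite rnormZ rmodV rmod_nat exprMn; have -> : 2^-1 ^+ 2 = 4^-1 :> R by field.
  lra.
have sC : cauchy_for (@rnorm R H) s.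
  move=> e e0; have e2 : 0 < e ^+ 2 / 4 by rewrite divr_gt0 // exprn_gt0.
  have [N HN] := small_inv e2; exists N => m n /HN hm /HN hn.
  rewrite -ltr_sqr ?nnegrE ?rnorm_ge0 ?(ltW e0) // parallelogram.
  move: (mid m n) (sP m).2 (sP n).2 hm hn; set u := invS R m; set v := invS R n.
  move: u v (rnorm _ ^+ 2) (rnorm _ ^+ 2) (rnorm _ ^+ 2) (e ^+ 2).
  by move=> *; lra.
have [y sy] := rnorm_complete sC.
have phisy : cv (E := C^o) (@rmod R) (phi \o s) (phi y).
  apply: (cv_lip (rnorm_seminorm H)) sy => x z; rewrite -linearB; exact: phiM.
have py : phi y = 1.
  apply/eqP; rewrite eq_sym -subr_eq0 -normr_eq0 -rmodE; apply/eqP.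
  congr (_%:C)%C; apply/eqP; rewrite eq_le rmod_ge0 andbT leNgt; apply/negP.
  by move=> /phisy[N /(_ N (leqnn N))] /=; rewrite (sP N).1 ltxx.
have ny : rnorm y ^+ 2 <= d.
  rewrite leNgt; apply/negP => dy.
  pose r := (d + rnorm y ^+ 2) / 2.
  have rd : 0 < (rnorm y ^+ 2 - d) / 2 by lra.
  have r0 : 0 <= r by rewrite /r; lra.
  have [N HN] := small_inv rd.
  have : rnorm y <= Num.sqrt r.
    apply: (cv_le (rnorm_seminorm H) (N := N)) sy => n /HN hn.
    rewrite -ler_sqr ?nnegrE ?sqrtr_ge0 ?rnorm_ge0 // sqr_sqrtr //.
    by have [_] := sP n; rewrite /r; lra.
  rewrite -ler_sqr ?nnegrE ?sqrtr_ge0 ?rnorm_ge0 // sqr_sqrtr // /r; lra.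
exists y => // z pz; apply/eqP; apply: contraT => yz.
have z0 : rnorm z != 0.
  by apply: contra_neq yz => /rnorm_eq0 ->; rewrite hdot0l.
pose c : C := ((rnorm z)^-1)%:C%C.
have e1 : rnorm (c *: z) = 1.
  by rewrite rnormZ rmod_real ger0_norm ?mulVf // invr_ge0 rnorm_ge0.
have /dS : phi (y - <[y, c *: z]> *: (c *: z)) = 1.
  by rewrite linearB /= scalarZ scalarZ pz !mulr0 subr0.
rewrite rnorm_residual // => dle; have : rmod <[y, c *: z]> ^+ 2 <= 0 by lra.
have rc : rmod c^* != 0.
  by rewrite /rmod norm_conjC -/(rmod c) rmod_real normr_eq0 invr_eq0.
rewrite hdotZr rmodM exprMn pmulr_rle0 ?exprn_even_gt0 //= real_exprn_even_le0 //=.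
move/eqP => h; case/eqP: yz; rewrite hdotC; apply/eqP; rewrite conjC_eq0.
by rewrite -normr_eq0 -rmodE h.
Qed.

Theorem Riesz_representation (phi : {scalar H}) : bounded_form phi ->
  exists y, forall x, phi x = <[x, y]>.
Proof.
move=> bphi; have [p0|/existsNP[x0 /eqP px0]] := pselect (forall x, phi x = 0).
  by exists 0 => x; rewrite hdot0r.
have [|y py yker] := least_norm bphi.
  by exists ((phi x0)^-1 *: x0); rewrite scalarZ mulVf.
exists ((<[y, y]>)^-1 *: y) => x; rewrite hdotZr.
have /yker : phi (x - phi x *: y) = 0 by rewrite linearB /= scalarZ py mulr1 subrr.
rewrite hdotBl hdotZl => /eqP; rewrite subr_eq0 => /eqP ->.
have y0 : <[y, y]> != 0.
  rewrite dnorm_eq0; apply/eqP => y0; move: py; rewrite y0 linear0 => /esym/eqP.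
  by rewrite oner_eq0.
rewrite conj_Creal; last by rewrite hdot_rnorm -fmorphV complex_real.
by rewrite mulrCA mulVf // mulr1.
Qed.

(** ** Bounded operators and their adjoints *)

Definition to_bop (f : H -> H) (lf : linear f) (bf : bounded_op f) : bop H :=
  @Bop R H (HB.pack_for {linear H -> H} f (GRing.isLinear.Build C H H *:%R f lf)) bf.

Lemma to_bopE f lf bf x : @to_bop f lf bf x = f x.
Proof. by []. Qed.

Lemma op_norm_has_sup (a : bop H) :
  has_sup [set rnorm (a x) | x in [set x : H | rnorm x <= 1]].
Proof.
split; first by exists (rnorm (a 0)), 0 => //=; rewrite /rnorm normr0 /= ler01.
have [M M0 aM] := bounded_op_ge0 (bop_bounded a).
exists M => _ [x /= x1 <-]; rewrite (le_trans (aM x)) // ler_piMr //.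
Qed.

Lemma op_norm_ge0 (a : bop H) : 0 <= op_norm a.
Proof.
have h : rnorm (a 0) <= op_norm a.
  apply: (sup_upper_bound (op_norm_has_sup a)).
  by exists 0 => //=; rewrite /rnorm normr0 /= ler01.
by apply: le_trans h; exact: rnorm_ge0.
Qed.

Lemma op_norm_le (a : bop H) M : 0 <= M ->
  (forall x, rnorm (a x) <= M * rnorm x) -> op_norm a <= M.
Proof.
move=> M0 aM; apply: ge_sup; first exact: (op_norm_has_sup a).1.
by move=> _ [x /= x1 <-]; rewrite (le_trans (aM x)) // ler_piMr //.
Qed.

Lemma adjoint_bound (a b : H -> H) M : op_adjoint a b ->
  (forall x, rnorm (a x) <= M * rnorm x) -> 0 <= M ->
  forall x, rnorm (b x) <= M * rnorm x.
Proof.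
move=> ab aM M0 y; have [->|y0] := eqVneq (rnorm (b y)) 0.
  by rewrite mulr_ge0 ?rnorm_ge0.
have by0 : 0 < rnorm (b y) by rewrite lt_neqAle eq_sym y0 rnorm_ge0.
rewrite -(ler_pM2l by0) -expr2.
have -> : rnorm (b y) ^+ 2 = rmod <[a (b y), y]>.
  by rewrite ab hdot_rnorm rmod_real ger0_norm ?sqr_ge0.
rewrite (le_trans (CauchySchwarz_rnorm _ _)) // mulrA (mulrC _ M) ler_wpM2r ?rnorm_ge0 //.
Qed.

Lemma adjoint_exists (a : bop H) : exists b : bop H, op_adjoint a b.
Proof.
have [M M0 aM] := bounded_op_ge0 (bop_bounded a).
have /choice[b bP] y : exists z, forall x, <[a x, y]> = <[x, z]>.
  have lphi : scalar (fun x => <[a x, y]>).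
    by move=> c x z; rewrite linearP hdotDl hdotZl.
  have := @Riesz_representation
    (HB.pack_for {scalar H} (fun x => <[a x, y]>) (GRing.isLinear.Build C H C *%R _ lphi)).
  apply; exists (M * rnorm y) => x /=; rewrite (le_trans (CauchySchwarz_rnorm _ _)) //.
  by rewrite mulrAC ler_wpM2r // rnorm_ge0.
have ab : op_adjoint a b by move=> x y; exact: bP.
have lb : linear b.
  move=> c x y; apply: hdot_ext => z.
  by rewrite -ab !hdotDr !hdotZr -!ab.
have bb : bounded_op b by exists M; exact: adjoint_bound ab aM M0.
by exists (to_bop lb bb).
Qed.

(** ** Rank one operators *)

Definition theta_fun e (f : H) x := <[x, f]> *: e.

Lemma theta_linear e f : linear (theta_fun e f).
Proof. by move=> c x y; rewrite /theta_fun hdotDl hdotZl scalerDl scalerA. Qed.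

Lemma theta_le e f x : rnorm (theta_fun e f x) <= rnorm e * rnorm f * rnorm x.
Proof.
rewrite rnormZ mulrC -mulrA ler_wpM2l ?rnorm_ge0 // mulrC.
exact: CauchySchwarz_rnorm.
Qed.

Lemma theta_bounded e f : bounded_op (theta_fun e f).
Proof. by exists (rnorm e * rnorm f); exact: theta_le. Qed.

Lemma theta_rank e f : finite_rank (theta_fun e f).
Proof. by exists 1%N, (fun=> e) => x; exists (fun=> <[x, f]>); rewrite big_ord1. Qed.

Definition theta e (f : H) : fin_op H :=
  mk_fin (@theta_linear e f) (theta_bounded e f) (theta_rank e f).

Lemma thetaE e f x : theta e f x = <[x, f]> *: e.
Proof. by []. Qed.

Lemma finD (a b : fin_op H) x : fin_fun (a + b) x = a x + b x.
Proof. by []. Qed.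

Lemma finZ c (a : fin_op H) x : fin_fun (c *: a) x = c *: a x.
Proof. by []. Qed.

Lemma fin_sum I (r : seq I) (F : I -> fin_op H) x :
  fin_fun (\sum_(i <- r) F i) x = \sum_(i <- r) F i x.
Proof. by elim/big_rec2: _ => //= i u v _ <-; rewrite finD. Qed.

Lemma finop_scale (a : fin_op H) k x : a (k *: x) = k *: a x.
Proof. by rewrite linearZ. Qed.

Lemma bop_scale (a : bop H) k x : a (k *: x) = k *: a x.
Proof. by rewrite linearZ. Qed.

Lemma fin_lmulE (a : bop H) b x : fin_lmul a b x = a (b x).
Proof. by []. Qed.

Lemma fin_rmulE (a : bop H) b x : fin_rmul a b x = b (a x).
Proof. by []. Qed.

Lemma lmul_theta (a : bop H) e f : fin_lmul a (theta e f) = theta (a e) f.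
Proof. by apply: fin_op_ext => x; rewrite fin_lmulE !thetaE linearZ. Qed.

Lemma theta_adjoint e f : op_adjoint (theta e f) (theta f e).
Proof. by move=> x y; rewrite !thetaE hdotZl hdotZr -hdotC mulrC. Qed.

Lemma op_normM_theta e f : op_norm (fin_bop (theta e f)) <= rnorm e * rnorm f.
Proof.
apply: op_norm_le; first by rewrite mulr_ge0 ?rnorm_ge0.
exact: theta_le.
Qed.

Lemma projection_le1 (P : H -> H) : oprojection P -> forall x, rnorm (P x) <= rnorm x.
Proof.
move=> [PP PA] x; have [->|p0] := eqVneq (rnorm (P x)) 0; first exact: rnorm_ge0.
have pp : 0 < rnorm (P x) by rewrite lt_neqAle eq_sym p0 rnorm_ge0.
rewrite -(ler_pM2r pp) -expr2.
have -> : rnorm (P x) ^+ 2 = rmod <[x, P x]>.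
  by rewrite -[in RHS]PP -PA hdot_rnorm rmod_real ger0_norm ?sqr_ge0.
exact: CauchySchwarz_rnorm.
Qed.

Lemma projection_op_norm (P : bop H) : oprojection P -> op_norm P <= 1.
Proof.
by move=> PP; apply: op_norm_le => // x; rewrite mul1r; apply: projection_le1.
Qed.

(** ** Orthonormal families *)

Fixpoint orthonormal_seq (es : seq H) : Prop :=
  if es is e :: es' then
    [/\ rnorm e = 1, forall f, f \in es' -> <[e, f]> = 0 & orthonormal_seq es']
  else True.

Definition proj_on (es : seq H) : fin_op H := \sum_(e <- es) theta e e.

Lemma proj_on_cons e es x : proj_on (e :: es) x = <[x, e]> *: e + proj_on es x.
Proof. by rewrite /proj_on big_cons finD thetaE. Qed.

Lemma proj_onE es x : proj_on es x = \sum_(e <- es) <[x, e]> *: e.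
Proof. by rewrite /proj_on fin_sum; apply: eq_bigr => e _; rewrite thetaE. Qed.

Lemma proj_on0 es x : (forall f, f \in es -> <[x, f]> = 0) -> proj_on es x = 0.
Proof.
move=> H0; rewrite /proj_on fin_sum big_seq big1 // => f /H0 xf.
by rewrite thetaE xf scale0r.
Qed.

Lemma proj_on_adjoint es : op_adjoint (proj_on es) (proj_on es).
Proof.
move=> x y; rewrite /proj_on !fin_sum hdot_suml hdot_sumr; apply: eq_bigr => e _.
exact: theta_adjoint.
Qed.

Lemma hdot_unit e : rnorm e = 1 -> <[e, e]> = 1.
Proof. by move=> e1; rewrite hdot_rnorm e1 expr1n. Qed.

Lemma proj_on_mem es f : orthonormal_seq es -> f \in es -> proj_on es f = f.
Proof.
elim: es => //= e es IH [e1 eo eso]; rewrite inE => /orP[/eqP->|fes].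
  by rewrite proj_on_cons hdot_unit // scale1r proj_on0 // addr0.
by rewrite proj_on_cons IH // hdotC eo // conjC0 scale0r add0r.
Qed.

Lemma proj_on_projection es : orthonormal_seq es -> oprojection (proj_on es).
Proof.
move=> eso; split; last exact: proj_on_adjoint.
move=> x; rewrite (proj_onE es x) linear_sum /= big_seq [RHS]big_seq.
by apply: eq_bigr => e ees; rewrite linearZ /= proj_on_mem.
Qed.

Lemma unit_scale (r : H) : rnorm r != 0 -> rnorm (((rnorm r)^-1)%:C%C *: r) = 1.
Proof.
by move=> r0; rewrite rnormZ rmod_real ger0_norm ?mulVf // invr_ge0 rnorm_ge0.
Qed.

(** One step of Gram-Schmidt. *)
Lemma orthonormal_extend es v : orthonormal_seq es -> proj_on es v != v ->
  exists e, [/\ orthonormal_seq (e :: es), proj_on (e :: es) v = v &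
     forall w, proj_on es w = w -> proj_on (e :: es) w = w].
Proof.
move=> eso nv; pose r := v - proj_on es v.
have r0 : rnorm r != 0.
  apply: contraNneq nv => /rnorm_eq0 r0.
  by rewrite eq_sym -subr_eq0 -/r r0.
pose c : C := ((rnorm r)^-1)%:C%C; pose e := c *: r.
have e1 : rnorm e = 1 by exact: unit_scale.
have cc : c^* * c = (((rnorm r) ^+ 2)^-1)%:C%C.
  rewrite /c conj_Creal; last by rewrite complex_real.
  by rewrite -rmorphM /= -invfM -expr2.
have rf w : proj_on es w = w -> <[r, w]> = 0.
  by move=> wE; rewrite hdotBl proj_on_adjoint wE subrr.
have ef w : proj_on es w = w -> <[e, w]> = 0 by move=> /rf h; rewrite hdotZl h mulr0.
exists e; split.
- by split=> // f fes; apply: ef; apply: proj_on_mem.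
- have pp : proj_on es (proj_on es v) = proj_on es v.
    by have [] := proj_on_projection eso.
  have ve : <[v, e]> = <[r, e]>.
    rewrite -{1}[v](subrK (proj_on es v)) -/r hdotDl [X in _ + X]hdotC ef //.
    by rewrite conjC0 addr0.
  rewrite proj_on_cons ve hdotZr scalerA mulrAC cc hdot_rnorm -rmorphM /=.
  by rewrite mulVf ?scale1r ?sqrf_eq0 // subrK.
- by move=> w ww; rewrite proj_on_cons hdotC ef // conjC0 scale0r add0r.
Qed.

Lemma orthonormal_span (vs : seq H) : exists es, orthonormal_seq es /\
  forall v, v \in vs -> proj_on es v = v.
Proof.
elim: vs => [|v vs [es [eso esP]]]; first by exists [::].
have [ev|/(orthonormal_extend eso)[e [eo ev ew]]] := eqVneq (proj_on es v) v.
  by exists es; split=> // w; rewrite inE => /orP[/eqP->|/esP].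
by exists (e :: es); split=> // w; rewrite inE => /orP[/eqP->|/esP /ew].
Qed.

(** A finite orthonormal family that cannot be extended would make the identity
   equal to [proj_on es], which has finite rank. *)
Lemma orthonormal_of_size : infinite_dimensional H ->
  forall n, exists es, orthonormal_seq es /\ size es = n.
Proof.
move=> inf; elim=> [|n [es [eso sz]]]; first by exists [::].
have [all_es|/existsNP[v /eqP /(orthonormal_extend eso)[e [eo _ _]]]] :=
    pselect (forall v, proj_on es v = v); last by exists (e :: es); rewrite /= sz.
case: inf; have [_ _ [m [f fP]]] := fin_opP (proj_on es).
by exists m, f => x /=; have [c cP] := fP x; exists c; rewrite -cP all_es.
Qed.

(** A bounded operator of finite rank is compressed by the orthogonal
   projection onto its range, so each coordinate is a bounded functional. *)
Lemma fin_op_thetas (a : fin_op H) : exists s : seq (H * H),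
  a = \sum_(p <- s) theta p.1 p.2.
Proof.
have [_ _ [n [f fP]]] := fin_opP a.
have [es [eso esP]] := orthonormal_span (codom f).
have ra x : proj_on es (a x) = a x.
  have [c ->] := fP x; rewrite linear_sum; apply: eq_bigr => i _ /=.
  by rewrite linearZ /= esP // codom_f.
have [b ab] := adjoint_exists (fin_bop a).
exists [seq (e, b e) | e <- es]; apply: fin_op_ext => x.
rewrite -ra /proj_on !fin_sum big_map; apply: eq_bigr => e _.
by rewrite !thetaE /= -ab.
Qed.

Lemma fin_adjoint (a : fin_op H) : exists b : fin_op H, op_adjoint a b.
Proof.
have [s ->] := fin_op_thetas a; exists (\sum_(p <- s) theta p.2 p.1) => x y.
rewrite !fin_sum hdot_suml hdot_sumr; apply: eq_bigr => p _; exact: theta_adjoint.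
Qed.

(** The projection onto the span of all the vectors occurring in rank one
   decompositions of the given operators. *)
Lemma common_support (s : seq (fin_op H)) : exists es, orthonormal_seq es /\
  forall a : fin_op H, a \in s -> (forall x, proj_on es (a x) = a x) /\
                      (forall x, a (proj_on es x) = a x).
Proof.
have /choice[th thP] (a : fin_op H) := fin_op_thetas a.
pose vs := flatten [seq [seq p.1 | p <- th a] ++ [seq p.2 | p <- th a] | a <- s].
have [es [eso esP]] := orthonormal_span vs; exists es; split=> // a sa.
have m1 p : p \in th a -> p.1 \in vs.
  move=> pa; apply/flatten_mapP; exists a => //; rewrite mem_cat.
  by rewrite (map_f fst pa).
have m2 p : p \in th a -> p.2 \in vs.
  move=> pa; apply/flatten_mapP; exists a => //; rewrite mem_cat.
  by rewrite (map_f snd pa) orbT.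
have aE y : a y = \sum_(p <- th a) <[y, p.2]> *: p.1.
  by rewrite {1}(thP a) fin_sum; apply: eq_bigr => p _; rewrite thetaE.
split=> x; rewrite !aE.
  rewrite linear_sum big_seq [RHS]big_seq; apply: eq_bigr => p /m1 /esP e1 /=.
  by rewrite linearZ /= e1.
rewrite big_seq [RHS]big_seq; apply: eq_bigr => p /m2 /esP e2 /=.
by rewrite proj_on_adjoint e2.
Qed.

End HilbertGeometry.

(** * The operation [diamond] *)

Section Diamond.
Variables (R : realType) (S : setting R).
Local Notation C := R[i].
Local Notation T := (st_square S).
Local Notation "<[ x , y ]>" := (hdot S x y).
Implicit Types (a b c d : fin_op S) (x y z u v w : S).

(** The identification of [L] with its own Hilbert square, on elementary tensors. *)
Definition ten x y : S := st_iota S (ht_tens T x y).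

Lemma ten_dot x y x' y' : <[ten x y, ten x' y']> = <[x, x']> * <[y, y']>.
Proof. by rewrite st_unitary ht_dot. Qed.

Lemma ten_norm x y : rnorm (ten x y) = rnorm x * rnorm y.
Proof.
apply/eqP; rewrite -(@eqrXn2 _ 2) ?mulr_ge0 ?rnorm_ge0 //; apply/eqP.
apply: (@complexI R); rewrite exprMn [RHS]rmorphM /= -!hdot_rnorm.
exact: ten_dot.
Qed.

Lemma tenDl x x' y : ten (x + x') y = ten x y + ten x' y.
Proof. by rewrite /ten linearDl linearD. Qed.

Lemma tenZl k x y : ten (k *: x) y = k *: ten x y.
Proof. by rewrite /ten linearZl_LR linearZ. Qed.

Lemma tenDr x y y' : ten x (y + y') = ten x y + ten x y'.
Proof. by rewrite /ten linearDr linearD. Qed.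

Lemma tenZr k x y : ten x (k *: y) = k *: ten x y.
Proof. by rewrite /ten linearZr_LR linearZ. Qed.

Lemma iota_norm (u : T) : rnorm (st_iota S u) = rnorm u.
Proof.
apply/eqP; rewrite -(@eqrXn2 _ 2) ?rnorm_ge0 //; apply/eqP.
by apply: (@complexI R); rewrite -!hdot_rnorm st_unitary.
Qed.

Lemma ten_approx w (e : R) : 0 < e ->
  exists s : seq (S * S), rnorm (w - \sum_(p <- s) ten p.1 p.2) < e.
Proof.
move=> e0; pose u := st_iotaV w.
have ec : 0 < (e%:C)%C :> C by rewrite ltcR.
have [v [ub [s vE]]] := ht_dense (h := T) (ex_intro _ u (ballxx u ec)) (ball_open _ _).
have {}ub : rnorm (u - v) < e by rewrite -rnorm_ball; exact: ub.
exists s; rewrite vE in ub; rewrite -(st_iotaVK w) -/u.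
have -> : \sum_(p <- s) ten p.1 p.2 = st_iota S (\sum_(p <- s) ht_tens T p.1 p.2).
  by rewrite linear_sum.
by rewrite -linearB iota_norm.
Qed.

Lemma ten_dot_ext u v : (forall x y, <[ten x y, u]> = <[ten x y, v]>) -> u = v.
Proof.
move=> uv; apply/eqP; rewrite -subr_eq0; apply/eqP; set w := u - v.
have w0 x y : <[ten x y, w]> = 0 by rewrite hdotBr uv subrr.
apply: rnorm_eq0; apply/eqP; rewrite eq_le rnorm_ge0 andbT.
apply/ler_addgt0Pr => e e0; rewrite add0r.
have [s sw] := ten_approx w e0; set t := \sum_(p <- s) _ in sw.
have [->|nw] := eqVneq (rnorm w) 0; first exact: ltW.
have nw0 : 0 < rnorm w by rewrite lt_neqAle eq_sym nw rnorm_ge0.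
have E : rnorm w ^+ 2 = rmod <[w - t, w]>.
  rewrite hdotBl [X in _ - X](_ : _ = 0) ?subr0; last first.
    by rewrite /t hdot_suml big1.
  by rewrite hdot_rnorm rmod_real ger0_norm // sqr_ge0.
have := CauchySchwarz_rnorm (w - t) w; rewrite -E expr2 ler_pM2r // => h.
exact: le_trans h (ltW sw).
Qed.

(** The adjoints agree, because their values are tested against the elementary
   tensors, which span a dense subspace. *)
Lemma ten_op_ext (f g : {linear S -> S}) : bounded_op f -> bounded_op g ->
  (forall x y, f (ten x y) = g (ten x y)) -> f =1 g.
Proof.
move=> bf bg fg w.
have [f' ff'] := adjoint_exists (Bop bf); have [g' gg'] := adjoint_exists (Bop bg).
have f'g' z : f' z = g' z.
  by apply: ten_dot_ext => x y; rewrite -ff' -gg' /= fg.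
by apply: hdot_ext => z; rewrite hdotC [RHS]hdotC (ff' w z) (gg' w z) f'g'.
Qed.

Lemma dia_ext c d : (forall x y, c (ten x y) = d (ten x y)) -> c = d.
Proof.
move=> cd; apply: fin_op_ext => w.
by apply: ten_op_ext => //; [case: (fin_opP c)|case: (fin_opP d)].
Qed.

(** The diamond of two rank one operators is again of rank one, with an explicit
   formula. This provides an operator satisfying the conditions under which
   [op_tensor] chooses, and shows that the chosen one has finite rank. *)
Lemma diamond_witness a b : exists c : fin_op S,
  forall x y, c (ten x y) = ten (a x) (b y).
Proof.
have [s sE] := fin_op_thetas a; have [t tE] := fin_op_thetas b.
exists (\sum_(p <- s) \sum_(q <- t) theta (ten p.1 q.1) (ten p.2 q.2)) => x y.
have aE : a x = \sum_(p <- s) <[x, p.2]> *: p.1.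
  by rewrite {1}sE fin_sum; apply: eq_bigr => p _; rewrite thetaE.
have bE : b y = \sum_(p <- t) <[y, p.2]> *: p.1.
  by rewrite {1}tE fin_sum; apply: eq_bigr => p _; rewrite thetaE.
have sl I (r : seq I) (F : I -> S) z : ten (\sum_(i <- r) F i) z = \sum_(i <- r) ten (F i) z.
  by rewrite /ten linear_sumlz linear_sum.
have sr I (r : seq I) (F : I -> S) z : ten z (\sum_(i <- r) F i) = \sum_(i <- r) ten z (F i).
  by rewrite /ten linear_sumr linear_sum.
rewrite aE bE fin_sum sl; apply: eq_bigr => p _; rewrite fin_sum sr.
apply: eq_bigr => q _; rewrite thetaE ten_dot tenZl tenZr scalerA.
by [].
Qed.

Lemma iotaV_linear : linear (@st_iotaV R S).
Proof.
by move=> k u v; apply: (can_inj (@st_iotaK _ S)); rewrite linearP !st_iotaVK.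
Qed.

Lemma iotaV_norm w : rnorm (st_iotaV w) = rnorm w.
Proof. by rewrite -iota_norm st_iotaVK. Qed.

Lemma diamondE a b x y : diamond a b (ten x y) = ten (a x) (b y).
Proof.
have [c cP] := diamond_witness a b; rewrite -cP; congr (fin_fun _ _).
rewrite /diamond; set f := fun x => _.
have [lc bc _] := fin_opP c.
pose D := [set c : T -> T | [/\ linear c, bounded_op c &
    forall x y, c (ht_tens T x y) = ht_tens T (a x) (b y)]].
have : D (@op_tensor R S S T a b).
  apply: (xgetPex 0); exists (@st_iotaV R S \o c \o st_iota S); split => /=.
  - by move=> k u v; rewrite /= linearP lc iotaV_linear.
  - case: bc => M cM; exists M => u /=; rewrite iotaV_norm (le_trans (cM _)) //.
    by rewrite iota_norm.
  - by move=> u v; rewrite /= -/(ten u v) cP /ten st_iotaK.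
case=> lo [M oM] oE.
have lf : linear f by move=> k u v; rewrite /f iotaV_linear lo linearP.
have bf : bounded_op f.
  by exists M => u; rewrite /f iota_norm (le_trans (oM _)) // iotaV_norm.
suff -> : f = val c by rewrite valKd.
apply/funext => w.
apply: (@ten_op_ext (to_bop lf bf) c bf bc).
by move=> u v /=; rewrite /f /ten st_iotaK oE -/(ten (a u) (b v)) cP.
Qed.

Lemma diamondDl a a' b : diamond (a + a') b = diamond a b + diamond a' b.
Proof. by apply: dia_ext => x y; rewrite finD !diamondE finD tenDl. Qed.

Lemma diamondDr a b b' : diamond a (b + b') = diamond a b + diamond a b'.
Proof. by apply: dia_ext => x y; rewrite finD !diamondE finD tenDr. Qed.

Lemma diamondZl k a b : diamond (k *: a) b = k *: diamond a b.
Proof. by apply: dia_ext => x y; rewrite finZ !diamondE finZ tenZl. Qed.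

Lemma diamondZr k a b : diamond a (k *: b) = k *: diamond a b.
Proof. by apply: dia_ext => x y; rewrite finZ !diamondE finZ tenZr. Qed.

Lemma diamond_linearl b : linear (fun a => diamond a b).
Proof. by move=> k a a'; rewrite diamondDl diamondZl. Qed.

Lemma diamond_linearr a : linear (diamond a).
Proof. by move=> k b b'; rewrite diamondDr diamondZr. Qed.

HB.instance Definition _ := bilinear_isBilinear.Build C (fin_op S) (fin_op S)
  (fin_op S) *:%R *:%R (@diamond R S)
  (conj (fun b => diamond_linearl b) (fun a => diamond_linearr a)).

Lemma diamondM a b c d : fin_lmul (fin_bop (diamond a b)) (diamond c d) =
  diamond (fin_lmul (fin_bop a) c) (fin_lmul (fin_bop b) d).
Proof. by apply: dia_ext => x y; rewrite fin_lmulE /= !diamondE !fin_lmulE. Qed.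

Lemma diamond_adjoint a a' b b' : op_adjoint a a' -> op_adjoint b b' ->
  op_adjoint (diamond a b) (diamond a' b').
Proof.
move=> aa bb; have [d dP] := fin_adjoint (diamond a b).
suff -> : diamond a' b' = d by [].
apply: dia_ext => x y; apply: ten_dot_ext => u v.
by rewrite -dP !diamondE !ten_dot aa bb.
Qed.

(** ** Isometries of [L] given by tensoring with a unit vector *)

(** With [V x = ten x e] and [W] its adjoint, [diamond a (theta e e)] is [V a W]
   and [W V = 1]; symmetrically for [V' x = ten e x]. *)
Lemma ten_isometries e : rnorm e = 1 -> exists V W V' W' : bop S,
  [/\ op_norm V <= 1 /\ op_norm W <= 1, op_norm V' <= 1 /\ op_norm W' <= 1,
      forall a, diamond a (theta e e) = fin_lmul V (fin_rmul W a),
      forall a, diamond (theta e e) a = fin_lmul V' (fin_rmul W' a) &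
      forall a, a = fin_lmul W (fin_rmul V (diamond a (theta e e)))].
Proof.
move=> e1.
have lV : linear (ten^~ e) by move=> k x y; rewrite tenDl tenZl.
have lV' : linear (ten e) by move=> k x y; rewrite tenDr tenZr.
have nV x : rnorm (ten x e) <= 1 * rnorm x by rewrite ten_norm e1 mulrC.
have nV' x : rnorm (ten e x) <= 1 * rnorm x by rewrite ten_norm e1.
pose V := to_bop lV (ex_intro _ _ nV); pose V' := to_bop lV' (ex_intro _ _ nV').
have [W VW] := adjoint_exists V; have [W' VW'] := adjoint_exists V'.
have WE x y : W (ten x y) = <[y, e]> *: x.
  apply: hdot_ext => z; rewrite -VW to_bopE ten_dot hdotZr mulrC.
  by rewrite -hdotC.
have WE' x y : W' (ten x y) = <[x, e]> *: y.
  apply: hdot_ext => z; rewrite -VW' to_bopE ten_dot hdotZr.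
  by rewrite -hdotC.
exists V, W, V', W'; split.
- split; apply: op_norm_le => //.
  exact: (adjoint_bound VW nV).
- split; apply: op_norm_le => //.
  exact: (adjoint_bound VW' nV').
- move=> a; apply: dia_ext => x y; rewrite fin_lmulE fin_rmulE diamondE WE thetaE.
  by rewrite finop_scale bop_scale tenZr.
- move=> a; apply: dia_ext => x y; rewrite fin_lmulE fin_rmulE diamondE WE' thetaE.
  by rewrite finop_scale bop_scale tenZl.
- move=> a; apply: fin_op_ext => x; rewrite fin_lmulE fin_rmulE to_bopE diamondE WE.
  by rewrite thetaE hdot_unit // scale1r hdot_unit // scale1r.
Qed.

End Diamond.

(** * Amplified bilinear operators *)

Lemma tliftD (K : fieldType) (U V W : lmodType K) (B : {bilinear U -> V -> W})
  (u v : tensor U V) : tlift B (u + v) = tlift B u + tlift B v.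
Proof. exact: linearD. Qed.

Lemma tlift0 (K : fieldType) (U V W : lmodType K) (B : {bilinear U -> V -> W}) :
  tlift B (0 : tensor U V) = 0.
Proof. exact: linear0. Qed.

Section BilinearAmplification.
Variables (R : realType) (S : setting R).
Local Notation C := R[i].
Variables (E F G : lmodType C) (B : {bilinear E -> F -> G}).

(** [tlift] extends one tensor argument at a time; the second argument comes
   first, with the elementary tensor [a x] as a parameter. *)
Definition bampl2 (a : fin_op S) (x : E) (b : fin_op S) (y : F) : fin_tensor S G :=
  tens (diamond a b) (B x y).

Lemma bampl2_bilinear a x : bilinear_for *:%R *:%R (bampl2 a x).
Proof.
split=> z k u v; rewrite /bampl2 linearPr ?tensDl ?tensDr ?tensZl ?tensZr //.
Qed.

HB.instance Definition _ a x := bilinear_isBilinear.Build C (fin_op S) F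
  (fin_tensor S G) *:%R *:%R (bampl2 a x) (bampl2_bilinear a x).

Definition bampl1 (v : fin_tensor S F) (a : fin_op S) (x : E) : fin_tensor S G :=
  tlift (bampl2 a x) v.

Lemma bampl1_bilinear v : bilinear_for *:%R *:%R (bampl1 v).
Proof.
split=> z k a b /=; rewrite /bampl1; elim/tensor_ind: v => [|c y v IH].
- by rewrite !tlift0 scaler0 addr0.
- rewrite !tliftD IH !tliftE /= /bampl2 linearPl tensDl tensZl scalerDr -!addrA.
  by congr (_ + _); rewrite addrCA.
- by rewrite !tlift0 scaler0 addr0.
- rewrite !tliftD IH !tliftE /= /bampl2 linearPl tensDr tensZr scalerDr -!addrA.
  by congr (_ + _); rewrite addrCA.
Qed.

HB.instance Definition _ v := bilinear_isBilinear.Build C (fin_op S) E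
  (fin_tensor S G) *:%R *:%R (bampl1 v) (bampl1_bilinear v).

Definition bampl (u : fin_tensor S E) (v : fin_tensor S F) : fin_tensor S G :=
  tlift (bampl1 v) u.

Lemma bamplP : is_bilinear_ampl B bampl.
Proof.
split; last by move=> a b x y; rewrite /bampl tliftE /= /bampl1 tliftE.
split=> [v k u u'|u k v v'] /=; rewrite /bampl; first exact: linearP.
elim/tensor_ind: u => [|a x u IH]; first by rewrite !tlift0 scaler0 addr0.
rewrite !tliftD IH !tliftE /= /bampl1 linearP scalerDr -!addrA.
by congr (_ + _); rewrite addrCA.
Qed.

End BilinearAmplification.

Section BilinearFor.
Variables (K : fieldType) (U V W : lmodType K) (f : U -> V -> W).
Hypothesis fP : bilinear_for *:%R *:%R f.

Lemma bilDl u u' v : f (u + u') v = f u v + f u' v.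
Proof. by have /= := fP.1 v 1 u u'; rewrite !scale1r. Qed.

Lemma bilDr u v v' : f u (v + v') = f u v + f u v'.
Proof. by have /= := fP.2 u 1 v v'; rewrite !scale1r. Qed.

Lemma bil0l v : f 0 v = 0.
Proof. by apply: (addrI (f 0 v)); rewrite -bilDl !addr0. Qed.

Lemma bil0r u : f u 0 = 0.
Proof. by apply: (addrI (f u 0)); rewrite -bilDr !addr0. Qed.

Lemma bilNl u v : f (- u) v = - f u v.
Proof. by apply: (addrI (f u v)); rewrite -bilDl !subrr bil0l. Qed.

Lemma bilNr u v : f u (- v) = - f u v.
Proof. by apply: (addrI (f u v)); rewrite -bilDr !subrr bil0r. Qed.

End BilinearFor.

(** * The unitization of a C*-algebra *)

Section Unitization.
Variables (R : realType) (A : cstar_algebra R).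
Local Notation C := R[i].
Local Notation "x ** y" := (cs_mul A x y) (at level 40, left associativity).

Implicit Types x y : A.

Lemma csDl x y (z : A) : (x + y) ** z = x ** z + y ** z.
Proof. by rewrite linearDl. Qed.

Lemma csDr x y (z : A) : z ** (x + y) = z ** x + z ** y.
Proof. by rewrite linearDr. Qed.

Lemma csBl x y (z : A) : (x - y) ** z = x ** z - y ** z.
Proof. by rewrite linearBl. Qed.

Lemma csBr x y (z : A) : z ** (x - y) = z ** x - z ** y.
Proof. by rewrite linearBr. Qed.

Lemma csZl c x y : (c *: x) ** y = c *: (x ** y).
Proof. by rewrite linearZl_LR. Qed.

Lemma csZr c x y : x ** (c *: y) = c *: (x ** y).
Proof. by rewrite linearZr_LR. Qed.

Lemma cs0l x : 0 ** x = 0.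
Proof. by rewrite linear0l. Qed.

Lemma cs0r x : x ** 0 = 0.
Proof. by rewrite linear0r. Qed.

(** The unit gives a meaning to [1 - h^2] and to its powers. The unitization
   carries no norm: its elements are measured by how they act on [A]. *)
Definition utz := (C^o * A)%type.

HB.instance Definition _ := GRing.Lmodule.copy utz (C^o * A)%type.

Definition utz_mul (u v : utz) : utz :=
  ((u.1 : C) * v.1, (u.1 : C) *: v.2 + (v.1 : C) *: u.2 + u.2 ** v.2).

Definition utz_one : utz := (1, 0).

Lemma utz_mulA : associative utz_mul.
Proof.
move=> [a x] [b y] [c z]; rewrite /utz_mul /=; congr pair; first by rewrite mulrA.
rewrite !scalerDr !linearDl !linearDr /= !linearZl_LR !linearZr_LR /= cs_mulA.
rewrite !scalerA [c * a]mulrC [c * b]mulrC -!addrA; congr (_ + _); congr (_ + _).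
rewrite [RHS]addrCA [X in _ = _ + X]addrCA [X in _ = X]addrCA; congr (_ + _).
by rewrite [RHS]addrCA; congr (_ + _); rewrite addrCA.
Qed.

Lemma utz_mul1 : left_id utz_one utz_mul.
Proof.
by move=> [a x]; rewrite /utz_mul /= mul1r scale1r scaler0 linear0l !addr0.
Qed.

Lemma utz_mulr1 : right_id utz_one utz_mul.
Proof.
by move=> [a x]; rewrite /utz_mul /= mulr1 scale1r scaler0 linear0r addr0 add0r.
Qed.

Lemma utz_mulDl : left_distributive utz_mul +%R.
Proof.
move=> [a x] [b y] [c z]; rewrite /utz_mul /=; congr pair; first by rewrite mulrDl.
rewrite scalerDl scalerDr linearDl /=.
by rewrite [X in X + _ = _]addrACA [LHS]addrACA.
Qed.

Lemma utz_mulDr : right_distributive utz_mul +%R.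
Proof.
move=> [a x] [b y] [c z]; rewrite /utz_mul /=; congr pair; first by rewrite mulrDr.
rewrite scalerDl scalerDr linearDr /=.
by rewrite [X in X + _ = _]addrACA [LHS]addrACA.
Qed.

Lemma utz_neq0 : utz_one != 0.
Proof. by apply/eqP => -[/eqP]; rewrite oner_eq0. Qed.

HB.instance Definition _ := GRing.Zmodule_isNzRing.Build utz utz_mulA utz_mul1
  utz_mulr1 utz_mulDl utz_mulDr utz_neq0.

Lemma utz_scalerAl (c : C) (u v : utz) : c *: (u * v) = (c *: u) * v.
Proof.
case: u v => [a x] [b y]; congr pair; first exact: mulrA.
rewrite /= !scalerDr linearZl_LR /= !scalerA [c * b]mulrC //.
Qed.

Lemma utz_scalerAr (c : C) (u v : utz) : c *: (u * v) = u * (c *: v).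
Proof.
case: u v => [a x] [b y]; congr pair; first exact: mulrCA.
by rewrite /= !scalerDr linearZr_LR /= !scalerA [c * a]mulrC.
Qed.

HB.instance Definition _ := GRing.Lmodule_isLalgebra.Build C utz utz_scalerAl.
HB.instance Definition _ := GRing.Lalgebra_isAlgebra.Build C utz utz_scalerAr.

Definition emb (x : A) : utz := (0, x).

Lemma emb_is_linear : linear emb.
Proof. by move=> c x y; congr pair; rewrite /= scaler0 addr0. Qed.

HB.instance Definition _ := GRing.isLinear.Build C A utz *:%R emb emb_is_linear.

Lemma embD x y : emb (x + y) = emb x + emb y.
Proof. exact: linearD. Qed.

Lemma embB x y : emb (x - y) = emb x - emb y.
Proof. exact: linearB. Qed.

Lemma embN x : emb (- x) = - emb x.
Proof. exact: linearN. Qed.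

Lemma embZ c x : emb (c *: x) = c *: emb x.
Proof. exact: linearZ. Qed.

Lemma emb0 : emb 0 = 0.
Proof. exact: linear0. Qed.

Lemma emb_sum I (r : seq I) (P : pred I) (F : I -> A) :
  emb (\sum_(i <- r | P i) F i) = \sum_(i <- r | P i) emb (F i).
Proof. exact: linear_sum. Qed.

Lemma embM x y : emb (x ** y) = emb x * emb y.
Proof. by congr pair; rewrite /= ?mulr0 // !scale0r !add0r. Qed.

Lemma emb_inj : injective emb.
Proof. by move=> x y []. Qed.

Lemma embE (u : utz) : u.1 = 0 -> u = emb u.2.
Proof. by case: u => a x /= ->. Qed.

Lemma mul_emb1 x (u : utz) : (emb x * u).1 = 0.
Proof. by rewrite /= mul0r. Qed.

Lemma emb_mul1 x (u : utz) : (u * emb x).1 = 0.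
Proof. by rewrite /= mulr0. Qed.

Lemma emb_act x (u : utz) : emb (emb x * u).2 = emb x * u.
Proof. by rewrite -embE // mul_emb1. Qed.

Lemma act_emb x (u : utz) : emb (u * emb x).2 = u * emb x.
Proof. by rewrite -embE // emb_mul1. Qed.

(** ** The involution *)

Definition star (u : utz) : utz := ((u.1 : C)^*, cs_star u.2).

Lemma cs_starD x y : cs_star (x + y) = cs_star x + cs_star y :> A.
Proof.
have e : cs_star (1 *: x + y) = (1 : C)^* *: cs_star x + cs_star y := cs_starP 1 x y.
by move: e; rewrite conjC1 !scale1r.
Qed.

Lemma cs_star0 : cs_star 0 = 0 :> A.
Proof. by apply: (addrI (cs_star 0)); rewrite -cs_starD !addr0. Qed.

Lemma cs_starZ c x : cs_star (c *: x) = c^* *: cs_star x :> A.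
Proof. by move: (cs_starP c x 0); rewrite cs_star0 !addr0. Qed.

Lemma starD u v : star (u + v) = star u + star v.
Proof. by congr pair; rewrite /= ?rmorphD // cs_starD. Qed.

Lemma starZ c u : star (c *: u) = c^* *: star u.
Proof. by congr pair; rewrite /= ?rmorphM // cs_starZ. Qed.

Lemma star0 : star 0 = 0.
Proof. by congr pair; rewrite /= ?conjC0 ?cs_star0. Qed.

Lemma starN u : star (- u) = - star u.
Proof. by have := starZ (-1 : C) u; rewrite conjCN1 !scaleN1r. Qed.

Lemma starB u v : star (u - v) = star u - star v.
Proof. by rewrite starD starN. Qed.

Lemma star1 : star 1 = 1.
Proof. by congr pair; rewrite /= ?conjC1 ?cs_star0. Qed.

Lemma starM u v : star (u * v) = star v * star u.
Proof.
congr pair; first by rewrite /= rmorphM mulrC.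
rewrite /= !cs_starD !cs_starZ cs_starM; congr (_ + _).
by rewrite addrC.
Qed.

Lemma starK u : star (star u) = u.
Proof. by case: u => a x; congr pair; rewrite /= ?conjCK ?cs_starK. Qed.

Lemma star_emb x : star (emb x) = emb (cs_star x).
Proof. by congr pair; rewrite /= conjC0. Qed.

Lemma star_sum I (r : seq I) (P : pred I) (F : I -> utz) :
  star (\sum_(i <- r | P i) F i) = \sum_(i <- r | P i) star (F i).
Proof. by elim/big_rec2: _ => [|i u v _ <-]; rewrite ?star0 ?starD. Qed.

(** ** C*-seminorms *)

Record cseminorm (nu : A -> R) : Prop := Cseminorm {
  cn_semi : seminorm nu;
  cn_mul : forall x y, nu (x ** y) <= nu x * nu y;
  cn_star : forall x, nu (cs_star x ** x) = nu x ^+ 2 }.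

Lemma rnorm_cseminorm : cseminorm (@rnorm R A).
Proof.
split; first exact: rnorm_seminorm.
- move=> x y; rewrite -lecR rmorphM /= !rnormE; exact: cs_normM.
- by move=> x; apply: (@complexI R); rewrite rmorphXn /= !rnormE cs_cstar.
Qed.

Section Cseminorms.
Variable nu : A -> R.
Hypothesis nuP : cseminorm nu.
Let nuS := cn_semi nuP.
Local Notation ge0 := (semi_ge0 nuS).

Lemma cn_star_le x : nu x <= nu (cs_star x).
Proof.
have [->|x0] := eqVneq (nu x) 0; first exact: ge0.
have xp : 0 < nu x by rewrite lt_neqAle eq_sym x0 ge0.
by rewrite -(ler_pM2r xp) -expr2 -(cn_star nuP) (cn_mul nuP).
Qed.

Lemma cn_starE x : nu (cs_star x) = nu x.
Proof. by apply/eqP; rewrite eq_le -{2}(cs_starK x) !cn_star_le. Qed.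

Lemma cn_star_r x : nu (x ** cs_star x) = nu x ^+ 2.
Proof. by rewrite -{1}(cs_starK x) (cn_star nuP) cn_starE. Qed.

(** The operator norm of right multiplication by [z], encoded by its upper bounds
   so that it can be used for an arbitrary seminorm [nu]. *)
Definition opb (z : utz) (r : R) := forall x : A, nu (emb x * z).2 <= r * nu x.

Lemma opb1 : opb 1 1.
Proof. by move=> x; rewrite mulr1 mul1r. Qed.

Lemma opb_le z r r' : r <= r' -> opb z r -> opb z r'.
Proof. by move=> rr zr x; rewrite (le_trans (zr x)) // ler_wpM2r ?ge0. Qed.

Lemma opbM z w r s : 0 <= s -> opb z r -> opb w s -> opb (z * w) (r * s).
Proof.
move=> s0 zr ws x; rewrite mulrA -emb_act (le_trans (ws _)) //.
by rewrite (mulrC r) -mulrA ler_wpM2l.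
Qed.

Lemma opbM1 z w : opb z 1 -> opb w 1 -> opb (z * w) 1.
Proof. by move=> z1 w1; rewrite -(mulr1 1); apply: opbM. Qed.

Lemma opbD z w r s : opb z r -> opb w s -> opb (z + w) (r + s).
Proof.
move=> zr ws x; rewrite mulrDr (le_trans (semiD nuS _ _)) // mulrDl.
by rewrite lerD.
Qed.

Lemma opbZ c z r : opb z r -> opb (c *: z) (rmod c * r).
Proof.
move=> zr x; rewrite -scalerAr (semiZ nuS) -mulrA ler_wpM2l ?rmod_ge0 //.
Qed.

Lemma opbN z r : opb z r -> opb (- z) r.
Proof. by move=> /(opbZ (-1)); rewrite rmodN1 mul1r scaleN1r. Qed.

Lemma opb_emb a : opb (emb a) (nu a).
Proof. by move=> x; rewrite -embM /= mulrC; exact: (cn_mul nuP). Qed.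

Lemma opb_sum I (r : seq I) (F : I -> utz) (f : I -> R) :
  (forall i, opb (F i) (f i)) -> opb (\sum_(i <- r) F i) (\sum_(i <- r) f i).
Proof.
move=> Ff; elim: r => [|i r IH]; last by rewrite !big_cons; apply: opbD.
by rewrite !big_nil => x; rewrite mulr0 mul0r (semi0 nuS).
Qed.

Lemma opb_norm z r : z.1 = 0 -> 0 <= r -> opb z r -> nu z.2 <= r.
Proof.
move=> z1 r0 zr; have [->//|n0] := eqVneq (nu z.2) 0.
have np : 0 < nu z.2 by rewrite lt_neqAle eq_sym n0 ge0.
rewrite -(ler_pM2r np) -expr2 -(cn_star nuP).
suff -> : cs_star z.2 ** z.2 = (emb (cs_star z.2) * z).2.
  by have := zr (cs_star z.2); rewrite cn_starE.
by apply: emb_inj; rewrite emb_act embM -(embE z1).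
Qed.

(** The C*-identity for [(x u)^*], since [x u u^* x^* = x x^*]. *)
Lemma opb_unitary u : u * star u = 1 -> opb u 1.
Proof.
move=> uu x; rewrite mul1r -ler_sqr ?nnegrE ?ge0 // -!cn_star_r.
suff -> : (emb x * u).2 ** cs_star (emb x * u).2 = x ** cs_star x by [].
apply: emb_inj; rewrite !embM -!star_emb emb_act starM.
by rewrite mulrA -(mulrA (emb x)) uu mulr1.
Qed.

(** If [T] and [d] are commuting self-adjoint elements with squares summing to
   the unit, then [T + i d] is unitary, so its real and imaginary parts are
   contractions. *)
Lemma rotation_contraction T d : star T = T -> star d = d -> T * d = d * T ->
  T * T + d * d = 1 -> opb T 1 /\ opb d 1.
Proof.
move=> sT sd Td TTdd; pose i : C := 'i.
have ii : i * i = -1 by rewrite -expr2 sqrCi.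
pose U := T + i *: d; pose V := T - i *: d.
have UV : U * V = 1.
  rewrite /U /V mulrDl !mulrBr -!scalerAl -!scalerAr scalerA ii scaleN1r opprK.
  by rewrite Td addrA subrK.
have VU : V * U = 1.
  rewrite /U /V mulrBl !mulrDr -!scalerAl -!scalerAr scalerA ii scaleN1r opprD opprK.
  by rewrite Td addrA addrK.
have ic : i^* = - i by rewrite conjCi.
have sU : star U = V by rewrite /U /V starD starZ sT sd ic scaleNr.
have sV : star V = U by rewrite -sU starK.
have oU : opb U 1 by apply: opb_unitary; rewrite sU.
have oV : opb V 1 by apply: opb_unitary; rewrite sV.
have half (c : C) : rmod c = 1 -> 1 = rmod (2^-1 * c) * (1 + 1).
  by rewrite rmodM rmodV rmod_nat => ->; field.
have mi : rmod (- i) = 1 by rewrite /rmod normrN normCi.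
split.
  have -> : T = (2^-1 * 1 : C) *: (U + V).
    by rewrite /U /V addrACA subrr addr0 mulr1 half_add.
  rewrite [X in opb _ X](half 1 (rmod1 R)); apply: opbZ; exact: opbD.
have -> : d = (2^-1 * - i : C) *: (U - V).
  rewrite /U /V opprB addrC addrA addrNK -scalerDr scalerA -mulrA mulNr ii opprK.
  by rewrite mulr1 half_add.
rewrite [X in opb _ X](half _ mi); apply: opbZ; apply: opbD => //; exact: opbN.
Qed.

(** Here [1 - b] is a square root of [1 - d^2], described through an element [b]
   of [A] since [A] is where limits can be taken. *)
Lemma sqrt_contraction (b d : A) : cs_star b = b -> cs_star d = d ->
  b ** d = d ** b -> b + b - b ** b = d ** d ->
  opb (1 - emb b) 1 /\ opb (emb d) 1.
Proof.
move=> sb sd bd e; apply: rotation_contraction.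
- by rewrite starB star1 star_emb sb.
- by rewrite star_emb sd.
- by rewrite mulrBl mulrBr mul1r mulr1 -!embM bd.
- have <- : emb b + emb b - emb b * emb b = emb d * emb d.
    by rewrite -!embM -e linearB linearD.
  by rewrite mulrBl mul1r mulrBr mulr1 -[emb b + _ - _]addrA addrACA subrK addNr addr0.
Qed.

End Cseminorms.
End Unitization.

(** * Square roots and uniqueness of the C*-norm *)

Section SquareRoot.
Variables (R : realType) (A : cstar_algebra R).
Local Notation C := R[i].
Local Notation "x ** y" := (cs_mul A x y) (at level 40, left associativity).
Local Notation N := (@rnorm R A).
Implicit Types (x y z a b c d h : A).

Let NP : cseminorm N := rnorm_cseminorm A.
Let NS : seminorm N := cn_semi NP.

(** The scalar iteration that dominates the one of [sqrt_seq] below. *)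
Fixpoint beta (n : nat) : R := if n is m.+1 then (1 + beta m ^+ 2) / 2 else 0.

(** The defect [x = 1 - beta n] obeys [x <- x - x^2/2], so it decays like [2/n]. *)
Lemma beta_bound n : 0 <= beta n <= 1 /\ 1 - beta n <= 2 * invS R n.
Proof.
elim: n => [|n [/andP[b0 b1] bn]] /=; first by rewrite /invS invr1; split; lra.
have bb : 0 <= beta n ^+ 2 <= 1 by rewrite sqr_ge0 expr_le1.
move/andP: bb => [bb0 bb1]; split; first by apply/andP; split; lra.
have n2 : 0 < n.+2%:R :> R by rewrite ltr0n.
have n1 : 0 < n.+1%:R :> R by rewrite ltr0n.
rewrite /invS in bn *; rewrite ler_pdivlMr // -[n.+2%:R]natr1.
have {bn} bn : (1 - beta n) * n.+1%:R <= 2 by rewrite -ler_pdivlMr.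
have -> : 1 - (1 + beta n ^+ 2) / 2 = (1 - beta n) * (1 - (1 - beta n) / 2) by field.
move: bn n1; set a := n.+1%:R; set x := 1 - beta n => bn n1.
have x0 : 0 <= x by rewrite /x; lra.
have [small|big] := lerP (x * (a + 1)) 2.
  rewrite (le_trans _ small) //.  rewrite ler_wpM2r //; first by lra.
  by rewrite ler_piMr //; lra.
rewrite -mulrA (le_trans _ bn) // ler_wpM2l //; lra.
Qed.

Lemma beta_mono n : beta n <= beta n.+1.
Proof.
have [/andP[b0 b1] _] := beta_bound n.
have -> : beta n.+1 = beta n + (1 - beta n) ^+ 2 / 2 by rewrite /=; field.
by rewrite lerDl divr_ge0 // sqr_ge0.
Qed.

Fixpoint sqrt_seq (y : A) (n : nat) : A :=
  if n is m.+1 then (2^-1 : C) *: (y + sqrt_seq y m ** sqrt_seq y m) else 0.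

Lemma N_half x : N ((2^-1 : C) *: x) = N x / 2.
Proof. by rewrite rnormZ rmodV rmod_nat mulrC. Qed.

Lemma sqrt_seq_bound y n : N y <= 1 ->
  N (sqrt_seq y n) <= beta n /\ N (sqrt_seq y n.+1 - sqrt_seq y n) <= beta n.+1 - beta n.
Proof.
move=> y1; elim: n => [|n [IH1 IH2]].
  rewrite /= (semi0 NS) cs0l addr0 subr0 N_half expr0n /=; split=> //; lra.
have [/andP[b0 b1] _] := beta_bound n; have := beta_mono n.
set s := sqrt_seq y n in IH1 IH2 *; set t := sqrt_seq y n.+1 in IH2 *.
set p := beta n in IH1 IH2 b0 b1 *; set r := beta n.+1 in IH2 *; move=> pr.
have tr : N t <= r by have := semiD NS (t - s) s; rewrite subrK; lra.
split=> //.
have -> : sqrt_seq y n.+2 - t = (2^-1 : C) *: (t ** (t - s) + (t - s) ** s).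
  rewrite -[LHS]/((2^-1 : C) *: (y + t ** t) - (2^-1 : C) *: (y + s ** s)) -scalerBr opprD addrACA subrr add0r.
  by rewrite csBr csBl /= addrA subrK.
rewrite N_half; have -> : beta n.+2 - r = (r ^+ 2 - p ^+ 2) / 2.
  by rewrite /r /= -/p; field.
rewrite ler_pM2r ?invr_gt0 // (le_trans (semiD NS _ _)) //.
have m1 := cn_mul NP t (t - s); have m2 := cn_mul NP (t - s) s.
have := semi_ge0 NS t; have := semi_ge0 NS s; have := semi_ge0 NS (t - s); nra.
Qed.

(** The classical iteration [b <- (y + b^2)/2] for [1 - sqrt (1 - y)]: each step
   is dominated by the corresponding step for [y = 1], which increases to 1. *)
Lemma sqrt_exists y : N y <= 1 -> exists b,
  [/\ N b <= 1, b + b - b ** b = y,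
      forall z, z ** y = y ** z -> z ** b = b ** z &
      cs_star y = y -> cs_star b = b].
Proof.
move=> y1; pose s := sqrt_seq y.
have sb n : N (s n) <= 1.
  have [h _] := sqrt_seq_bound n y1; have [/andP[_ b1] _] := beta_bound n.
  exact: le_trans h b1.
have st n k : N (s (n + k)%N - s n) <= beta (n + k) - beta n.
  elim: k => [|k IH]; first by rewrite addn0 !subrr (semi0 NS).
  have [_] := sqrt_seq_bound (n + k) y1; rewrite addnS -/s => h.
  have := semi_tri NS (s (n + k).+1) (s (n + k)%N) (s n); rewrite -/s; lra.
have [b sbP] : exists b, cv N s b.
  apply: rnorm_complete; apply: (cauchy_mono NS) => e e0.
  have e2 : 0 < e / 2 by lra.
  have [M HM] := small_inv e2; exists M => n k /HM hn.
  have [/andP[_ b1] _] := beta_bound (n + k); have [_ bn] := beta_bound n.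
  by have := st n k; lra.
have b1 : N b <= 1 by apply: (cv_le NS (N := 0)) sbP => n _; exact: sb.
have df := @rnorm_eq0 R A.
exists b; split=> //.
- have half : b = (2^-1 : C) *: (y + b ** b).
    have c1 : cv N (s \o S) b by apply: cv_comp sbP.
    suff c2 : cv N (s \o S) ((2^-1 : C) *: (y + b ** b)) by apply: (cv_unique NS df c1 c2).
    move=> e e0; have [M HM] := sbP _ e0; exists M => n /HM hn /=.
    rewrite -scalerBr opprD addrACA subrr add0r N_half -/s.
    have -> : s n ** s n - b ** b = s n ** (s n - b) + (s n - b) ** b.
      by rewrite csBr csBl /= addrA subrK.
    have := semiD NS (s n ** (s n - b)) ((s n - b) ** b).
    have := cn_mul NP (s n) (s n - b); have := cn_mul NP (s n - b) b.
    have := sb n; have := semi_ge0 NS (s n - b); nra.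
  rewrite {1 2}half -scalerDr.
  have -> (x : A) : (2^-1 : C) *: (x + x) = x by exact: half_add.
  by rewrite addrK.
- move=> z zy; pose f := fun x => z ** x - x ** z.
  have fs n : f (s n) = 0.
    elim: n => [|n /eqP IH]; first by rewrite /f /= cs0l cs0r subrr.
    rewrite subr_eq0 in IH; move/eqP: IH => IH.
    rewrite /f /= csZl csZr -scalerBr csDl csDr /= zy.
    by rewrite cs_mulA IH -cs_mulA IH cs_mulA subrr scaler0.
  have fb : cv N (f \o s) (f b).
    apply: (cv_lip (M := 2 * N z) NS) sbP => u v; rewrite /f.
    have -> : z ** u - u ** z - (z ** v - v ** z) = z ** (u - v) - (u - v) ** z.
      rewrite csBr csBl /= !opprB addrACA [RHS]addrACA.
      by congr (_ + _); rewrite addrC.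
    have := semiB NS (z ** (u - v)) ((u - v) ** z).
    have := cn_mul NP z (u - v); have := cn_mul NP (u - v) z; lra.
  have f0 : cv N (f \o s) 0.
    by move=> e e0; exists 0 => n _ /=; rewrite fs subrr (semi0 NS).
  by apply/eqP; rewrite -subr_eq0; apply/eqP; exact: (cv_unique NS df fb f0).
- move=> sy; have ss n : cs_star (s n) = s n.
    elim: n => [|n IH]; first by rewrite /s /= cs_star0.
    rewrite /s /= cs_starZ cs_starD sy cs_starM IH conj_Creal //.
    by rewrite realV realn.
  have c1 : cv N s (cs_star b).
    move=> e /sbP[M HM]; exists M => n /HM hn; rewrite -(ss n).
    have -> : cs_star (s n) - cs_star b = cs_star (s n - b).
      by apply: emb_inj; rewrite linearB /= -!star_emb -starB -linearB.
    by rewrite (cn_starE NP).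
  exact: (cv_unique NS df c1 sbP).
Qed.

(** ** Comparison of C*-norms *)

Section Compare.
Variable nu : A -> R.
Hypothesis nuP : cseminorm nu.
Let nuS := cn_semi nuP.

(** A self-adjoint [d] with norm at most 1 is the imaginary part of the unitary
   [sqrt (1 - d^2) + i d]. *)
Lemma selfadjoint_le d : cs_star d = d -> N d <= 1 -> nu d <= 1.
Proof.
move=> sd d1.
have dd1 : N (d ** d) <= 1.
  by rewrite (le_trans (cn_mul NP _ _)) // mulr_ile1 // (semi_ge0 NS).
have [b [b1 bE bc bs]] := sqrt_exists dd1.
have sdd : cs_star (d ** d) = d ** d by rewrite cs_starM sd.
have [_ od] := sqrt_contraction nuP (bs sdd) sd (esym (bc d (cs_mulA d d d))) bE.
exact: (opb_norm nuP (z := emb d)).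
Qed.

(** By homogeneity, the self-adjoint case applied to [x^* x]. *)
Lemma cseminorm_le x : nu x <= N x.
Proof.
rewrite -ler_sqr ?nnegrE ?(semi_ge0 NS) ?(semi_ge0 nuS) // -(cn_star nuP) -(cn_star NP).
set h := cs_star x ** x; have sh : cs_star h = h by rewrite cs_starM cs_starK.
have [h0|h0] := eqVneq (N h) 0.
  by rewrite h0 (rnorm_eq0 h0) (semi0 nuS).
have hp : 0 < N h by rewrite lt_neqAle eq_sym h0 rnorm_ge0.
pose c : C := ((N h)^-1)%:C%C.
have cr : c^* = c by apply: conj_Creal; rewrite complex_real.
have mc : rmod c = (N h)^-1 by rewrite rmod_real ger0_norm // invr_ge0 ltW.
have : nu (c *: h) <= 1.
  apply: selfadjoint_le; first by rewrite cs_starZ sh cr.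
  by rewrite (semiZ NS) mc mulVf.
by rewrite (semiZ nuS) mc mulrC ler_pdivrMr // mul1r.
Qed.

Hypothesis nu_definite : forall x, nu x = 0 -> x = 0.

(** With [k = h^2], [b = 1 - |1 - 2k|] and [c = b/2], the element [g = k - c] is
   the positive part of [2k - 1], so that [g + g^2 = 2 k g]. If [nu h] were small,
   so would be [nu k], and this equation would force [nu g = 0]; then [2k = b] would
   contradict [N k = 1]. *)
Lemma selfadjoint_ge h : cs_star h = h -> N h = 1 -> 2^-1 <= nu h.
Proof.
move=> sh h1; rewrite leNgt; apply/negP => nh.
have [k kdef] : exists k, k = h ** h by exists (h ** h).
have sk : cs_star k = k by rewrite kdef cs_starM sh.
have kh : k ** h = h ** k by rewrite kdef cs_mulA.
have k1 : N k = 1 by rewrite kdef -{1}sh (cn_star NP) h1 expr1n.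
have nk : nu k < 4^-1.
  rewrite kdef -{1}sh (cn_star nuP); have := semi_ge0 nuS h; nra.
have [b0 [b01 b0E b0c b0s]] : exists b, [/\ N b <= 1, b + b - b ** b = k,
    forall z, z ** k = k ** z -> z ** b = b ** z & cs_star k = k -> cs_star b = b].
  by apply: sqrt_exists; rewrite k1.
have sb0 := b0s sk; have hb0 := b0c h (esym kh).
have [t tdef] : exists t, t = h - h ** b0 by exists (h - h ** b0).
have [d ddef] : exists d, d = t + t by exists (t + t).
have st : cs_star t = t.
  apply: emb_inj; rewrite -star_emb tdef embB starB !star_emb cs_starM sh sb0 hb0.
  by rewrite -embB.
have sd : cs_star d = d by rewrite ddef cs_starD st.
have tE : emb t = emb h * (1 - emb b0) by rewrite mulrBr mulr1 -embM tdef embB.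
have hT : emb h * (1 - emb b0) = (1 - emb b0) * emb h.
  by rewrite mulrBr mulrBl mulr1 mul1r -!embM hb0.
have tt : t ** t = k - k ** k.
  apply: emb_inj; rewrite embM.
  have TT : (1 - emb b0) * (1 - emb b0) = 1 - emb k.
    rewrite -b0E mulrBl mul1r mulrBr mulr1 embB embD embM.
    by rewrite -[emb b0 + _ - _]addrA [- (emb b0 + _) in RHS]opprD [RHS]addrA.
  rewrite tE {2}hT mulrA -(mulrA (emb h)) TT mulrBr mulrBl mulr1 -!embM.
  by rewrite embB kdef !cs_mulA.
have dist (u v : A) : u - v + (u - v) = u + u - (v + v) by rewrite opprD addrACA.
have dd : d ** d = k + k + (k + k) - (k + k) ** (k + k).
  by rewrite ddef !csDl !csDr /= tt !dist.
have kb0 : k ** b0 = b0 ** k by exact: b0c.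
have kt : k ** t = t ** k.
  by rewrite tdef csBr csBl /= kh cs_mulA kh -!cs_mulA kb0.
have kd : k ** d = d ** k by rewrite ddef csDr csDl /= kt.
have rot mu (muP : cseminorm mu) : opb mu (1 - emb (k + k)) 1 /\ opb mu (emb d) 1.
  apply: sqrt_contraction => //; first by rewrite cs_starD sk.
  by rewrite csDl csDr /= kd.
have d1 : N d <= 1 by have [_ od] := rot _ NP; exact: (opb_norm NP (z := emb d)).
have dd1 : N (d ** d) <= 1.
  by rewrite (le_trans (cn_mul NP _ _)) // mulr_ile1 // (semi_ge0 NS).
have [b [b1 bE bc _]] := sqrt_exists dd1.
have kb : k ** b = b ** k by apply: bc; rewrite cs_mulA kd -!cs_mulA kd.
pose c := (2^-1 : C) *: b; have cc : c + c = b by rewrite -scalerDr half_add.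
have kc : k ** c = c ** k by rewrite csZr csZl /= kb.
have dblI (u v : A) : u + u = v + v -> u = v.
  by move=> e; rewrite -(half_add u) e half_add.
have cE : c - c ** c = k - k ** k.
  apply: (dblI); apply: (dblI); rewrite !dist; move: bE; rewrite dd -cc.
  by rewrite !csDl !csDr.
have kcE : k - c = k ** k - c ** c.
  by apply/eqP; rewrite subr_eq addrAC eq_sym -addrA cE addrC subrK.
pose g := k - c.
have gE : g + g ** g = k ** g + k ** g.
  have -> : g ** g = (k ** k - k ** c) + (c ** c - k ** c).
    by rewrite /g csBl !csBr /= -kc opprB.
  by rewrite {1}/g kcE addrCA subrKA /g csBr.
(* [x + x g] is [3/2 x] minus two terms of norms at most [nu x / 2] each, by
   [2 g = 2 k - b]: these are half of [x (1 - 2 k)] and of [x b]. *)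
have ng x : nu x <= 2 * nu (x + x ** g).
  have -> : 2 * nu (x + x ** g) = nu ((x + x ** g) + (x + x ** g)).
    by rewrite -mulr2n (semiMn nuS) mulr_natl.
  have e : x + x + x = x + x ** g + (x + x ** g) + (emb x * (1 - emb (k + k))).2 + x ** b.
    have -> : (emb x * (1 - emb (k + k))).2 = x - (x ** k + x ** k).
      by apply: emb_inj; rewrite emb_act mulrBr mulr1 -embM embB csDr.
    rewrite /g csBr -cc csDr [x + _ + (x + _)]addrACA dist.
    set P := x ** k + _; set Q := x ** c + _.
    by rewrite [X in _ = X + _]addrACA [P - Q]addrC addrK addrNK.
  have [o1 _] := rot _ nuP; have := o1 x; rewrite mul1r => h2.
  have h3 := cn_mul nuP x b; have h4 := cseminorm_le b.
  have h5 : nu (x + x + x) = 3 * nu x.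
    by rewrite -[x + x]mulr2n -mulrSr (semiMn nuS) mulr_natl.
  have h6 : nu (x + x + x) <= nu (x + x ** g + (x + x ** g)) + nu (emb x * (1 - emb (k + k))).2 + nu (x ** b).
    by rewrite e (le_trans (semiD nuS _ _)) // lerD2r (semiD nuS).
  have h7 := semi_ge0 nuS x; have h8 : nu x * nu b <= nu x * 1 by rewrite ler_wpM2l //; lra.
  lra.
have ng0 : nu g = 0.
  have h1' := ng g; have h2 := cn_mul nuP k g; have h3 := semi_ge0 nuS g.
  have h4 : nu (g + g ** g) = 2 * nu (k ** g).
    by rewrite gE -mulr2n (semiMn nuS) mulr_natl.
  rewrite h4 in h1'; nra.
have kcE' : k = c by apply/eqP; rewrite -subr_eq0; apply/eqP/nu_definite.
have : N k <= 2^-1 by rewrite kcE' N_half; lra.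
rewrite k1; lra.
Qed.

Lemma sq_iter_norm h n : cs_star h = h ->
  exists2 k, cs_star k = k & forall mu, cseminorm mu -> mu k = mu h ^+ (2 ^ n).
Proof.
move=> sh; elim: n => [|n [k sk kP]]; first by exists h.
exists (k ** k) => [|mu' mP]; first by rewrite cs_starM sk.
by rewrite -{1}sk (cn_star mP) kP // -exprM expnSr.
Qed.

(** C*-norms on a C*-algebra coincide with its norm: constants disappear under
   [nu (h^2) = nu h ^2]. *)
Theorem cnorm_unique x : nu x = N x.
Proof.
apply/eqP; rewrite eq_le cseminorm_le /=.
rewrite -ler_sqr ?nnegrE ?(semi_ge0 NS) ?(semi_ge0 nuS) // -(cn_star nuP) -(cn_star NP).
set h := cs_star x ** x; have sh : cs_star h = h by rewrite cs_starM cs_starK.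
(* Both norms are equivalent on self-adjoint elements, with the constant 2. *)
have weak k : cs_star k = k -> N k <= 2 * nu k.
  move=> sk; have [k0|k0] := eqVneq (N k) 0.
    by rewrite k0 mulr_ge0 // (semi_ge0 nuS).
  have kp : 0 < N k by rewrite lt_neqAle eq_sym k0 rnorm_ge0.
  pose c : C := ((N k)^-1)%:C%C.
  have cr : c^* = c by apply: conj_Creal; rewrite complex_real.
  have mc : rmod c = (N k)^-1 by rewrite rmod_real ger0_norm // invr_ge0 ltW.
  have : 2^-1 <= nu (c *: k).
    apply: selfadjoint_ge; first by rewrite cs_starZ sk cr.
    by rewrite (semiZ NS) mc mulVf.
  rewrite (semiZ nuS) mc mulrC ler_pdivlMr //; lra.
rewrite leNgt; apply/negP => lt.
have nh0 := semi_ge0 nuS h.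
have pow n : N h ^+ (2 ^ n) <= 2 * nu h ^+ (2 ^ n).
  have [k sk kP] := sq_iter_norm n sh.
  by rewrite -(kP _ NP) -(kP _ nuP); apply: weak.
have hp : 0 < N h by apply: le_lt_trans lt.
have [nz|np] := leP (nu h) 0.
  have nh : nu h = 0 by apply/eqP; rewrite eq_le nz.
  by have := pow 0%N; rewrite expn0 !expr1 nh; lra.
pose e := N h / nu h - 1.
have e0 : 0 < e by rewrite subr_gt0 ltr_pdivlMr // mul1r.
(* Bernoulli: a ratio of the norms above 1 would exceed 2 after enough squarings. *)
have grow n : 1 + (2 ^ n)%:R * e <= (1 + e) ^+ (2 ^ n).
  elim: n => [|n IH]; first by rewrite expn0 mul1r expr1.
  rewrite expnSr exprM.
  have q0 : 0 <= (2 ^ n)%:R * e by rewrite mulr_ge0 // ltW.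
  have : (1 + (2 ^ n)%:R * e) ^+ 2 <= ((1 + e) ^+ (2 ^ n)) ^+ 2.
    by rewrite ler_sqr ?nnegrE //; [lra | rewrite exprn_ge0 //; lra].
  apply: le_trans; rewrite natrM; nra.
have bnd n : (2 ^ n)%:R * e <= 1.
  have := pow n; rewrite -ler_pdivrMr ?exprn_gt0 // -exprVn -exprMn.
  have -> : N h / nu h = 1 + e by rewrite /e addrC subrK.
  by have := grow n; lra.
have [M HM] := small_inv e0; have := HM M (leqnn M); rewrite /invS => h1.
have := bnd M.+1; apply/negP; rewrite -ltNge -ltr_pdivrMr // div1r.
apply: (@lt_trans _ _ M.+1%:R); last by rewrite ltr_nat ltn_expl.
by rewrite -[_.+1%:R]invrK ltf_pV2 // posrE invr_gt0 ltr0n.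
Qed.

End Compare.
End SquareRoot.

(** * Geometry of Q-spaces *)

Lemma tensor_linear_ext (K : fieldType) (U V W : lmodType K)
  (f g : {linear tensor U V -> W}) :
  (forall a x, f (tens a x) = g (tens a x)) -> f =1 g.
Proof.
move=> fg; elim/tensor_ind => [|a x u IH]; first by rewrite !linear0.
by rewrite !linearD IH fg.
Qed.

Section QSpaceGeometry.
Variables (R : realType) (S : setting R).
Local Notation C := R[i].

Lemma unit_vector : exists e : S, rnorm e = 1.
Proof.
have [[|e es] [eo sz]] // := orthonormal_of_size (@st_infinite R S) 1.
by case: eo => e1 _ _; exists e.
Qed.

Definition dia_r (c a : fin_op S) : fin_op S := diamond a c.
Definition dia_l (c a : fin_op S) : fin_op S := diamond c a.

HB.instance Definition _ c := GRing.isLinear.Build C (fin_op S) (fin_op S) *:%R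
  (dia_r c) (diamond_linearl c).
HB.instance Definition _ c := GRing.isLinear.Build C (fin_op S) (fin_op S) *:%R
  (dia_l c) (diamond_linearr c).

Section Amplifications.
Variable E : lmodType C.

Definition fdia_r c : {linear fin_tensor S E -> fin_tensor S E} := tmap (dia_r c) (@idfun E).
Definition fdia_l c : {linear fin_tensor S E -> fin_tensor S E} := tmap (dia_l c) (@idfun E).

Lemma fdia_rE c a x : fdia_r c (tens a x) = tens (diamond a c) x.
Proof. exact: tmapE. Qed.

Lemma fdia_lE c a x : fdia_l c (tens a x) = tens (diamond c a) x.
Proof. exact: tmapE. Qed.

Lemma flmulE (a : bop S) b (x : E) : flmul E a (tens b x) = tens (fin_lmul a b) x.
Proof. exact: tmapE. Qed.

Lemma frmulE (a : bop S) b (x : E) : frmul E a (tens b x) = tens (fin_rmul a b) x.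
Proof. exact: tmapE. Qed.

Lemma amplE (F : lmodType C) (phi : {linear E -> F}) a (x : E) :
  ampl S phi (tens a x) = tens a (phi x).
Proof. exact: tmapE. Qed.

Lemma tensor_support (u : fin_tensor S E) : exists es, orthonormal_seq es /\
  is_support (fin_bop (proj_on es)) u.
Proof.
have [es [eso esP]] := common_support [seq p.1 | p <- repr u].
have oP := proj_on_projection eso; exists es; split=> //; split=> //.
  rewrite (tensor_sum u) linear_sum /= big_seq [RHS]big_seq.
  apply: eq_bigr => p pu; rewrite flmulE; congr (tens _ _); apply: fin_op_ext => x.
  by have [h _] := esP _ (map_f fst pu); exact: h.
rewrite (tensor_sum u) linear_sum /= big_seq [RHS]big_seq.
apply: eq_bigr => p pu; rewrite frmulE; congr (tens _ _); apply: fin_op_ext => x.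
by have [_ h] := esP _ (map_f fst pu); exact: h.
Qed.

End Amplifications.

Lemma idfun_bounded : bounded_op (@idfun S).
Proof. by exists 1 => x; rewrite mul1r. Qed.

Lemma idfun_lin : linear (@idfun S).
Proof. by []. Qed.

Definition id_bop : bop S := to_bop idfun_lin idfun_bounded.

Lemma id_bop_norm : op_norm id_bop <= 1.
Proof. by apply: op_norm_le => // x; rewrite mul1r. Qed.

Section Norms.
Variable E : qspace S.

Lemma qnorm_seminorm : seminorm (@qnorm R S E).
Proof. by split; [exact: (qnorm_triangle (qnormP E)) | exact: (qnorm_scale (qnormP E))]. Qed.
Let qS := qnorm_seminorm.

Lemma qnorm_bimod (a b : bop S) (M K : R) (u : fin_tensor S E) :
  op_norm a <= M -> op_norm b <= K ->
  qnorm (flmul E a (frmul E b u)) <= M * K * qnorm u.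
Proof.
move=> aM bK; have := qnorm_bimodule (qnormP E) a b u.
have := op_norm_ge0 a; have := op_norm_ge0 b; have := semi_ge0 qS u => u0 b0 a0.
move=> h; rewrite (le_trans h) // mulrAC.
apply: ler_wpM2r => //; apply: ler_pM => //.
Qed.

Lemma qnorm_contr (a b : bop S) (u : fin_tensor S E) :
  op_norm a <= 1 -> op_norm b <= 1 -> qnorm (flmul E a (frmul E b u)) <= qnorm u.
Proof. by move=> a1 b1; have := qnorm_bimod u a1 b1; rewrite !mul1r. Qed.

Lemma frmul_id (u : fin_tensor S E) : frmul E id_bop u = u.
Proof.
apply: (@tensor_linear_ext _ _ _ _ (frmul E id_bop) idfun) => a x.
by rewrite frmulE; congr (tens _ _); apply: fin_op_ext.
Qed.

Lemma qnorm_flmul (a : bop S) (u : fin_tensor S E) :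
  op_norm a <= 1 -> qnorm (flmul E a u) <= qnorm u.
Proof.
by move=> a1; have := qnorm_contr u a1 id_bop_norm; rewrite frmul_id.
Qed.

Lemma qnorm_theta (e f g : S) (y : E) : rnorm e = 1 ->
  qnorm (tens (theta f g) y) <= rnorm f * rnorm g * qnorm (tens (theta e e) y).
Proof.
move=> e1.
have -> : tens (theta f g) y = flmul E (fin_bop (theta f e))
    (frmul E (fin_bop (theta e g)) (tens (theta e e) y)).
  rewrite frmulE flmulE; congr (tens _ _); apply: fin_op_ext => x.
  rewrite fin_lmulE fin_rmulE /= !thetaE !hdotZl hdot_unit // !mulr1.
  by [].
apply: qnorm_bimod; rewrite (le_trans (op_normM_theta _ _)) // e1 ?mulr1 ?mul1r //.
Qed.

Lemma qnorm_tens_bound (e : S) (a : fin_op S) : rnorm e = 1 ->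
  exists2 K : R, 0 <= K & forall y : E, qnorm (tens a y) <= K * qnorm (tens (theta e e) y).
Proof.
move=> e1; have [s sE] := fin_op_thetas a.
exists (\sum_(p <- s) rnorm p.1 * rnorm p.2).
  by apply: sumr_ge0 => p _; rewrite mulr_ge0 ?rnorm_ge0.
move=> y; rewrite sE linear_sumlz (le_trans (semi_sum qS _ _ _)) // mulr_suml.
by apply: ler_sum => p _; apply: qnorm_theta.
Qed.

(** Conjugation by an isometry and by its adjoint, both of norm at most 1. *)
Lemma fdia_r_theta e (u : fin_tensor S E) : rnorm e = 1 ->
  qnorm (fdia_r E (theta e e) u) = qnorm u.
Proof.
move=> e1; have [V [W [_ [_ [[nV nW] _ dE _ aE]]]]] := ten_isometries e1.
apply/eqP; rewrite eq_le; apply/andP; split.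
  have -> : fdia_r E (theta e e) u = flmul E V (frmul E W u).
    apply: (@tensor_linear_ext _ _ _ _ (fdia_r E _) (flmul E V \o frmul E W)) => a x.
    by rewrite fdia_rE /= frmulE flmulE dE.
  exact: qnorm_contr.
have {1}-> : u = flmul E W (frmul E V (fdia_r E (theta e e) u)).
  apply: (@tensor_linear_ext _ _ _ _ idfun (flmul E W \o frmul E V \o fdia_r E _)) => a x.
  by rewrite /= fdia_rE frmulE flmulE -aE.
exact: qnorm_contr.
Qed.

Lemma fdia_l_theta e (u : fin_tensor S E) : rnorm e = 1 ->
  qnorm (fdia_l E (theta e e) u) <= qnorm u.
Proof.
move=> e1; have [_ [_ [V [W [_ [nV nW] _ dE _]]]]] := ten_isometries e1.
have -> : fdia_l E (theta e e) u = flmul E V (frmul E W u).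
  apply: (@tensor_linear_ext _ _ _ _ (fdia_l E _) (flmul E V \o frmul E W)) => a x.
  by rewrite fdia_lE /= frmulE flmulE dE.
exact: qnorm_contr.
Qed.

Lemma diamond_projection (p p' : fin_op S) : oprojection p -> oprojection p' ->
  oprojection (diamond p p').
Proof.
move=> [pp pa] [pp' pa']; split; last exact: diamond_adjoint.
move=> x; have /(congr1 (fun c => fin_fun c x)) := diamondM p p' p p'.
rewrite fin_lmulE /= => ->; congr (fin_fun (diamond _ _) x); apply: fin_op_ext => z.
  exact: pp.
exact: pp'.
Qed.

Lemma theta_projection (e : S) : rnorm e = 1 -> oprojection (theta e e).
Proof.
move=> e1; split; last exact: theta_adjoint.
by move=> x; rewrite !thetaE hdotZl hdot_unit // mulr1.
Qed.

Lemma lmul_proj (p : fin_op S) : oprojection p -> fin_lmul (fin_bop p) p = p.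
Proof. by move=> [pp _]; apply: fin_op_ext => x; rewrite fin_lmulE; exact: pp. Qed.

Lemma fin_rlmul (a b : fin_op S) : fin_rmul (fin_bop a) b = fin_lmul (fin_bop b) a.
Proof. exact: fin_op_ext. Qed.

Lemma fdia_r_support (p p' : fin_op S) (u : fin_tensor S E) : oprojection p' ->
  is_support (fin_bop p) u ->
  is_support (fin_bop (diamond p p')) (fdia_r E p' u).
Proof.
move=> op' [op pu up]; split; first exact: diamond_projection.
  rewrite -{2}pu.
  apply: (@tensor_linear_ext _ _ _ _ (flmul E (fin_bop (diamond p p')) \o fdia_r E p')
    (fdia_r E p' \o flmul E (fin_bop p))) => a x.
  by rewrite /= fdia_rE flmulE flmulE fdia_rE diamondM lmul_proj.
rewrite -{2}up.
apply: (@tensor_linear_ext _ _ _ _ (frmul E (fin_bop (diamond p p')) \o fdia_r E p')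
  (fdia_r E p' \o frmul E (fin_bop p))) => a x.
rewrite /= fdia_rE frmulE frmulE fdia_rE.
by rewrite fin_rlmul diamondM (lmul_proj op') -fin_rlmul.
Qed.

Lemma fdia_l_support (p p' : fin_op S) (u : fin_tensor S E) : oprojection p' ->
  is_support (fin_bop p) u ->
  is_support (fin_bop (diamond p' p)) (fdia_l E p' u).
Proof.
move=> op' [op pu up]; split; first exact: diamond_projection.
  rewrite -{2}pu.
  apply: (@tensor_linear_ext _ _ _ _ (flmul E (fin_bop (diamond p' p)) \o fdia_l E p')
    (fdia_l E p' \o flmul E (fin_bop p))) => a x.
  by rewrite /= fdia_lE flmulE flmulE fdia_lE diamondM lmul_proj.
rewrite -{2}up.
apply: (@tensor_linear_ext _ _ _ _ (frmul E (fin_bop (diamond p' p)) \o fdia_l E p')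
  (fdia_l E p' \o frmul E (fin_bop p))) => a x.
rewrite /= fdia_lE frmulE frmulE fdia_lE.
by rewrite fin_rlmul diamondM (lmul_proj op') -fin_rlmul.
Qed.

Lemma diamond0l a : diamond (0 : fin_op S) a = 0.
Proof. exact: (linear0l (@diamond R S)). Qed.

Lemma diamond0r a : diamond a (0 : fin_op S) = 0.
Proof. exact: (linear0r (@diamond R S)). Qed.

(** For [e] in an orthonormal family, the copies of [u] tensored with [theta e e]
   have mutually orthogonal supports, so the norm of their sum is the maximum of
   their norms. *)
Lemma fdia_r_proj es (u : fin_tensor S E) : orthonormal_seq es ->
  qnorm (fdia_r E (proj_on es) u) <= qnorm u.
Proof.
have [fs [fo sup]] := tensor_support u; set p := proj_on fs in sup.
elim: es => [|e es IH] /=.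
  move=> _; suff -> : fdia_r E (proj_on [::]) u = 0 by rewrite (semi0 qS) semi_ge0.
  apply: (@tensor_linear_ext _ _ _ _ (fdia_r E _) \0) => a x.
  by rewrite fdia_rE /proj_on big_nil diamond0r linear0l.
move=> [e1 eo eso].
have -> : fdia_r E (proj_on (e :: es)) u = fdia_r E (theta e e) u + fdia_r E (proj_on es) u.
  elim/tensor_ind: u {IH sup} => [|a x u IH]; first by rewrite !linear0 addr0.
  rewrite [LHS]linearD IH ![fdia_r E _ (_ + u)]linearD addrACA; congr (_ + _).
  by rewrite !fdia_rE /proj_on big_cons diamondDr tensDl.
rewrite (qnorm_orthogonal (qnormP E) (P := fin_bop (diamond p (theta e e)))
  (Q := fin_bop (diamond p (proj_on es)))).
- by rewrite ge_max fdia_r_theta // lexx IH.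
- apply: fdia_r_support => //; exact: theta_projection.
- apply: fdia_r_support => //; exact: proj_on_projection.
- move=> x; rewrite -[LHS]/(fin_lmul (fin_bop _) _ x) diamondM.
  suff -> : fin_lmul (fin_bop (theta e e)) (proj_on es) = 0 by rewrite diamond0r.
  apply: fin_op_ext => z; rewrite fin_lmulE /= thetaE proj_on_adjoint proj_on0 //.
  by rewrite hdot0r scale0r.
- move=> x; rewrite -[LHS]/(fin_lmul (fin_bop _) _ x) diamondM.
  suff -> : fin_lmul (fin_bop (proj_on es)) (theta e e) = 0 by rewrite diamond0r.
  by apply: fin_op_ext => z; rewrite fin_lmulE /= thetaE finop_scale proj_on0 // scaler0.
Qed.

Lemma fdia_l_proj es (u : fin_tensor S E) : orthonormal_seq es ->
  qnorm (fdia_l E (proj_on es) u) <= qnorm u.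
Proof.
have [fs [fo sup]] := tensor_support u; set p := proj_on fs in sup.
elim: es => [|e es IH] /=.
  move=> _; suff -> : fdia_l E (proj_on [::]) u = 0 by rewrite (semi0 qS) semi_ge0.
  apply: (@tensor_linear_ext _ _ _ _ (fdia_l E _) \0) => a x.
  by rewrite fdia_lE /proj_on big_nil diamond0l linear0l.
move=> [e1 eo eso].
have -> : fdia_l E (proj_on (e :: es)) u = fdia_l E (theta e e) u + fdia_l E (proj_on es) u.
  elim/tensor_ind: u {IH sup} => [|a x u IH]; first by rewrite !linear0 addr0.
  rewrite [LHS]linearD IH ![fdia_l E _ (_ + u)]linearD addrACA; congr (_ + _).
  by rewrite !fdia_lE /proj_on big_cons diamondDl tensDl.
rewrite (qnorm_orthogonal (qnormP E) (P := fin_bop (diamond (theta e e) p))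
  (Q := fin_bop (diamond (proj_on es) p))).
- by rewrite ge_max fdia_l_theta // IH.
- apply: fdia_l_support => //; exact: theta_projection.
- apply: fdia_l_support => //; exact: proj_on_projection.
- move=> x; rewrite -[LHS]/(fin_lmul (fin_bop _) _ x) diamondM.
  suff -> : fin_lmul (fin_bop (theta e e)) (proj_on es) = 0 by rewrite diamond0l.
  apply: fin_op_ext => z; rewrite fin_lmulE /= thetaE proj_on_adjoint proj_on0 //.
  by rewrite hdot0r scale0r.
- move=> x; rewrite -[LHS]/(fin_lmul (fin_bop _) _ x) diamondM.
  suff -> : fin_lmul (fin_bop (proj_on es)) (theta e e) = 0 by rewrite diamond0l.
  by apply: fin_op_ext => z; rewrite fin_lmulE /= thetaE finop_scale proj_on0 // scaler0.
Qed.

Lemma rank_oneE (p : fin_op S) : rank_one_projection p ->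
  exists2 e, rnorm e = 1 & p = theta e e.
Proof.
move=> [[pp pa] [f f0 fP]].
have nf : rnorm f != 0 by apply: contra_neq f0 => /rnorm_eq0.
pose c : C := ((rnorm f)^-1)%:C%C; have e1 : rnorm (c *: f) = 1 by exact: unit_scale.
have c0 : c != 0 by apply/eqP => /(congr1 (@rmod R)); rewrite rmod0 rmod_real => /eqP; rewrite normr_eq0 invr_eq0 (negbTE nf).
exists (c *: f) => //; set e := c *: f.
have pe : p e = e.
  have : range p f by rewrite fP; exists 1 => //; rewrite scale1r.
  by case=> x _ xf; rewrite /e finop_scale -xf pp.
apply: fin_op_ext => x; rewrite thetaE.
have [k _ kE] : [set c *: f | c in setT] (p x) by rewrite -fP; exists x.
have kE' : p x = (k / c) *: e by rewrite -kE scalerA mulfVK.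
rewrite -pe -pa kE' hdotZl hdot_unit // mulr1 pe.
by [].
Qed.

End Norms.
End QSpaceGeometry.

(** * The standard quantization *)

Lemma closed_seq (R : realType) (V : normedModType R[i]) (B : set V) (s : nat -> V) l :
  closed B -> (forall n, B (s n)) -> cv (@rnorm R V) s l -> B l.
Proof.
move=> cB Bs sl; apply: cB => U /nbhs_ballP[_ /posc[e e0 ->] eU].
have [n hn] := sl _ e0; exists (s n); split=> //; apply: eU.
by rewrite rnorm_ball (semi_distC (rnorm_seminorm V)); apply: hn.
Qed.

Lemma orthonormal_cat (R : realType) (H : hilbert R) (es fs : seq H) :
  orthonormal_seq (es ++ fs) ->
  orthonormal_seq es /\ forall e f, e \in es -> f \in fs -> hdot H e f = 0.
Proof.
elim: es => //= e es IH [e1 eo /IH[eso ef]]; split.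
  by split=> // f fes; apply: eo; rewrite mem_cat fes.
move=> e' f; rewrite inE => /orP[/eqP->|ees] ffs; last exact: ef.
by apply: eo; rewrite mem_cat ffs orbT.
Qed.

Section StandardQuantization.
Variables (R : realType) (S : setting R) (A : cstar_algebra R).
Variable q : standard_quantization S A.
Local Notation C := R[i].
Local Notation "x ** y" := (cs_mul A x y) (at level 40, left associativity).
Local Notation Q := (sq_norm q).
Local Notation FA := (fin_tensor S A).

Let QS : seminorm Q := qnorm_seminorm (std_qspace q).

(** Tensoring with a projection is a *-homomorphism from [A] to its amplification. *)
Lemma proj_cseminorm (p : fin_op S) : oprojection p ->
  cseminorm (fun x : A => Q (tens p x)).
Proof.
move=> op; have [m [st [[mb mE] [sD sE] mQ mstar]]] := sq_cstar q.
have mp x y : m (tens p x) (tens p y) = tens p (x ** y) by rewrite mE lmul_proj.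
have sp x : st (tens p x) = tens p (cs_star x) by apply: sE; exact: op.2.
split; first by split=> *; rewrite ?tensDr ?tensZr ?(semiD QS) ?(semiZ QS).
- by move=> x y; rewrite -mp.
- by move=> x; rewrite -mstar sp mp.
Qed.

Lemma proj_norm_le (p : fin_op S) (x : A) : oprojection p -> Q (tens p x) <= rnorm x.
Proof. by move=> op; have := cseminorm_le (proj_cseminorm op) x. Qed.

(** For a projection of rank one this homomorphism is injective, so uniqueness of
   the C*-norm applies: the quantization restricts to the original norm, which is
   what makes it complete. *)
Lemma unit_norm (e : S) (x : A) : rnorm e = 1 -> Q (tens (theta e e) x) = rnorm x.
Proof.
move=> e1; have cn := proj_cseminorm (theta_projection e1).
apply: (cnorm_unique cn) => y /(qnorm_definite (sq_qnorm q)).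
move/(congr1 (slice A e e)); rewrite linear0 /slice /= tliftE /= /slice_fun.
by rewrite thetaE hdotZl hdot_unit // mulr1 scale1r.
Qed.

(** ** Positivity *)

(** The columns with values in [A], the entries being placed along the vectors [p.1]
   of an orthonormal family. *)
Definition column (e0 : S) (ps : seq (S * A)) : FA :=
  \sum_(p <- ps) tens (theta p.1 e0) p.2.

Lemma column_square m st e0 ps : is_fin_mul m -> is_fin_star st ->
  orthonormal_seq [seq p.1 | p <- ps] ->
  m (st (column e0 ps)) (column e0 ps) =
  tens (theta e0 e0) (\sum_(p <- ps) cs_star p.2 ** p.2).
Proof.
move=> [mb mE] [sD sE]; have st0 : st 0 = 0.
  by apply: (addrI (st 0)); rewrite -sD !addr0.
have stE (e : S) z : st (tens (theta e e0) z) = tens (theta e0 e) (cs_star z).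
  by apply: sE; exact: theta_adjoint.
have mth (e f : S) x y : m (tens (theta e0 e) x) (tens (theta f e0) y) =
    tens (hdot S f e *: theta e0 e0) (x ** y).
  rewrite mE; congr (tens _ _); apply: fin_op_ext => z.
  by rewrite fin_lmulE /= finZ !thetaE hdotZl !scalerA mulrC.
elim: ps => [|[e z] ps IH] /=.
  by rewrite /column !big_nil (bil0r mb) linear0r.
move=> [e1 eo /IH{}IH]; rewrite /column !big_cons -/(column e0 ps) /=.
have o1 x : m (tens (theta e0 e) x) (column e0 ps) = 0.
  have : forall f, f \in [seq p.1 | p <- ps] -> hdot S e f = 0 by [].
  rewrite /column; elim: (ps) => [|[f y] qs IHq] h; first by rewrite big_nil (bil0r mb).
  rewrite big_cons (bilDr mb) mth hdotC h ?mem_head // conjC0 scale0r linear0l add0r.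
  by apply: IHq => g gq; apply: h; rewrite inE gq orbT.
have o2 x : m (st (column e0 ps)) (tens (theta e e0) x) = 0.
  have : forall f, f \in [seq p.1 | p <- ps] -> hdot S e f = 0 by [].
  rewrite /column; elim: (ps) => [|[f y] qs IHq] h; first by rewrite big_nil st0 (bil0l mb).
  rewrite big_cons sD (bilDl mb) stE mth h ?mem_head // scale0r linear0l add0r.
  by apply: IHq => g gq; apply: h; rewrite inE gq orbT.
rewrite sD stE (bilDl mb) !(bilDr mb) o1 o2 add0r addr0 IH mth hdot_unit // scale1r.
by rewrite tensDr.
Qed.

Lemma orthonormal_zip (zs : seq A) : exists ps : seq (S * A),
  orthonormal_seq [seq p.1 | p <- ps] /\ [seq p.2 | p <- ps] = zs.
Proof.
have [es [eso sz]] := orthonormal_of_size (@st_infinite R S) (size zs).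
exists (zip es zs); split.
  by rewrite -/(unzip1 _) unzip1_zip // sz.
by rewrite -/(unzip2 _) unzip2_zip // sz.
Qed.

(** Cutting a column down to its first entries is a multiplication by a
   projection, hence does not increase its norm. *)
Theorem sum_squares_le (zs ws : seq A) :
  rnorm (\sum_(z <- zs) cs_star z ** z) <=
  rnorm (\sum_(z <- zs) cs_star z ** z + \sum_(w <- ws) cs_star w ** w).
Proof.
have [m [st [mP sP mQ mstar]]] := sq_cstar q.
have [e0 e01] := unit_vector S.
have [rs [ro rE]] := orthonormal_zip (zs ++ ws).
pose ps := take (size zs) rs; pose qs := drop (size zs) rs.
have psE : [seq p.2 | p <- ps] = zs by rewrite /ps map_take rE take_size_cat.
have qsE : [seq p.2 | p <- qs] = ws by rewrite /qs map_drop rE drop_size_cat.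
have rsE : rs = ps ++ qs by rewrite cat_take_drop.
move: ro; rewrite rsE map_cat => ro; have [po pq] := orthonormal_cat ro.
rewrite -map_cat -rsE in ro.
have norm ts : orthonormal_seq [seq p.1 | p <- ts] ->
    rnorm (\sum_(p <- ts) cs_star p.2 ** p.2) = Q (column e0 ts) ^+ 2.
  by move=> to; rewrite -(unit_norm _ e01) -(column_square e0 mP sP to) mstar.
have -> : \sum_(z <- zs) cs_star z ** z = \sum_(p <- ps) cs_star p.2 ** p.2.
  by rewrite -psE big_map.
have -> : \sum_(p <- ps) cs_star p.2 ** p.2 + \sum_(w <- ws) cs_star w ** w =
    \sum_(p <- rs) cs_star p.2 ** p.2.
  by rewrite -qsE big_map rsE big_cat.
rewrite !norm // ler_sqr ?nnegrE ?(semi_ge0 QS) //.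
pose P := proj_on [seq p.1 | p <- ps].
have -> : column e0 ps = flmul A (fin_bop P) (column e0 rs).
  rewrite rsE /column big_cat /= linearD !linear_sum /=.
  rewrite [X in _ = _ + X]big_seq [X in _ = _ + X]big1 ?addr0 => [|p pin].
    rewrite big_seq [RHS]big_seq; apply: eq_bigr => p pin; rewrite flmulE lmul_theta /=.
    by rewrite /P proj_on_mem // map_f.
  rewrite flmulE lmul_theta /= /P proj_on0 => [|f fin]; last first.
    by rewrite hdotC (pq f p.1) ?conjC0 ?map_f.
  suff -> : theta (0 : S) e0 = 0 by rewrite linear0l.
  by apply: fin_op_ext => z; rewrite thetaE scaler0.
apply: (qnorm_flmul (E := std_qspace q)); apply: projection_op_norm.
exact: proj_on_projection.
Qed.

(** ** Complete contractivity of the multiplication *)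

Lemma ampl_mul_factor m p p' (u v : FA) : is_fin_mul m ->
  m (fdia_r A p u) (fdia_l A p' v) =
  bampl (cs_mul A) (frmul A (fin_bop p') u) (flmul A (fin_bop p) v).
Proof.
move=> [mb mE]; have [bb bE] := bamplP S (cs_mul A).
elim/tensor_ind: u => [|a x u IH]; first by rewrite !linear0 (bil0l mb) (bil0l bb).
rewrite !linearD /= (bilDl mb) (bilDl bb) IH; congr (_ + _).
elim/tensor_ind: v {IH} => [|b y v IH]; first by rewrite !linear0 (bil0r mb) (bil0r bb).
rewrite !linearD /= (bilDr mb) (bilDr bb) IH; congr (_ + _).
by rewrite fdia_rE fdia_lE frmulE flmulE mE bE diamondM -fin_rlmul.
Qed.

(** If [P] supports [v] and [P'] supports [u], the diamond product of [u] and [v]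
   is the product, in the amplified C*-algebra, of [u] tensored with [P] and of [P']
   tensored with [v]. *)
Theorem mul_contractive (u v : FA) : Q (bampl (cs_mul A) u v) <= Q u * Q v.
Proof.
have [m [st [mP _ mQ _]]] := sq_cstar q.
have [es [eso [_ _ up]]] := tensor_support u.
have [fs [fso [_ pv _]]] := tensor_support v.
rewrite -{1}up -{1}pv -(ampl_mul_factor _ _ _ _ mP) (le_trans (mQ _ _)) //.
apply: ler_pM; rewrite ?(semi_ge0 QS) //.
  exact: (fdia_r_proj (E := std_qspace q)).
exact: (fdia_l_proj (E := std_qspace q)).
Qed.

Definition rmulA (d x : A) : A := x ** d.

Lemma rmulA_linear d : linear (rmulA d).
Proof. by move=> c x y; rewrite /rmulA csDl csZl. Qed.

HB.instance Definition _ d := GRing.isLinear.Build C A A *:%R (rmulA d) (rmulA_linear d).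

(** On a support [P] of [u], the amplified right multiplication by [d] is a product
   with the elementary tensor of [P] and [d]. *)
Lemma ampl_rmul_le d (u : FA) : Q (ampl S (rmulA d) u) <= Q u * rnorm d.
Proof.
have [m [st [[mb mE] _ mQ _]]] := sq_cstar q.
have [es [eso [_ _ up]]] := tensor_support u.
have -> : ampl S (rmulA d) u = m u (tens (proj_on es) d).
  rewrite -{1}up; elim/tensor_ind: u {up} => [|a x u IH].
    by rewrite !linear0 (bil0l mb).
  rewrite !linearD /= (bilDl mb) IH mE frmulE; congr (_ + _).
  by rewrite -fin_rlmul; exact: amplE.
rewrite (le_trans (mQ _ _)) // ler_wpM2l ?(semi_ge0 QS) // proj_norm_le //.
exact: proj_on_projection.
Qed.

Lemma underlying_rnorm p (x : A) : rank_one_projection p ->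
  @underlying_norm R S (std_qspace q) p x = rnorm x.
Proof. by move=> /rank_oneE[e e1 ->]; exact: unit_norm. Qed.

Theorem std_banach_qalgebra : banach_qalgebra (std_qalgebra q).
Proof.
split; first exact: cs_mulA.
  by exists (bampl (cs_mul A)); [exact: bamplP | exact: mul_contractive].
move=> p op s; rewrite /= => sC.
have [|l sl] := @rnorm_complete R A s.
  move=> e /sC[N HN]; exists N => m n Nm Nn.
  by rewrite -(underlying_rnorm _ op); apply: HN.
exists l => e /sl[N HN]; exists N => n Nn.
have := HN n Nn; rewrite -(underlying_rnorm _ op); exact.
Qed.

Section Ideal.
Variable I : closed_left_ideal A.

Lemma ideal_norm p (x : li_type I) : rank_one_projection p ->
  @underlying_norm R S (ideal_qspace I q) p x = rnorm (val x).
Proof. by move=> op; rewrite -(underlying_rnorm _ op) /underlying_norm /= amplE. Qed.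

Lemma ampl_ideal (u : fin_tensor S (li_type I)) :
  @qnorm R S (ideal_qspace I q) u = Q (ampl S (li_incl I) u).
Proof. by []. Qed.

Lemma ampl_act (u : FA) (v : fin_tensor S (li_type I)) :
  ampl S (li_incl I) (bampl (@li_act R A I) u v) = bampl (cs_mul A) u (ampl S (li_incl I) v).
Proof.
have [bb bE] := bamplP S (cs_mul A); have [ib iE] := bamplP S (@li_act R A I).
elim/tensor_ind: u => [|a x u IH]; first by rewrite (bil0l bb) (bil0l ib) linear0.
rewrite (bilDl bb) (bilDl ib) linearD /= IH; congr (_ + _).
elim/tensor_ind: v {IH} => [|b y v IH]; first by rewrite linear0 (bil0r bb) (bil0r ib) linear0.
rewrite (bilDr ib) !linearD /= (bilDr bb) IH; congr (_ + _).
by rewrite iE !amplE bE.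
Qed.

Theorem ideal_banach_qmodule : banach_left_qmodule (ideal_qmodule I q).
Proof.
split; first by move=> a b x; apply: val_inj; rewrite /= cs_mulA.
  exists (bampl (@li_act R A I)); first exact: bamplP.
  by move=> u v; rewrite !ampl_ideal ampl_act; exact: mul_contractive.
move=> p op s sC.
have [|l sl] := @rnorm_complete R A (val \o s).
  move=> e /sC[N HN]; exists N => m n Nm Nn.
  by have := HN _ _ Nm Nn; rewrite (ideal_norm _ op).
have Il : li_set I l.
  by apply: closed_seq (@li_closed _ _ I) _ sl => n; have := valP (s n); rewrite /li_pred /= inE.
have Pl : l \in li_pred I by rewrite inE.
pose l' : li_type I := exist _ l Pl.
exists l' => e /sl[N HN]; exists N => n /HN; rewrite /=.
have -> // : rnorm (val (s n) - l) = @underlying_norm R S (ideal_qspace I q) p (s n - l').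
by rewrite (ideal_norm (s n - l') op).
Qed.

End Ideal.
End StandardQuantization.

(** * A strictly positive element of a closed left ideal *)

Section LeftIdeal.
Variables (R : realType) (A : cstar_algebra R) (I : closed_left_ideal A).
Local Notation C := R[i].
Local Notation "x ** y" := (cs_mul A x y) (at level 40, left associativity).
Local Notation N := (@rnorm R A).
Implicit Types (x y a : A).

Let NP : cseminorm N := rnorm_cseminorm A.
Let NS : seminorm N := cn_semi NP.

Lemma li0 : li_set I 0.
Proof. by have := (li_submod I).1; rewrite inE. Qed.

Lemma liP c x y : li_set I x -> li_set I y -> li_set I (c *: x + y).
Proof.
by move=> Ix Iy; have := (li_submod I).2 c x y; rewrite !inE; apply.
Qed.

Lemma liD x y : li_set I x -> li_set I y -> li_set I (x + y).
Proof. by move=> Ix Iy; have := liP 1 Ix Iy; rewrite scale1r. Qed.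

Lemma liZ c x : li_set I x -> li_set I (c *: x).
Proof. by move=> Ix; have := liP c Ix li0; rewrite addr0. Qed.

Lemma liM a x : li_set I x -> li_set I (a ** x).
Proof. by move=> Ix; have := @li_mul _ _ I a x; rewrite !inE; apply. Qed.

Lemma li_sum (J : Type) (r : seq J) (F : J -> A) :
  (forall j, li_set I (F j)) -> li_set I (\sum_(j <- r) F j).
Proof.
move=> IF; elim: r => [|j r IH]; rewrite ?big_nil ?big_cons; first exact: li0.
exact: liD.
Qed.

Lemma li_utz (z : utz A) x : li_set I x -> li_set I (z * emb x).2.
Proof.
move=> Ix; rewrite /= scale0r addr0; apply: liD; first exact: liZ.
exact: liM.
Qed.

(** A subset of a separable metric space is separable: for every point of the dense
   set and every scale, an element of the ideal at that distance is picked when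
   there is one. *)
Lemma ideal_dense_seq : separable A -> exists x : nat -> A,
  (forall n, li_set I (x n)) /\
  forall y, li_set I y -> forall e : R, 0 < e -> exists n, N (y - x n) < e.
Proof.
move=> [D [/countable_injP[f fI] dD]].
pose good n m x := li_set I x /\ exists d, [/\ D d, f d = n & N (d - x) < invS R m].
have /choice[g gP] (nm : nat * nat) : exists x, li_set I x /\
    ((exists x, good nm.1 nm.2 x) -> good nm.1 nm.2 x).
  have [[x gx]|ng] := pselect (exists x, good nm.1 nm.2 x).
    by exists x; split=> //; case: gx.
  by exists 0; split; [exact: li0|].
pose x k := g (odflt (0, 0)%N (unpickle k)).
exists x; split; first by move=> n; case: (gP (odflt (0, 0)%N (unpickle n))).
move=> y Iy e e0; have e2 : 0 < e / 2 by lra.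
have [m Hm] := small_inv e2; have {Hm} hm := Hm m (leqnn m).
have mc : 0 < ((invS R m)%:C)%C :> C by rewrite ltcR invS_gt0.
have [d [yd Dd]] := dD _ (ex_intro _ y (ballxx y mc)) (ball_open _ _).
have {}yd : N (y - d) < invS R m by rewrite -rnorm_ball; exact: yd.
exists (pickle (f d, m)); rewrite /x pickleK /=.
have [_ /(_ _)[|_ [d' [Dd' fd' d'x]]]] := gP (f d, m).
  exists y; split=> //; exists d; split=> //=.
  by rewrite (semi_distC NS).
have dd : d' = d by apply: fI => //; rewrite inE.
rewrite dd /= in d'x; have := semi_tri NS y d (g (f d, m)); lra.
Qed.

Hypothesis sum_squares : forall zs ws : seq A,
  N (\sum_(z <- zs) cs_star z ** z) <=
  N (\sum_(z <- zs) cs_star z ** z + \sum_(w <- ws) cs_star w ** w).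

Lemma starl_le (y : utz A) a : opb N y 1 -> N (star y * emb a * y).2 <= N a.
Proof.
move=> y1; rewrite -{1}act_emb.
have := y1 (star y * emb a).2; rewrite mul1r => h; apply: le_trans h _.
rewrite -(cn_starE NP); have := y1 (cs_star a); rewrite mul1r (cn_starE NP).
suff -> : cs_star (star y * emb a).2 = (emb (cs_star a) * y).2 by [].
by apply: emb_inj; rewrite -star_emb act_emb starM starK star_emb emb_act.
Qed.

(** A weighted sum of [x^* x] over a dense sequence dominates each of them. *)
Lemma strictly_positive : separable A -> exists h, [/\ li_set I h, cs_star h = h, N h <= 1 &
  forall x, li_set I x -> forall e : R, 0 < e -> exists x' c,
    [/\ N (x - x') < e, 0 < c & forall y : utz A, opb N y 1 ->
        N (emb x' * y).2 ^+ 2 <= c * N (star y * emb h * y).2]].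
Proof.
move=> /ideal_dense_seq[x [Ix xd]].
(* The weights make the series of the squares converge to an element of norm at
   most 1. *)
pose w k : R := 2^-1 ^+ k.+1 / (1 + N (x k)).
have p1 k : 0 < 1 + N (x k) by have := semi_ge0 NS (x k); lra.
have w0 k : 0 < w k by rewrite divr_gt0 // exprn_gt0 // invr_gt0.
pose z k : A := ((w k)%:C)%C *: x k.
have half01 k : 0 <= (2^-1 : R) ^+ k <= 1.
  have h0 : 0 <= 2^-1 :> R by lra.
  have h1 : 2^-1 <= 1 :> R by lra.
  by apply/andP; split; [exact: exprn_ge0 | exact: exprn_ile1].
have nz k : N (z k) <= 2^-1 ^+ k.+1.
  rewrite (semiZ NS) rmod_real ger0_norm; last exact: ltW.
  rewrite -[w k]/(2^-1 ^+ k.+1 / (1 + N (x k))) mulrAC ler_pdivrMr //.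
  by rewrite ler_wpM2l //; [case/andP: (half01 k.+1) | have := semi_ge0 NS (x k); lra].
have nzz k : N (cs_star (z k) ** z k) <= 2^-1 ^+ k.+1.
  rewrite (cn_star NP) expr2 (le_trans _ (nz k)) // ler_piMr ?(semi_ge0 NS) //.
  by rewrite (le_trans (nz k)) //; case/andP: (half01 k.+1).
pose s n := \sum_(k < n) cs_star (z k) ** z k.
have step n k : N (s (n + k)%N - s n) <= 2^-1 ^+ n - 2^-1 ^+ (n + k).
  elim: k => [|k IH]; first by rewrite addn0 !subrr (semi0 NS).
  rewrite addnS; have -> : s (n + k).+1 = s (n + k)%N + cs_star (z (n + k)%N) ** z (n + k)%N.
    by rewrite /s big_ord_recr.
  rewrite addrAC (le_trans (semiD NS _ _)) //; have := nzz (n + k)%N.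
  have -> : 2^-1 ^+ (n + k).+1 = 2^-1 ^+ (n + k) / 2 :> R by rewrite exprSr.
  lra.
have [h sh] : exists h, cv N s h.
  apply: rnorm_complete; apply: (cauchy_mono NS) => e e0.
  have [M HM] := small_inv e0; exists M => n k /HM hn.
  have := step n k; have := pow_half_lt R n; have /andP[] := half01 (n + k)%N; lra.
have Is n : li_set I (s n).
  by rewrite /s; apply: li_sum => k; apply: liM; apply: liZ.
have ss n : cs_star (s n) = s n.
  apply: emb_inj; rewrite -star_emb emb_sum star_sum; apply: eq_bigr => k _.
  by rewrite star_emb cs_starM cs_starK.
exists h; split.
- exact: closed_seq (@li_closed _ _ I) Is sh.
- apply: (cv_unique NS (@rnorm_eq0 R A) _ sh) => e /sh[M HM]; exists M => n /HM.
  rewrite -(ss n); suff -> : cs_star (s n) - cs_star h = cs_star (s n - h).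
    by rewrite (cn_starE NP) ss.
  by apply: emb_inj; rewrite embB -!star_emb -starB -embB.
- apply: (cv_le NS (N := 0)) sh => n _; have := step 0%N n.
  rewrite add0n /s big_ord0 subr0 expr0; case/andP: (half01 n); lra.
move=> y Iy e e0; have [k yk] := xd y Iy e e0.
exists (x k), (w k ^- 2); split=> //; first by rewrite invr_gt0 exprn_gt0.
move=> v v1; rewrite mulrC ler_pdivlMr ?exprn_gt0 // -exprMn.
have -> : N (emb (x k) * v).2 * w k = N (emb (z k) * v).2.
  rewrite /z embZ -scalerAl /= -/(_ *: (emb (x k) * v).2).
  by rewrite -[RHS]/(N (((w k)%:C)%C *: (emb (x k) * v).2)) (semiZ NS) rmod_real ger0_norm ?(ltW (w0 k)) // mulrC.
pose F a := (star v * emb a * v).2.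
have FB a b : F a - F b = F (a - b) by rewrite /F embB mulrBr mulrBl.
have Fs : cv N (F \o s) (F h).
  by apply: (cv_lip (M := 1) NS) sh => a b; rewrite FB mul1r; apply: starl_le.
(* Only finitely many terms are needed to contain the one of index [k]; the others
   are dropped by positivity. *)
suff low n : (k < n)%N -> N (emb (z k) * v).2 ^+ 2 <= N (F (s n)).
  rewrite -/(F h); rewrite leNgt; apply/negP => lt.
  have gap : 0 < N (emb (z k) * v).2 ^+ 2 - N (F h) by lra.
  have [M HM] := Fs _ gap; have := HM _ (leq_maxl M k.+1); have := low _ (leq_maxr M k.+1).
  rewrite /=; have := semiD NS (F (s (maxn M k.+1)) - F h) (F h); rewrite subrK; lra.
move=> kn; rewrite -(cn_star NP).
pose t j := (emb (z j) * v).2.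
have FE : F (s n) = \sum_(j < n) cs_star (t j) ** t j.
  apply: emb_inj; rewrite {1}/F -act_emb emb_act act_emb /s !emb_sum mulr_sumr mulr_suml.
  apply: eq_bigr => j _; rewrite !embM -!star_emb emb_act starM.
  by rewrite !mulrA.
rewrite FE -(big_mkord xpredT (fun j => cs_star (t j) ** t j)).
rewrite (bigD1_seq k) ?iota_uniq ?mem_index_iota //=.
have := sum_squares [:: t k] [seq t j | j <- index_iota 0 n & j != k].
by rewrite big_seq1 big_map big_filter.
Qed.

End LeftIdeal.

(** * Averages of the powers of a contraction *)

Lemma scale_invn (R : realType) (V : lmodType R[i]) (x : V) m : (0 < m)%N ->
  (m%:R^-1 : R[i]) *: (x *+ m) = x.
Proof.
by move=> m0; rewrite -[x *+ m]scaler_nat scalerA mulVf ?scale1r // pnatr_eq0 -lt0n.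
Qed.

Section Averages.
Variables (R : realType) (A : cstar_algebra R) (h b0 : A).
Local Notation C := R[i].
Local Notation "x ** y" := (cs_mul A x y) (at level 40, left associativity).
Local Notation N := (@rnorm R A).
Local Notation opb := (opb N).
Implicit Types (x y a : A) (z w : utz A).

Hypothesis sh : cs_star h = h.
Hypothesis sb0 : cs_star b0 = b0.
Hypothesis b0E : b0 + b0 - b0 ** b0 = h ** h.
Hypothesis b0c : forall x, x ** (h ** h) = (h ** h) ** x -> x ** b0 = b0 ** x.
Hypothesis sum_squares : forall zs ws : seq A,
  N (\sum_(z <- zs) cs_star z ** z) <=
  N (\sum_(z <- zs) cs_star z ** z + \sum_(w <- ws) cs_star w ** w).

Let NP : cseminorm N := rnorm_cseminorm A.
Let NS : seminorm N := cn_semi NP.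
Local Notation H := (emb h).

(** The bicommutant of [h] is commutative, and contains everything built below. *)
Definition bic z := forall w, w * H = H * w -> w * z = z * w.

Lemma bicC z w : bic z -> bic w -> z * w = w * z.
Proof. by move=> bz bw; apply: bw; rewrite bz. Qed.

Lemma bicH : bic H. Proof. by []. Qed.

Lemma bic1 : bic 1. Proof. by move=> w _; rewrite mulr1 mul1r. Qed.

Lemma bicD z z' : bic z -> bic z' -> bic (z + z').
Proof. by move=> bz bz' w wH; rewrite mulrDr mulrDl bz // bz'. Qed.

Lemma bicN z : bic z -> bic (- z).
Proof. by move=> bz w wH; rewrite mulrN mulNr bz. Qed.

Lemma bicM z z' : bic z -> bic z' -> bic (z * z').
Proof. by move=> bz bz' w wH; rewrite mulrA bz // -mulrA bz' // mulrA. Qed.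

Lemma bicZ c z : bic z -> bic (c *: z).
Proof. by move=> bz w wH; rewrite -scalerAl -scalerAr bz. Qed.

Lemma bicX z n : bic z -> bic (z ^+ n).
Proof.
move=> bz; elim: n => [|n IH]; first by rewrite expr0; exact: bic1.
by rewrite exprS; apply: bicM.
Qed.

Lemma bic_sum n (F : nat -> utz A) : (forall i, bic (F i)) -> bic (\sum_(i < n) F i).
Proof.
move=> bF; elim: n => [|n IH]; last by rewrite big_ord_recr; apply: bicD.
by rewrite big_ord0 => w _; rewrite mulr0 mul0r.
Qed.

Lemma bic_commutant y b : bic (emb y) ->
  (forall x, x ** y = y ** x -> x ** b = b ** x) -> bic (emb b).
Proof.
move=> by_ yb w /by_ wy.
have wE : w = (w.1 : C) *: 1 + emb w.2.
  by case: w {wy} => c x; congr pair; rewrite /= ?addr0 ?scaler0 ?add0r //; exact: esym (mulr1 _).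
have red a : w * emb a = emb a * w <-> w.2 ** a = a ** w.2.
  rewrite {1 2}wE mulrDl mulrDr -scalerAl -scalerAr mul1r mulr1 -!embM.
  by split=> [/addrI /emb_inj|->].
by apply/red/yb/red.
Qed.

(** The cosine of the angle with sine [h], that is, [sqrt (1 - h^2)]. *)
Definition cos1 : utz A := 1 - emb b0.
Definition cos2 : utz A := cos1 * cos1.

Lemma cos2E : cos2 = 1 - H * H.
Proof.
have -> : H * H = emb b0 + emb b0 - emb b0 * emb b0.
  by rewrite -!embM -b0E embB embD.
rewrite /cos2 /cos1 mulrBl mul1r mulrBr mulr1 -[emb b0 + _ - _]addrA.
by rewrite [- (emb b0 + _) in RHS]opprD [RHS]addrA.
Qed.

Lemma HHE : H * H = 1 - cos2.
Proof. by rewrite cos2E subKr. Qed.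

Lemma bicT : bic cos1.
Proof.
apply: bicD; first exact: bic1.
apply: bicN; apply: (bic_commutant (y := h ** h)) b0c.
by rewrite embM; apply: bicM; exact: bicH.
Qed.

Lemma bicSq : bic cos2. Proof. by apply: bicM; exact: bicT. Qed.

Lemma starH : star H = H. Proof. by rewrite star_emb sh. Qed.
Lemma starT : star cos1 = cos1. Proof. by rewrite /cos1 starB star1 star_emb sb0. Qed.
Lemma starSq : star cos2 = cos2. Proof. by rewrite /cos2 starM starT. Qed.

Lemma opbT : opb cos1 1.
Proof.
apply: (sqrt_contraction NP sb0 sh _ b0E).1; apply: emb_inj; rewrite !embM.
have : H * cos1 = cos1 * H by apply: bicC; [exact: bicH | exact: bicT].
rewrite /cos1 mulrBl mulrBr mul1r mulr1 => /(congr1 (fun z => H - z)).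
by rewrite !subKr => ->.
Qed.

Lemma opbSq : opb cos2 1. Proof. by apply: opbM1; exact: opbT. Qed.

Lemma opbSqX n : opb (cos2 ^+ n) 1.
Proof.
elim: n => [|n IH]; first by rewrite expr0; exact: opb1.
by rewrite exprS; apply: opbM1 => //; exact: opbSq.
Qed.

(** As a function of [h], close to 1 where [m h^2] is small, and of order
   [1 / (m h^2)] where it is large. *)
Definition avg m : utz A := (m%:R^-1 : C) *: \sum_(i < m) cos2 ^+ i.

Lemma bic_avg m : bic (avg m).
Proof. by apply: bicZ; apply: (bic_sum _ (fun i => bicX i bicSq)). Qed.

Lemma conj_invn m : (m%:R^-1 : C)^* = m%:R^-1.
Proof. by apply: conj_Creal; rewrite realV realn. Qed.

Lemma star_avg m : star (avg m) = avg m.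
Proof.
rewrite /avg starZ conj_invn star_sum; congr (_ *: _); apply: eq_bigr => i _.
by elim: (nat_of_ord i) => [|n IH]; rewrite ?expr0 ?star1 // {1}exprS starM IH starSq exprSr.
Qed.

Lemma rmod_invn m : rmod (m%:R^-1 : C) = m%:R^-1.
Proof. by rewrite rmodV rmod_nat. Qed.

Lemma opb_avg m : (0 < m)%N -> opb (avg m) 1.
Proof.
move=> m0; have -> : 1 = rmod (m%:R^-1 : C) * \sum_(i < m) (1 : R).
  by rewrite rmod_invn sumr_const card_ord mulVf // pnatr_eq0 -lt0n.
by apply: opbZ => //; apply: opb_sum => // i; exact: opbSqX.
Qed.

Lemma geometric_sum n : H * H * \sum_(i < n) cos2 ^+ i = 1 - cos2 ^+ n.
Proof. by rewrite HHE -opprB mulNr -subrX1 opprB. Qed.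

Lemma HH_avg m : H * H * avg m = (m%:R^-1 : C) *: (1 - cos2 ^+ m).
Proof. by rewrite /avg -scalerAr geometric_sum. Qed.

Lemma opb_HH_avg m : opb (H * H * avg m) (2 / m%:R).
Proof.
rewrite HH_avg mulrC -rmod_invn -[2]/(1 + 1); apply: opbZ => //.
by apply: opbD => //; [exact: opb1 | apply: opbN => //; exact: opbSqX].
Qed.

(** The square is the norm of [h^2 avg m^2], where [h^2 avg m = (1 - cos2^m) / m]
   by a geometric sum. *)
Lemma H_avg_norm m : (0 < m)%N -> N (H * avg m).2 ^+ 2 <= 2 / m%:R.
Proof.
move=> m0; rewrite -(cn_star NP).
have -> : cs_star (H * avg m).2 ** (H * avg m).2 = (H * H * avg m * avg m).2.
  apply: emb_inj; rewrite embM -star_emb !emb_act starM starH star_avg.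
  have c := bicC (bic_avg m) bicH.
  by rewrite -!mulrA emb_act (mulrA (avg m)) c -mulrA (mulrA (avg m)) c -mulrA.
apply: (opb_norm NP); first by rewrite -!mulrA mul_emb1.
  by rewrite divr_ge0.
by rewrite -[2 / _]mulr1; apply: opbM => //; [exact: opb_HH_avg | exact: opb_avg].
Qed.

Definition approx_unit m : utz A := 1 - avg m.
(** The quotient of [approx_unit m] by [h^2]. Its bound [m] measures how fast
   [approx_unit m] vanishes as [h] tends to 0. *)
Definition cofactor m : utz A := (m%:R^-1 : C) *: \sum_(i < m) \sum_(j < i) cos2 ^+ j.

Lemma approx_unit_factor m : (0 < m)%N -> approx_unit m = cofactor m * (H * H).
Proof.
move=> m0; rewrite /approx_unit /avg /cofactor -scalerAl mulr_suml.
have {1}-> : 1 = (m%:R^-1 : C) *: \sum_(i < m) (1 : utz A).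
  by rewrite sumr_const card_ord scale_invn.
rewrite -scalerBr -sumrB; congr (_ *: _); apply: eq_bigr => i _.
rewrite -geometric_sum; apply: bicC; first by apply: bicM; exact: bicH.
exact: (bic_sum _ (fun j => bicX j bicSq)).
Qed.

Lemma opb_cofactor m : opb (cofactor m) m%:R.
Proof.
have [->|m0] := posnP m; first by move=> x; rewrite /cofactor invr0 scale0r mulr0 mul0r (semi0 NS).
apply: (@opb_le _ _ _ NP _ (rmod (m%:R^-1 : C) * \sum_(i < m) \sum_(j < i) (1 : R))).
  rewrite rmod_invn ler_pdivrMl ?ltr0n //.
  rewrite (le_trans (y := \sum_(i < m) m%:R)) //.
    by apply: ler_sum => i _; rewrite sumr_const card_ord ler_nat ltnW.
  rewrite sumr_const card_ord; by rewrite mulr_natl.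
apply: opbZ => //; apply: opb_sum => // i; apply: opb_sum => // j; exact: opbSqX.
Qed.

Lemma bic_approx_unit m : bic (approx_unit m).
Proof. by apply: bicD; [exact: bic1 | apply: bicN; exact: bic_avg]. Qed.

Lemma star_approx_unit m : star (approx_unit m) = approx_unit m.
Proof. by rewrite /approx_unit starB star1 star_avg. Qed.

(** For [n] much larger than [m], the averages of order [n] are small wherever
   [approx_unit m] is not. *)
Lemma approx_unit_avg m n : (0 < m)%N -> (0 < n)%N ->
  opb (approx_unit m * avg n) (2 * m%:R / n%:R).
Proof.
move=> m0 n0; rewrite approx_unit_factor // -mulrA.
have -> : 2 * m%:R / n%:R = m%:R * (2 / n%:R) :> R by ring.
apply: opbM => //; first by rewrite divr_ge0.
  exact: opb_cofactor.
exact: opb_HH_avg.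
Qed.

Lemma approx_unit_1 m : (0 < m)%N -> (approx_unit m).1 = 0.
Proof. by move=> m0; rewrite approx_unit_factor // mulrA emb_mul1. Qed.

Definition approx_elt m : A := (approx_unit m).2.

Lemma approx_eltE m : (0 < m)%N -> emb (approx_elt m) = approx_unit m.
Proof. by move=> m0; rewrite /approx_elt -embE // approx_unit_1. Qed.

Lemma approx_elt_ideal (I : closed_left_ideal A) m : (0 < m)%N -> li_set I h -> li_set I (approx_elt m).
Proof.
by move=> m0 Ih; rewrite /approx_elt approx_unit_factor // mulrA; apply: li_utz.
Qed.

Lemma approx_elt_star m : (0 < m)%N -> cs_star (approx_elt m) = approx_elt m.
Proof. by move=> m0; apply: emb_inj; rewrite -star_emb approx_eltE // star_approx_unit. Qed.

(** A substitute for the order of the unitization: adding such an element makes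
   another one larger. *)
Definition sos z := exists s : seq (utz A), z = \sum_(w <- s) star w * w.

Lemma sosD z z' : sos z -> sos z' -> sos (z + z').
Proof. by move=> [s ->] [t ->]; exists (s ++ t); rewrite big_cat. Qed.

Lemma sos1 w : sos (star w * w).
Proof. by exists [:: w]; rewrite big_seq1. Qed.

Lemma sos_sum n (F : nat -> utz A) : (forall i, sos (F i)) -> sos (\sum_(i < n) F i).
Proof.
move=> sF; elim: n => [|n IH]; last by rewrite big_ord_recr; apply: sosD.
by exists [::]; rewrite big_ord0 big_nil.
Qed.

(** Conjugation by [x] brings sums of squares of the unitization back to [A], where
   [sum_squares] compares them. *)
Lemma sos_le z w x : sos z -> sos w ->
  N (emb (cs_star x) * z * emb x).2 <= N (emb (cs_star x) * (z + w) * emb x).2.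
Proof.
have E (r : seq (utz A)) : (emb (cs_star x) * (\sum_(v <- r) star v * v) * emb x).2 =
    \sum_(y <- [seq (v * emb x).2 | v <- r]) cs_star y ** y.
  rewrite mulr_sumr mulr_suml big_map; apply: emb_inj; rewrite emb_sum.
  rewrite -embE; last first.
    rewrite -mulr_suml -mulr_sumr -mulrA; exact: mul_emb1.
  apply: eq_bigr => v _; rewrite embM -!star_emb act_emb starM.
  by rewrite !mulrA.
move=> [s ->] [t ->]; rewrite mulrDr mulrDl /= -/(_ + _).
have := sum_squares [seq (v * emb x).2 | v <- s] [seq (v * emb x).2 | v <- t].
by rewrite -!E.
Qed.

(** Both [m u] and [m (1 - u)] are sums of squares, for [u = approx_unit m], so
   [x^* u x] has norm at most that of [x^* x]. For [x = u] this bounds the norm of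
   [u^3] by the square of that of [u], which excludes a norm above 1. *)
Lemma approx_unit_norm m : (0 < m)%N -> N (approx_elt m) <= 1.
Proof.
move=> m0; set a := approx_elt m.
have TX n : star (cos1 ^+ n) = cos1 ^+ n.
  by elim: n => [|n IH]; rewrite ?expr0 ?star1 // {1}exprS starM IH starT exprSr.
(* The powers of [cos2] are squares because [cos2] is the square of [cos1]. *)
have SX n : cos2 ^+ n = star (cos1 ^+ n) * cos1 ^+ n.
  by rewrite TX /cos2 -expr2 -exprM mulnC exprM expr2.
have m1 : (m%:R : C) != 0 by rewrite pnatr_eq0 -lt0n.
have s1 : sos (m%:R *: approx_unit m).
  rewrite approx_unit_factor // /cofactor -scalerAl scalerA mulfV // scale1r mulr_suml.
  apply: (sos_sum _ (F := fun i => (\sum_(j < i) cos2 ^+ j) * (H * H))) => i.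
  rewrite mulr_suml; apply: (sos_sum _ (F := fun j => cos2 ^+ j * (H * H))) => j.
  suff -> : cos2 ^+ j * (H * H) = star (cos1 ^+ j * H) * (cos1 ^+ j * H) by exact: sos1.
  rewrite starM TX starH SX TX !mulrA; congr (_ * _).
  have TH : cos1 ^+ j * H = H * cos1 ^+ j by apply: bicC; [apply: bicX; exact: bicT | exact: bicH].
  by rewrite -mulrA TH mulrA TH.
have s2 : sos (m%:R *: avg m).
  rewrite /avg scalerA mulfV // scale1r.
  by apply: (sos_sum _ (F := fun i => cos2 ^+ i)) => i; rewrite SX; exact: sos1.
have cube x : N (emb (cs_star x) * approx_unit m * emb x).2 <= N x ^+ 2.
  have := sos_le x s1 s2; rewrite -scalerDr /approx_unit subrK -/(approx_unit m).
  have sc (z : utz A) : (emb (cs_star x) * (m%:R *: z) * emb x).2 =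
      (m%:R : C) *: (emb (cs_star x) * z * emb x).2.
    by rewrite -scalerAr -scalerAl.
  rewrite !sc !(semiZ NS) rmod_nat ler_pM2l ?ltr0n // mulr1 -embM /= => h2.
  by rewrite (le_trans h2) // (cn_star NP).
have sa : cs_star a = a by exact: approx_elt_star.
have c1 : N (a ** a ** a) <= N a ^+ 2.
  by have := cube a; rewrite sa -approx_eltE // -!embM.
have c2 : N a ^+ 4 <= N (a ** a ** a) * N a.
  have -> : N a ^+ 4 = N (a ** a ** a ** a).
    have saa : cs_star (a ** a) = a ** a by rewrite cs_starM sa.
    have := cn_star NP (a ** a); rewrite saa cs_mulA => ->.
    by have := cn_star NP a; rewrite sa => ->; rewrite -exprM.
  exact: (cn_mul NP).
rewrite leNgt; apply/negP => a1; have := semi_ge0 NS a => a0.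
have c3 : N a ^+ 4 <= N a ^+ 2 * N a by rewrite (le_trans c2) // ler_wpM2r.
have e4 : N a ^+ 4 = N a ^+ 2 * N a * N a by ring.
have p3 : 0 < N a ^+ 2 * N a by rewrite -exprSr exprn_gt0 //; lra.
by move: c3; rewrite e4 ger_pMr // leNgt a1.
Qed.

(** For [x'] dominated by [h], the norm of [x' avg m] has a square bounded by a
   multiple of the norm of [h avg m], which tends to 0. Such [x'] approximate [x]. *)
Lemma avg_to0 x (e : R) : 0 < e ->
  (exists x' c, [/\ N (x - x') < e / 2, 0 < c & forall y : utz A, opb y 1 ->
        N (emb x' * y).2 ^+ 2 <= c * N (star y * H * y).2]) ->
  exists M, forall m, (M < m)%N -> N (emb x * avg m).2 < e.
Proof.
move=> e0 [x' [c [xx' c0 x'c]]].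
pose r := (e / 2) ^+ 2 / c.
have r0 : 0 < r by rewrite divr_gt0 // exprn_gt0 // divr_gt0.
have r2 : 0 < r ^+ 2 / 2 by rewrite divr_gt0 // exprn_gt0.
have [M HM] := small_inv r2; exists M => -[//|m] Mm.
have := HM m Mm; rewrite /invS => hm.
have nH : N (H * avg m.+1).2 < r.
  rewrite -ltr_sqr ?nnegrE ?(semi_ge0 NS) ?(ltW r0) //.
  by rewrite (le_lt_trans (H_avg_norm (ltn0Sn m))) // mulrC -ltr_pdivlMr.
have a1 := opb_avg (ltn0Sn m).
have h1 : N (emb x' * avg m.+1).2 < e / 2.
  have e2 : 0 <= e / 2 by rewrite divr_ge0 // ltW.
  rewrite -ltr_sqr ?nnegrE ?(semi_ge0 NS) //.
  rewrite (le_lt_trans (x'c _ a1)) // star_avg.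
  suff h2 : N (avg m.+1 * H * avg m.+1).2 <= N (H * avg m.+1).2.
    by rewrite -ltr_pdivlMl // mulrC (le_lt_trans h2).
  rewrite (bicC (bic_avg _) bicH); have := a1 (H * avg m.+1).2.
  by rewrite mul1r emb_act.
have h3 := a1 (x - x'); rewrite mul1r in h3.
have -> : (emb x * avg m.+1).2 = (emb (x - x') * avg m.+1).2 + (emb x' * avg m.+1).2.
  by rewrite -[in LHS](subrK x' x) [emb (x - x' + x')]embD mulrDl.
have := semiD NS (emb (x - x') * avg m.+1).2 (emb x' * avg m.+1).2; lra.
Qed.

End Averages.

(** * Bounded partitions of unity in a closed left ideal *)

(** The growth makes [4 * scale_seq j / scale_seq k] at most [16 ^- k.+1] for
   [j < k]. *)
Fixpoint scale_seq (k : nat) : nat :=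
  if k is i.+1 then (4 * 16 ^ i.+2 * scale_seq i)%N else 1%N.

Lemma scale_seq_gt k : (k < scale_seq k)%N.
Proof.
elim: k => //= k IH; rewrite (leq_ltn_trans IH) // ltn_Pmull //.
  by rewrite (@leq_trans 4) // leq_pmulr // expn_gt0.
exact: leq_ltn_trans IH.
Qed.

Lemma scale_seq_gt0 k : (0 < scale_seq k)%N.
Proof. exact: leq_ltn_trans (scale_seq_gt k). Qed.

Lemma scale_seq_mono j k : (j <= k)%N -> (scale_seq j <= scale_seq k)%N.
Proof.
move=> /subnKC <-; elim: (k - j)%N => [|i IH]; first by rewrite addn0.
by rewrite addnS /= (leq_trans IH) // leq_pmull // muln_gt0 expn_gt0.
Qed.

Lemma one_sub_sqr (V : nzRingType) (u : V) : (1 - u) * (1 + u) = 1 - u * u.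
Proof. by rewrite mulrBl mul1r mulrDr mulr1 opprD addrA addrK. Qed.

Lemma square_step (V : zmodType) (a b c f t : V) :
  a + b + (c + f) - (t + f) = a - t + (b + c).
Proof. by rewrite addrA [t + f]addrC opprD addrA addrK -(addrA a) addrAC. Qed.

Lemma sum_parity (V : zmodType) (F : nat -> V) K :
  \sum_(k < K.*2) F k =
  \sum_(k < K) F (false + k.*2)%N + \sum_(k < K) F (true + k.*2)%N.
Proof.
elim: K => [|K IH]; first by rewrite !big_ord0 addr0.
by rewrite doubleS !big_ord_recr /= IH -[LHS]addrA [RHS]addrACA.
Qed.

Section Partition.
Variables (R : realType) (A : cstar_algebra R) (h b0 : A) (B : nat -> A).
Local Notation C := R[i].
Local Notation "x ** y" := (cs_mul A x y) (at level 40, left associativity).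
Local Notation N := (@rnorm R A).
Local Notation opb := (opb N).
Implicit Types (x y a : A) (z w : utz A).

Hypothesis sh : cs_star h = h.
Hypothesis sb0 : cs_star b0 = b0.
Hypothesis b0E : b0 + b0 - b0 ** b0 = h ** h.
Hypothesis b0c : forall x, x ** (h ** h) = (h ** h) ** x -> x ** b0 = b0 ** x.
Hypothesis sum_squares : forall zs ws : seq A,
  N (\sum_(z <- zs) cs_star z ** z) <=
  N (\sum_(z <- zs) cs_star z ** z + \sum_(w <- ws) cs_star w ** w).

Let NP : cseminorm N := rnorm_cseminorm A.
Let NS : seminorm N := cn_semi NP.
Let v k : A := approx_elt b0 (scale_seq k).

Hypothesis BP : forall k,
  [/\ N (B k) <= 1, B k + B k - B k ** B k = v k ** v k,
      forall x, x ** (v k ** v k) = (v k ** v k) ** x -> x ** B k = B k ** x &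
      cs_star (B k) = B k].

Local Notation bic := (bic h).
Local Notation m k := (scale_seq k).
Let m0 k : (0 < m k)%N := scale_seq_gt0 k.
Let U k : utz A := approx_unit b0 (m k).
Let D k : utz A := 1 - emb (B k).

Let UE k : emb (v k) = U k.
Proof. exact: (approx_eltE b0E). Qed.

Let sv k : cs_star (v k) = v k.
Proof. exact: (approx_elt_star sb0 b0E). Qed.

Let bicU k : bic (U k).
Proof. exact: (bic_approx_unit b0c). Qed.

Let bicD_ k : bic (D k).
Proof.
have [_ _ Bc _] := BP k; apply: bicD; first exact: bic1.
apply: bicN; apply: bic_commutant Bc; rewrite embM UE; exact: bicM.
Qed.

Let DD k : D k * D k = 1 - U k * U k.
Proof.
have [_ BE _ _] := BP k.
have -> : U k * U k = emb (B k) + emb (B k) - emb (B k) * emb (B k).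
  by rewrite -UE -!embM -BE embB embD.
rewrite /D mulrBl mul1r mulrBr mulr1 -[emb (B k) + _ - _]addrA.
by rewrite [- (emb (B k) + _) in RHS]opprD [RHS]addrA.
Qed.

Let starU k : star (U k) = U k.
Proof. exact: star_approx_unit. Qed.

Let starD_ k : star (D k) = D k.
Proof. by have [_ _ _ sB] := BP k; rewrite /D starB star1 star_emb sB. Qed.

Let opbU k : opb (U k) 1.
Proof.
rewrite -UE; apply: (opb_le NP (approx_unit_norm sh sb0 b0E b0c sum_squares (m0 k))).
exact: opb_emb.
Qed.

Let opbD_ k : opb (D k) 1.
Proof.
have [B1 BE Bc sB] := BP k.
apply: (sqrt_contraction NP sB (sv k) _ BE).1.
by rewrite (Bc (v k)) // cs_mulA.
Qed.

Fixpoint tails (k : nat) : utz A := if k is i.+1 then D i * tails i else 1.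

Let bicP k : bic (tails k).
Proof. by elim: k => [|k IH] /=; [exact: bic1 | exact: bicM]. Qed.

Let starP k : star (tails k) = tails k.
Proof.
elim: k => [|k IH] /=; first exact: star1.
by rewrite starM IH starD_ (bicC (bicP k) (bicD_ k)).
Qed.

Let opbP k : opb (tails k) 1.
Proof. by elim: k => [|k IH] /=; [exact: opb1 | exact: opbM1]. Qed.

(** The sine [U k] takes its share of what the cosines [D j], [j < k], have left.
   As [D k ^2 = 1 - U k ^2], the squares of the bumps telescope. *)
Definition bump k : A := (tails k * U k).2.
Local Notation d := bump.

Let dE k : emb (d k) = tails k * U k.
Proof. by rewrite /bump -UE act_emb. Qed.

Let dC k : emb (d k) = U k * tails k.
Proof. by rewrite dE (bicC (bicP k) (bicU k)). Qed.

Lemma bump_ideal (I : closed_left_ideal A) k : li_set I h -> li_set I (d k).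
Proof.
move=> Ih; rewrite /bump -UE; apply: li_utz.
exact: (approx_elt_ideal b0E b0c (m0 k) Ih).
Qed.

Lemma bump_star k : cs_star (d k) = d k.
Proof. by apply: emb_inj; rewrite -star_emb dE starM starP starU; exact: bicC. Qed.

Lemma bump_le1 k : N (d k) <= 1.
Proof.
apply: (opb_norm NP (z := emb (d k))) => //; rewrite dE; apply: opbM1 => //.
Qed.

Lemma sum_bumps K : emb (\sum_(k < K) d k ** d k) = 1 - tails K * tails K.
Proof.
elim: K => [|K IH]; first by rewrite big_ord0 emb0 mulr1 subrr.
have dd : emb (d K ** d K) = tails K * tails K - tails K.+1 * tails K.+1.
  have c : D K * tails K = tails K * D K by apply: bicC.
  have UU : U K * U K = 1 - D K * D K by rewrite DD subKr.
  rewrite embM {1}dE dC mulrA -(mulrA (tails K)) UU mulrBr mulrBl mulr1 /=.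
  by rewrite {1}c !mulrA.
by rewrite big_ord_recr embD IH dd addrA subrK.
Qed.

(** The remainder [tails K.+1 ^2] contains the factor
   [D K ^2 = (1 - U K) (1 + U K)], and [1 - U K] is an average. *)
Lemma sum_bumps_cv x : (forall e : R, 0 < e -> exists M, forall n, (M < n)%N ->
    N (emb x * avg b0 n).2 < e) ->
  cv N (fun K => \sum_(k < K) x ** (d k ** d k)) x.
Proof.
move=> xavg e e0; have e2 : 0 < e / 2 by lra.
have [M HM] := xavg _ e2; exists M.+1 => -[//|K] MK.
have -> : \sum_(k < K.+1) x ** (d k ** d k) - x =
    - (emb x * (avg b0 (m K) * ((1 + U K) * (tails K * tails K)))).2.
  have -> : \sum_(k < K.+1) x ** (d k ** d k) = x ** \sum_(k < K.+1) d k ** d k.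
    by rewrite linear_sumr.
  have tt : tails K.+1 * tails K.+1 = avg b0 (m K) * ((1 + U K) * (tails K * tails K)).
    have c : D K * tails K = tails K * D K by apply: bicC.
    have -> : avg b0 (m K) = 1 - U K by rewrite /U /approx_unit subKr.
    rewrite /= -mulrA (mulrA (tails K) (D K)) -c -mulrA mulrA DD [RHS]mulrA; congr (_ * _).
    by rewrite one_sub_sqr.
  rewrite -tt; apply: emb_inj; rewrite embB embM sum_bumps mulrBr mulr1 addrAC subrr add0r.
  by rewrite embN emb_act.
have o : opb ((1 + U K) * (tails K * tails K)) 2.
  rewrite -[2]mulr1; apply: opbM => //; last exact: opbM1.
  by rewrite -[2]/(1 + 1); apply: opbD => //; exact: opb1.
rewrite (semiN NS) mulrA -emb_act; have := o (emb x * avg b0 (m K)).2.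
have MK' : (M <= K)%N by [].
have := HM (m K) (leq_ltn_trans MK' (scale_seq_gt K)); lra.
Qed.

(** The bump [d j] contains [U j], a bounded multiple of [m j * h^2], and [d k.+1]
   contains [D k], with [D k ^2 = avg (m k) * (1 + U k)]. As [h^2 * avg (m k)] is
   of order [1 / m k], the product [U j * D k] is small once [j < k]. *)
Lemma bump_orthogonal j k : (j.+2 <= k)%N -> N (d j ** d k) <= 4^-1 ^+ k.
Proof.
case: k => // k; rewrite ltnS => jk.
pose z := (U j * D k : utz A).
have z1 : z.1 = 0 by rewrite /z -UE mul_emb1.
have zz : N z.2 ^+ 2 <= 4 * (m j)%:R / (m k)%:R.
  rewrite -(cn_star_r NP).
  have -> : z.2 ** cs_star z.2 = ((U j * avg b0 (m k)) * ((1 + U k) * U j)).2.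
    apply: emb_inj; rewrite embM -star_emb -!embE //; last first.
      by rewrite -UE -!mulrA mul_emb1.
    rewrite /z starM starU starD_ -!mulrA; congr (_ * _).
    rewrite mulrA DD mulrA; congr (_ * _).
    have -> : avg b0 (m k) = 1 - U k by rewrite /U /approx_unit subKr.
    by rewrite one_sub_sqr.
  apply: (opb_norm NP); first by rewrite -UE -!mulrA mul_emb1.
    by rewrite divr_ge0 // mulr_ge0.
  have -> : 4 * (m j)%:R / (m k)%:R = (2 * (m j)%:R / (m k)%:R) * 2 :> R by ring.
  apply: opbM => //.
    by apply: (approx_unit_avg (h := h)) => //; exact: m0.
  rewrite -[2]mulr1; apply: opbM => //.
  by rewrite -[2]/(1 + 1); apply: opbD => //; exact: opb1.
have zk : N z.2 <= 4^-1 ^+ k.+1.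
  have p0 : 0 <= (4^-1 : R) ^+ k.+1 by rewrite exprn_ge0 // invr_ge0.
  rewrite -ler_sqr ?nnegrE ?(semi_ge0 NS) // (le_trans zz) //.
  rewrite ler_pdivrMr ?ltr0n //.
  have -> : ((4^-1 : R) ^+ k.+1) ^+ 2 = (16 ^+ k.+1)^-1.
    by rewrite -exprM mulnC exprM -[RHS]exprVn; congr (_ ^+ _); field.
  rewrite ler_pdivlMl ?exprn_gt0 // -natrX -!natrM ler_nat.
  case: k jk {z z1 zz p0} => // k jk; rewrite /= ltnS in jk *.
  by rewrite mulnA [(_ * 4)%N]mulnC leq_mul2l scale_seq_mono ?orbT.
have -> : d j ** d k.+1 = (emb z.2 * (tails j * (tails k * U k.+1))).2.
  apply: emb_inj; rewrite embM emb_act -embE // (dC j) (dE k.+1) /= /z -!mulrA.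
  by rewrite (mulrA (tails j)) (bicC (bicP j) (bicD_ k)) -mulrA.
apply: le_trans zk; have o : opb (tails j * (tails k * U k.+1)) 1.
  by apply: opbM1 => //; apply: opbM1.
by have := o z.2; rewrite mul1r.
Qed.

Lemma sum_bumps_le K : N (\sum_(k < K) d k ** d k) <= 2.
Proof.
apply: (opb_norm NP (z := emb (\sum_(k < K) d k ** d k))) => //; rewrite sum_bumps.
rewrite -[2]/(1 + 1); apply: opbD => //; first exact: opb1.
by apply: opbN => //; apply: opbM1.
Qed.

Variable r : bool.
Local Notation e k := (d (r + k.*2)).

(** The squares of the bumps of the other parity are dropped by positivity. *)
Lemma sum_bumps_parity K : N (\sum_(k < K) e k ** e k) <= 2.
Proof.
apply: le_trans (sum_bumps_le K.*2).
have -> : \sum_(k < K.*2) d k ** d k =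
    \sum_(k < K) e k ** e k + \sum_(k < K) d (~~ r + k.*2) ** d (~~ r + k.*2).
  by rewrite (sum_parity (fun k => d k ** d k)); case: (r); rewrite //= addrC.
have := sum_squares [seq e k | k <- index_iota 0 K]
  [seq d (~~ r + k.*2) | k <- index_iota 0 K].
rewrite !big_map !big_mkord.
by under eq_bigr do rewrite bump_star; under [X in _ + X]eq_bigr do rewrite bump_star.
Qed.

Definition sgn (b : bool) : C := (-1) ^+ b.

Lemma sgn_real b : (sgn b)^* = sgn b.
Proof. by case: b; rewrite /sgn ?expr1 ?expr0 ?conjCN1 ?conjC1. Qed.

Lemma sgn2 b : sgn b * sgn b = 1.
Proof. by rewrite /sgn -signr_addb addbb. Qed.

Lemma rmod_sgn b : rmod (sgn b) = 1.
Proof. by case: b; rewrite /sgn ?expr1 ?expr0 ?rmodN1 ?rmod1. Qed.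

Variable s : nat -> bool.
Let Ds K : A := \sum_(k < K) sgn (s k) *: e k.

Let starDs K : cs_star (Ds K) = Ds K.
Proof.
apply: emb_inj; rewrite -star_emb /Ds emb_sum star_sum; apply: eq_bigr => k _.
by rewrite star_emb cs_starZ sgn_real bump_star.
Qed.

Lemma double_le_pow K : (2 * K <= 8 ^ K)%N.
Proof.
elim: K => // K IH; have p : (0 < 8 ^ K)%N by rewrite expn_gt0.
rewrite expnS mulnS (@leq_trans (2 * 8 ^ K + 8 ^ K)) //.
  by apply: leq_add => //; rewrite leq_pmulr.
by rewrite -mulSnr leq_mul2r orbT.
Qed.

Let cross K : N (Ds K ** e K) <= 2^-1 ^+ K / 2.
Proof.
have -> : Ds K ** e K = \sum_(k < K) sgn (s k) *: (e k ** e K).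
  by rewrite /Ds linear_sumlz; apply: eq_bigr => k _; rewrite csZl.
rewrite (le_trans (semi_sum NS _ _ _)) //.
rewrite (@le_trans _ _ (\sum_(k < K) (16^-1 : R) ^+ K)) //.
  apply: ler_sum => k _; rewrite (semiZ NS) rmod_sgn mul1r.
  have kK := ltn_ord k.
  rewrite (le_trans (bump_orthogonal _)) //.
    by rewrite -addnS -addnS leq_add2l -doubleS leq_double.
  have -> : 16^-1 ^+ K = 4^-1 ^+ K.*2 :> R.
    by rewrite -mul2n exprM; congr (_ ^+ _); field.
  by rewrite addnC exprD ler_piMr ?exprn_ge0 ?invr_ge0 // exprn_ile1 ?invr_ge0 // invf_le1 // ler1n.
rewrite sumr_const card_ord -[_ *+ K]mulr_natl.
(* Each of the [K] products is at most [16 ^- K], and [2 K <= 8 ^ K]. *)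
have -> : 16^-1 ^+ K = 2^-1 ^+ K * (8 ^+ K)^-1 :> R.
  by rewrite -exprVn -exprMn; congr (_ ^+ _); field.
rewrite mulrCA ler_wpM2l ?exprn_ge0 ?invr_ge0 // ler_pdivrMr ?exprn_gt0 //.
rewrite mulrC ler_pdivlMr // mulrC -natrX -natrM ler_nat; exact: double_le_pow.
Qed.

Lemma square_add a x (c : C) : c * c = 1 ->
  (a + c *: x) ** (a + c *: x) = a ** a + c *: (a ** x) + (c *: (x ** a) + x ** x).
Proof. by move=> cc; rewrite csDl !csDr !csZl !csZr scalerA cc scale1r. Qed.

(** The square of a signed sum differs from the sum of the squares by cross terms.
   For indices of one parity, these involve far apart bumps only, so they are summable. *)
Lemma signed_sum_le K : N (\sum_(k < K) sgn (s k) *: e k) <= 2.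
Proof.
rewrite -/(Ds K); pose G K := Ds K ** Ds K - \sum_(k < K) e k ** e k.
have NG : N (G K) <= 2 * (1 - 2^-1 ^+ K).
  elim: K => [|K IH].
    by rewrite /G /Ds !big_ord0 cs0l subrr (semi0 NS) expr0 subrr mulr0.
  have -> : G K.+1 = G K + sgn (s K) *: (Ds K ** e K + e K ** Ds K).
    have DK : Ds K.+1 = Ds K + sgn (s K) *: e K by rewrite /Ds big_ord_recr.
    rewrite /G DK (square_add _ _ (sgn2 _)) big_ord_recr /=.
    by rewrite [sgn _ *: (_ + _)]scalerDr square_step.
  have h1 : N (sgn (s K) *: (Ds K ** e K + e K ** Ds K)) <= 2^-1 ^+ K.
    rewrite (semiZ NS) rmod_sgn mul1r (le_trans (semiD NS _ _)) //.
    have -> : N (e K ** Ds K) = N (Ds K ** e K).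
      by rewrite -(cn_starE NP) cs_starM starDs bump_star.
    have := cross K; lra.
  rewrite (le_trans (semiD NS _ _)) // exprS; lra.
have half0 : 0 <= (2^-1 : R) ^+ K by rewrite exprn_ge0 // invr_ge0.
rewrite -ler_sqr ?nnegrE ?(semi_ge0 NS) // -(cn_star NP) starDs.
have -> : Ds K ** Ds K = G K + \sum_(k < K) e k ** e k by rewrite /G subrK.
rewrite (le_trans (semiD NS _ _)) //; have := sum_bumps_parity K; lra.
Qed.

End Partition.

(** The elements are the bumps built on a strictly positive [h]. Splitting by parity
   keeps the indices of two distinct terms of a signed sum at distance at least 2,
   where the products are small. *)
Theorem bounded_partition (R : realType) (A : cstar_algebra R) (I : closed_left_ideal A) :
  separable A ->
  (forall zs ws : seq A, rnorm (\sum_(z <- zs) cs_mul A (cs_star z) z) <=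
     rnorm (\sum_(z <- zs) cs_mul A (cs_star z) z +
            \sum_(w <- ws) cs_mul A (cs_star w) w)) ->
  exists d : nat -> A,
  [/\ forall k, li_set I (d k) /\ rnorm (d k) <= 1,
      forall x, li_set I x ->
        cv (@rnorm R A) (fun K => \sum_(k < K) cs_mul A x (cs_mul A (d k) (d k))) x,
      forall j k, (j.+2 <= k)%N -> rnorm (cs_mul A (d j) (d k)) <= 4^-1 ^+ k &
      forall (r : bool) (s : nat -> bool) K,
        rnorm (\sum_(k < K) sgn R (s k) *: d (r + k.*2)%N) <= 2].
Proof.
move=> sep sq; have NP := rnorm_cseminorm A.
have [h [Ih sh h1 hdom]] := strictly_positive I sq sep.
have hh1 : rnorm (cs_mul A h h) <= 1.
  by rewrite (le_trans (cn_mul NP _ _)) // mulr_ile1 // rnorm_ge0.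
have [b0 [_ b0E b0c b0s]] := sqrt_exists hh1.
have sb0 : cs_star b0 = b0 by apply: b0s; rewrite cs_starM sh.
pose v k := approx_elt b0 (scale_seq k).
have /choice[B BP] k : exists b, [/\ rnorm b <= 1, b + b - cs_mul A b b = cs_mul A (v k) (v k),
    forall x, cs_mul A x (cs_mul A (v k) (v k)) = cs_mul A (cs_mul A (v k) (v k)) x ->
      cs_mul A x b = cs_mul A b x & cs_star b = b].
  have v1 : rnorm (v k) <= 1 by apply: (approx_unit_norm sh sb0 b0E b0c sq); exact: scale_seq_gt0.
  have vv1 : rnorm (cs_mul A (v k) (v k)) <= 1.
    by rewrite (le_trans (cn_mul NP _ _)) // mulr_ile1 // rnorm_ge0.
  have [b [b1 bE bc bs]] := sqrt_exists vv1; exists b; split=> //; apply: bs.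
  by rewrite cs_starM (approx_elt_star sb0 b0E b0c) // scale_seq_gt0.
exists (bump b0 B); split.
- move=> k; split; first exact: (bump_ideal B b0E b0c).
  exact: (bump_le1 sh sb0 b0E b0c sq BP).
- move=> x Ix; apply: (sum_bumps_cv sh sb0 b0E b0c sq BP) => e e0.
  apply: (avg_to0 sh sb0 b0E b0c e0); apply: hdom => //; lra.
- by move=> j k jk; apply: (bump_orthogonal sh sb0 b0E b0c sq BP).
- by move=> r s K; apply: (signed_sum_le sh sb0 b0E b0c sq BP).
Qed.

(** * Lifting through an admissible morphism *)

Section UnderlyingNorm.
Variables (R : realType) (S : setting R) (e : S).
Hypothesis e1 : rnorm e = 1.
Local Notation C := R[i].
Local Notation p := (theta e e).

(** The underlying norm, read off one fixed projection of rank one. *)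
Definition unorm (E : qspace S) (y : E) : R := qnorm (tens p y).

Lemma theta_rank_one : rank_one_projection p.
Proof.
split; first exact: theta_projection.
exists e; first by apply/eqP => e0; move: e1; rewrite e0 /rnorm normr0 => /eqP; rewrite eq_sym oner_eq0.
apply/seteqP; split=> [_ [x _ <-]|_ [c _ <-]]; first by exists (hdot S x e).
by exists (c *: e) => //; rewrite thetaE hdotZl hdot_unit // mulr1.
Qed.

Lemma unorm_seminorm (E : qspace S) : seminorm (@unorm E).
Proof.
by split=> *; rewrite /unorm ?tensDr ?tensZr ?(semiD (qnorm_seminorm E)) ?(semiZ (qnorm_seminorm E)).
Qed.

Lemma unorm_definite (E : qspace S) (y : E) : unorm y = 0 -> y = 0.
Proof.
move/(qnorm_definite (qnormP E))/(congr1 (slice E e e)).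
rewrite linear0 /slice /= tliftE /= /slice_fun.
by rewrite thetaE hdotZl hdot_unit // mulr1 scale1r.
Qed.

Lemma unorm_cb (E F : qspace S) (phi : {linear E -> F}) (M : R) :
  (forall u, qnorm (ampl S phi u) <= M * qnorm u) ->
  forall y, unorm (phi y) <= M * unorm y.
Proof. by move=> phiM y; rewrite /unorm -amplE. Qed.

(** Tensoring with the fixed projection preserves norms, and turns [B x y] into a
   value of the amplification of [B]. *)
Lemma unorm_act (E F G : qspace S) (B : E -> F -> G) : completely_contractive B ->
  forall x y, unorm (B x y) <= unorm x * unorm y.
Proof.
move=> [Bi BiP Bile] x y; rewrite {1}/unorm -(fdia_r_theta _ e1) fdia_rE -BiP.2.
exact: Bile.
Qed.

End UnderlyingNorm.

Lemma amplD (R : realType) (S : setting R) (E F : lmodType R[i])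
  (phi : {linear E -> F}) (u v : fin_tensor S E) :
  ampl S phi (u + v) = ampl S phi u + ampl S phi v.
Proof. exact: linearD. Qed.

Lemma ampl0 (R : realType) (S : setting R) (E F : lmodType R[i])
  (phi : {linear E -> F}) : ampl S phi 0 = 0.
Proof. exact: linear0. Qed.

(** The mean of [b (D + d) (D + d)] and [b (D - d) (D - d)] is
   [b D D + b d d]. By induction, the sum of the [b (d k) (d k)] is a mean over all
   choices of signs of values of [b] at pairs of equal signed sums; the accumulator
   [D] keeps the signs already chosen. *)
Lemma diagonal_le (R : realType) (V F : lmodType R[i]) (nu : F -> R) (b : V -> V -> F)
  (d : nat -> V) (M : R) :
  seminorm nu -> bilinear_for *:%R *:%R b ->
  forall K D,
  (forall s : nat -> bool, let z := D + \sum_(k < K) sgn R (s k) *: d k in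
     nu (b z z) <= M) ->
  nu (\sum_(k < K) b (d k) (d k) + b D D) <= M.
Proof.
move=> nuP bP; elim=> [|K IH] D H.
  by have := H (fun=> false); rewrite /= !big_ord0 addr0 add0r.
have ext c : nu (\sum_(k < K) b (d k) (d k) + b (D + sgn R c *: d K) (D + sgn R c *: d K)) <= M.
  apply: IH => s; have := H (fun k => if k == K then c else s k).
  rewrite /= big_ord_recr /= eqxx -addrA [X in D + X]addrC.
  suff -> : \sum_(i < K) sgn R (if i == K :> nat then c else s i) *: d i =
    \sum_(k < K) sgn R (s k) *: d k by [].
  by apply: eq_bigr => k _; rewrite ltn_eqF.
have := ext false; have := ext true; rewrite /sgn expr1 expr0 scale1r scaleN1r.
rewrite !(bilDl bP) !(bilDr bP) !(bilNl bP) !(bilNr bP) big_ord_recr /=.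
set t := \sum_(k < K) _; move=> h1 h2.
set a := b D D in h1 h2 *; set c := b (d K) (d K) in h1 h2 *.
set x := b D (d K) in h1 h2; set y := b (d K) D in h1 h2.
have mean : t + (a + x + (y + c)) + (t + (a - x + (- y - - c))) = (t + c + a) *+ 2.
  have e1 : a + x + (y + c) = a + c + (x + y) by rewrite [y + c]addrC addrACA.
  have e2 : a - x + (- y - - c) = a + c - (x + y).
    by rewrite opprK [- y + c]addrC addrACA opprD.
  have -> : t + c + a = t + (a + c) by rewrite -addrA [c + a]addrC.
  by rewrite e1 e2 [LHS]addrACA [X in _ + X]addrACA subrr addr0 mulr2n [LHS]addrACA.
have := semiD nuP (t + (a + x + (y + c))) (t + (a - x + (- y - - c))).
by rewrite mean (semiMn nuP) mulr2n; lra.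
Qed.

Section Lift.
Variables (R : realType) (S : setting R) (A : cstar_algebra R).
Variables (q : standard_quantization S A) (I : closed_left_ideal A).
Variable Y : act_qspace (std_qalgebra q).
Local Notation C := R[i].
Local Notation P := (li_type I).
Local Notation PQ := (ideal_qspace I q).
Local Notation "x ** y" := (cs_mul A x y) (at level 40, left associativity).

Variables (e : S) (e1 : rnorm e = 1).
Variable sigma : {linear P -> Y}.
Variable M : R.
Hypothesis M0 : 0 <= M.
Hypothesis sigmaM : forall u : fin_tensor S P,
  qnorm (ampl S sigma u) <= M * @qnorm R S PQ u.
Hypothesis actA : forall (a b : A) (y : Y),
  aq_act Y (a ** b) y = aq_act Y a (aq_act Y b y).
Hypothesis actC : completely_contractive (aq_act Y).
Hypothesis compY : q_complete Y.

Local Notation nY := (@unorm R S e Y).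
Let nYS : seminorm nY := unorm_seminorm e Y.

Lemma unorm_ideal (x : P) : @unorm R S e PQ x = rnorm (val x).
Proof. exact: ideal_norm (theta_rank_one e1). Qed.

Lemma ideal_mem (x : P) : li_set I (val x).
Proof. by have := valP x; rewrite /li_pred /= inE. Qed.

Lemma sigma_le (g : P) : nY (sigma g) <= M * rnorm (val g).
Proof. by rewrite -unorm_ideal; exact: (@unorm_cb R S e PQ Y sigma M sigmaM g). Qed.

Lemma act_le (a : A) (y : Y) : nY (aq_act Y a y) <= rnorm a * nY y.
Proof.
have := unorm_act e1 actC a y; rewrite /unorm.
by rewrite [X in _ <= X * _](unit_norm q a e1).
Qed.

(** The two arguments [f] and [g] are separated in order to make the term bilinear
   in them; the lift only uses the diagonal [f = g]. *)
Definition piece (f : A) (g x : P) : Y := aq_act Y (val x ** f) (sigma g).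

Lemma piece_linear f g : linear (piece f g).
Proof. by move=> c x y; rewrite /piece /= csDl csZl linearPl. Qed.

HB.instance Definition _ f g := GRing.isLinear.Build C P Y *:%R (piece f g) (piece_linear f g).

(** Tensoring with [theta e e] preserves the norm and turns the amplified piece into
   a value of the amplified action, at the elementary tensor of [theta e e] and
   [sigma g]. *)
Lemma piece_le f g (u : fin_tensor S P) :
  qnorm (ampl S (piece f g) u) <= rnorm f * (M * rnorm (val g)) * @qnorm R S PQ u.
Proof.
have [Bi BiP Bile] := actC.
rewrite -(fdia_r_theta _ e1).
have -> : fdia_r Y (theta e e) (ampl S (piece f g) u) =
    Bi (ampl S (rmulA f) (ampl S (li_incl I) u)) (tens (theta e e) (sigma g)).
  elim/tensor_ind: u => [|a x u IH]; first by rewrite !linear0 (bil0l BiP.1).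
  rewrite !linearD /= (bilDl BiP.1) IH; congr (_ + _).
  by rewrite !amplE fdia_rE BiP.2.
apply: le_trans (Bile _ _) _.
have h1 : qnorm (tens (theta e e) (sigma g)) <= M * rnorm (val g) by exact: sigma_le.
have h2 := ampl_rmul_le q f (ampl S (li_incl I) u).
have h3 := semi_ge0 (qnorm_seminorm (std_qspace q)) (ampl S (rmulA f) (ampl S (li_incl I) u)).
have h4 := semi_ge0 (qnorm_seminorm Y) (tens (theta e e) (sigma g)).
have h5 : sq_norm q (ampl S (rmulA f) (ampl S (li_incl I) u)) * qnorm (tens (theta e e) (sigma g))
    <= (sq_norm q (ampl S (li_incl I) u) * rnorm f) * (M * rnorm (val g)) by apply: ler_pM.
apply: le_trans h5 _; rewrite ampl_ideal le_eqVlt; apply/orP; left; apply/eqP; ring.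
Qed.

Variable d : nat -> P.
Hypothesis d1 : forall k, rnorm (val (d k)) <= 1.
Hypothesis d_unit : forall x, li_set I x ->
  cv (@rnorm R A) (fun K => \sum_(k < K) x ** (val (d k) ** val (d k))) x.
Hypothesis d_orth : forall j k, (j.+2 <= k)%N ->
  rnorm (val (d j) ** val (d k)) <= 4^-1 ^+ k.
Hypothesis d_sign : forall (r : bool) (s : nat -> bool) K,
  rnorm (\sum_(k < K) sgn R (s k) *: val (d (r + k.*2)%N)) <= 2.

Definition partial_lift n (x : P) : Y := \sum_(k < n) piece (val (d k)) (d k) x.

Lemma partial_lift_linear n : linear (partial_lift n).
Proof.
move=> c x y; rewrite /partial_lift scaler_sumr -big_split /=.
by apply: eq_bigr => k _; rewrite linearP.
Qed.

HB.instance Definition _ n := GRing.isLinear.Build C P Y *:%R (partial_lift n)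
  (partial_lift_linear n).

Lemma ampl_partial_lift n (u : fin_tensor S P) :
  ampl S (partial_lift n) u = \sum_(k < n) ampl S (piece (val (d k)) (d k)) u.
Proof.
elim/tensor_ind: u => [|a x u IH].
  by rewrite linear0 big1 // => k _; rewrite linear0.
rewrite linearD /= IH amplE /partial_lift linear_sumr -big_split /=.
by apply: eq_bigr => k _; rewrite linearD /= amplE.
Qed.

Lemma ampl_piece_linearl (u : fin_tensor S P) c (f g : A) z :
  ampl S (piece (c *: f + g) z) u = c *: ampl S (piece f z) u + ampl S (piece g z) u.
Proof.
elim/tensor_ind: u => [|a x u IH]; first by rewrite !linear0 addr0.
rewrite !amplD IH !amplE /= /piece csDr csZr linearPl tensDr tensZr scalerDr.
by rewrite addrACA.
Qed.

Lemma ampl_piece_linearr (u : fin_tensor S P) c z (f g : P) :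
  ampl S (piece z (c *: f + g)) u = c *: ampl S (piece z f) u + ampl S (piece z g) u.
Proof.
elim/tensor_ind: u => [|a x u IH]; first by rewrite !linear0 addr0.
rewrite !amplD IH !amplE /= /piece linearP linearPr tensDr tensZr scalerDr.
by rewrite addrACA.
Qed.

Lemma piece_bilinear (u : fin_tensor S P) :
  bilinear_for *:%R *:%R (fun f g : P => ampl S (piece (val f) g) u).
Proof.
split=> z c f g; last exact: ampl_piece_linearr.
exact: (ampl_piece_linearl u c (val f) (val g) z).
Qed.

(** The terms form the diagonal of a bilinear form that is bounded on the signed
   sums [z], each of norm at most 2: by [2 * 2 * M] for each parity. *)
Lemma partial_lift_le K (u : fin_tensor S P) :
  qnorm (ampl S (partial_lift K.*2) u) <= 8 * M * @qnorm R S PQ u.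
Proof.
have u0 : 0 <= @qnorm R S PQ u := semi_ge0 (qnorm_seminorm PQ) u.
have part (r : bool) : qnorm (\sum_(k < K)
    ampl S (piece (val (d (r + k.*2)%N)) (d (r + k.*2)%N)) u) <= 4 * M * @qnorm R S PQ u.
  have := @diagonal_le R P (fin_tensor S Y) (@qnorm R S Y) _ (fun k => d (r + k.*2)%N)
    (4 * M * @qnorm R S PQ u) (qnorm_seminorm Y) (piece_bilinear u) K 0.
  rewrite (bil0l (piece_bilinear u)) addr0; apply => s.
  have diag (z : P) : rnorm (val z) <= 2 ->
      qnorm (ampl S (piece (val z) z) u) <= 4 * M * @qnorm R S PQ u.
    move=> z2; rewrite (le_trans (piece_le _ _ _)) // ler_wpM2r // mulrCA [4 * M]mulrC.
    rewrite ler_wpM2l //; have -> : 4 = 2 * 2 :> R by ring.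
    by apply: ler_pM => //; exact: rnorm_ge0.
  apply: diag; have zE : li_incl I (0 + \sum_(k < K) sgn R (s k) *: d (r + k.*2)%N) =
      \sum_(k < K) sgn R (s k) *: val (d (r + k.*2)%N).
    rewrite linearD linear0 add0r linear_sum; apply: eq_bigr => k _.
    by rewrite linearZ.
  by rewrite -[val _]/(li_incl I _) zE; exact: d_sign.
rewrite ampl_partial_lift (sum_parity (fun k => ampl S (piece (val (d k)) (d k)) u)).
rewrite (le_trans (semiD (qnorm_seminorm Y) _ _)) //.
by have := part false; have := part true; lra.
Qed.

Lemma partial_lift_norm K x : nY (partial_lift K.*2 x) <= 8 * M * rnorm (val x).
Proof.
rewrite -unorm_ideal /unorm -amplE; exact: partial_lift_le.
Qed.

Lemma piece_norm f g x : nY (piece f g x) <= rnorm (val x ** f) * (M * rnorm (val g)).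
Proof.
rewrite (le_trans (act_le _ _)) // ler_wpM2l ?rnorm_ge0 //; exact: sigma_le.
Qed.

(** By the uniform bound it is enough to treat a dense set of [x], namely the sums of
   elements [a (d j) (d j)]: for these, the terms of the series decay geometrically,
   because [d j] and [d n] are almost orthogonal for large [n]. *)
Lemma partial_lift_cauchy x : cauchy_for nY (fun K => partial_lift K.*2 x).
Proof.
have lin n a b : partial_lift n (a - b) = partial_lift n a - partial_lift n b.
  by rewrite linearB.
have add n a b : partial_lift n (a + b) = partial_lift n a + partial_lift n b.
  by rewrite linearD.
have good_add a b : cauchy_for nY (fun K => partial_lift K.*2 a) ->
    cauchy_for nY (fun K => partial_lift K.*2 b) ->
    cauchy_for nY (fun K => partial_lift K.*2 (a + b)).
  move=> ga gb r r0; have r2 : 0 < r / 2 by lra.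
  have [n1 h1] := ga _ r2; have [n2 h2] := gb _ r2.
  exists (maxn n1 n2) => i j; rewrite !geq_max => /andP[i1 i2] /andP[j1 j2].
  rewrite !add opprD addrACA (le_lt_trans (semiD nYS _ _)) //.
  by have := h1 _ _ i1 j1; have := h2 _ _ i2 j2; lra.
(* From the index [j + 2] on, [d j] and [d n] are almost orthogonal. *)
have good_single a j : cauchy_for nY (fun K => partial_lift K.*2 (li_act (val a ** val (d j)) (d j))).
  set b := li_act _ _; pose c := rnorm (val a ** val (d j)) * M.
  have c0 : 0 <= c by rewrite mulr_ge0 // rnorm_ge0.
  have tail n : (j.+2 <= n)%N -> nY (piece (val (d n)) (d n) b) <= c * 2^-1 ^+ n.
    move=> jn; rewrite (le_trans (piece_norm _ _ _)) // /b /= -cs_mulA.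
    have h1 := cn_mul (rnorm_cseminorm A) (val a ** val (d j)) (val (d j) ** val (d n)).
    have h2 := d_orth jn; have h3 := d1 n; have h4 := rnorm_ge0 (val (d n)).
    have h5 := rnorm_ge0 (val a ** val (d j)).
    have h6 : 0 <= (2^-1 : R) ^+ n by rewrite exprn_ge0 // invr_ge0.
    have h7 : (4^-1 : R) ^+ n <= 2^-1 ^+ n.
      by apply: lerXn2r; rewrite ?nnegrE ?invr_ge0 //; lra.
    have h8 : rnorm (val a ** val (d j) ** (val (d j) ** val (d n))) <=
        rnorm (val a ** val (d j)) * 2^-1 ^+ n.
      by rewrite (le_trans h1) // ler_wpM2l // (le_trans h2).
    have -> : c * 2^-1 ^+ n = rnorm (val a ** val (d j)) * 2^-1 ^+ n * (M * 1).
      by rewrite /c; ring.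
    apply: ler_pM => //; [exact: rnorm_ge0 | exact: mulr_ge0 | exact: ler_wpM2l].
  have step n k : (j.+2 <= n)%N ->
      nY (partial_lift (n + k) b - partial_lift n b) <= 2 * c * (2^-1 ^+ n - 2^-1 ^+ (n + k)).
    move=> jn; elim: k => [|k IH]; first by rewrite addn0 !subrr (semi0 nYS) mulr0.
    have -> : partial_lift (n + k.+1) b = partial_lift (n + k) b +
        piece (val (d (n + k)%N)) (d (n + k)%N) b.
      by rewrite /partial_lift addnS big_ord_recr.
    rewrite addrAC (le_trans (semiD nYS _ _)) // addnS exprS.
    have := tail (n + k)%N (leq_trans jn (leq_addr k n)); lra.
  apply: (cauchy_mono nYS) => r r0; have c1 : 0 < 2 * c + 1 by lra.
  have [n0 hn0] := small_inv (divr_gt0 r0 c1).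
  exists (maxn n0 j.+2) => n k; rewrite geq_max => /andP[n0n jn].
  have jn2 : (j.+2 <= n.*2)%N by rewrite (leq_trans jn) // -addnn leq_addr.
  rewrite doubleD (le_lt_trans (step _ _ jn2)) //.
  have h1 := hn0 n n0n; have h2 := pow_half_lt R n.
  have h3 : 0 <= (2^-1 : R) ^+ (n.*2 + k.*2) by rewrite exprn_ge0 // invr_ge0.
  have h4 : (2^-1 : R) ^+ n.*2 <= 2^-1 ^+ n.
    rewrite -addnn exprD ler_piMr ?exprn_ge0 ?invr_ge0 //.
    by apply: exprn_ile1; rewrite ?invr_ge0 // invf_le1 // ler1n.
  have h0 : 0 <= (2^-1 : R) ^+ n by rewrite exprn_ge0 // invr_ge0.
  have h5 : (2^-1 : R) ^+ n < r / (2 * c + 1) := le_lt_trans h2 h1.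
  move: h5; rewrite ltr_pdivlMr // => h5; apply: le_lt_trans h5.
  apply: (@le_trans _ _ (2 * c * 2^-1 ^+ n)).
    by apply: ler_wpM2l; [rewrite mulr_ge0 | lra].
  by rewrite mulrC ler_wpM2l // lerDl.
move=> r r0.
have m1 : 0 < 8 * M + 1 by rewrite ltr_wpDl // mulr_ge0.
have del : 0 < r / 3 / (8 * M + 1) by rewrite !divr_gt0.
have [J hJ] := d_unit (ideal_mem x) del.
pose xJ : P := \sum_(j < J) li_act (val x ** val (d j)) (d j).
have xJE : val xJ = \sum_(j < J) val x ** (val (d j) ** val (d j)).
  by rewrite -[val xJ]/(li_incl I xJ) linear_sum; apply: eq_bigr => j _; rewrite /= cs_mulA.
have gJ : cauchy_for nY (fun K => partial_lift K.*2 xJ).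
  rewrite /xJ; elim: (J) => [|i IH].
    move=> r' r'0; exists 0%N => i j _ _.
    have z0 n : partial_lift n 0 = 0 by rewrite linear0.
    by rewrite big_ord0 !z0 subrr (semi0 nYS).
  by rewrite big_ord_recr; apply: good_add => //; exact: good_single.
(* Partial lifts are bounded by [8 M], uniformly in their number of terms. *)
have close i : nY (partial_lift i.*2 x - partial_lift i.*2 xJ) <= r / 3.
  rewrite -lin (le_trans (partial_lift_norm _ _)) //.
  have vB : val (x - xJ) = val x - val xJ by exact: (linearB (li_incl I)).
  rewrite vB xJE (semi_distC (rnorm_seminorm A)).
  have := hJ J (leqnn J); rewrite ltr_pdivlMr // => h.
  have := rnorm_ge0 (\sum_(k < J) val x ** (val (d k) ** val (d k)) - val x); nra.
have r3 : 0 < r / 3 by lra.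
have [n0 hn0] := gJ _ r3; exists n0 => i j ni nj.
have := close i; have := close j; have := hn0 i j ni nj.
have := semi_tri nYS (partial_lift i.*2 x) (partial_lift i.*2 xJ) (partial_lift j.*2 x).
have := semi_tri nYS (partial_lift i.*2 xJ) (partial_lift j.*2 xJ) (partial_lift j.*2 x).
rewrite (semi_distC nYS (partial_lift j.*2 xJ)); lra.
Qed.

(** The uniform bound passes to the limit, since the amplifications of the partial
   lifts converge on every element of the algebraic tensor product. *)
Lemma lift_exists : exists psi : {linear P -> Y},
  [/\ forall u : fin_tensor S P, qnorm (ampl S psi u) <= 8 * M * @qnorm R S PQ u,
      forall a x, psi (li_act a x) = aq_act Y a (psi x) &
      forall x, cv nY (fun K => partial_lift K.*2 x) (psi x)].
Proof.
have /choice[psi psiP] x : exists y, cv nY (fun K => partial_lift K.*2 x) y.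
  exact: (compY (theta_rank_one e1) (partial_lift_cauchy x)).
have uniq := cv_unique nYS (@unorm_definite R S e e1 Y).
have psil : linear psi.
  move=> c x y; apply: uniq (psiP _) _ => /=.
  have -> : (fun K => partial_lift K.*2 (c *: x + y)) =
      (fun K => c *: partial_lift K.*2 x + partial_lift K.*2 y).
    by apply/funext => K; rewrite linearP.
  apply: (cvD nYS) => //; apply: (cv_lip (M := rmod c) nYS (f := *:%R c)) (psiP x) => a b.
  by rewrite -scalerBr (semiZ nYS).
exists (HB.pack_for {linear P -> Y} psi (GRing.isLinear.Build C P Y *:%R psi psil)).
split => //=.
- move=> u.
  have lim : cv (@qnorm R S Y) (fun K => ampl S (partial_lift K.*2) u)
      (ampl S (HB.pack_for {linear P -> Y} psi (GRing.isLinear.Build C P Y *:%R psi psil)) u).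
    elim/tensor_ind: u => [|a x u IH].
      by move=> r r0; exists 0%N => n _; rewrite !ampl0 subrr (semi0 (qnorm_seminorm Y)).
    rewrite amplD; have -> : (fun K => ampl S (partial_lift K.*2) (tens a x + u)) =
        (fun K => tens a (partial_lift K.*2 x) + ampl S (partial_lift K.*2) u).
      by apply/funext => K; rewrite amplD amplE.
    apply: (cvD (qnorm_seminorm Y)) => //; rewrite amplE /=.
    (* On elementary tensors convergence is that in the underlying norm. *)
    have [k k0 kP] := @qnorm_tens_bound R S Y e a e1.
    apply: (cv_lip (M := k) nYS (f := tens a)) (psiP x) => y z.
    by rewrite -(linearBr (@tens _ _ _)); exact: kP.
  by apply: (cv_le (qnorm_seminorm Y) (N := 0%N)) lim => n _; exact: partial_lift_le.
- move=> a x; apply: uniq (psiP _) _.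
  have -> : (fun K => partial_lift K.*2 (li_act a x)) =
      (fun K => aq_act Y a (partial_lift K.*2 x)).
    apply/funext => K; rewrite /partial_lift linear_sumr; apply: eq_bigr => k _.
    by rewrite /piece /= -cs_mulA actA.
  apply: (cv_lip (M := rnorm a) nYS (f := aq_act Y a)) (psiP x) => y z.
  by rewrite -linearBr; exact: act_le.
Qed.

End Lift.

Theorem mainTheorem1 (R : realType) (S : setting R) (A : cstar_algebra R)
  (hA : separable A) (q : standard_quantization S A) (I : closed_left_ideal A) :
  relatively_projective (ideal_qmodule I q).
Proof.
split; [exact: std_banach_qalgebra | exact: ideal_banach_qmodule | ].
move=> X Y tau phi [_ actXC _] [actYA actYC compY] [[Mt tauM] tauA] [rho [Mr rhoM] rhoK]
  [[Mp phiM] phiA].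
have [e e1] := unit_vector S.
have [d [dI d_unit d_orth d_sign]] := bounded_partition I hA (sum_squares_le q).
pose d' k : li_type I := exist _ (d k) (mem_set (dI k).1).
pose sigma : {linear li_type I -> Y} := rho \o phi.
pose M := `|Mr| * `|Mp|.
have M0 : 0 <= M by rewrite mulr_ge0.
have sigmaM (u : fin_tensor S (li_type I)) :
    qnorm (ampl S sigma u) <= M * @qnorm R S (ideal_qspace I q) u.
  have -> : ampl S sigma u = ampl S rho (ampl S phi u).
    elim/tensor_ind: u => [|a x u IH]; first by rewrite !ampl0.
    by rewrite !amplD IH !amplE.
  have Xs := qnorm_seminorm X; have Is := qnorm_seminorm (ideal_qspace I q).
  rewrite (le_trans (rhoM _)) //.
  rewrite (@le_trans _ _ (`|Mr| * qnorm (ampl S phi u))) //.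
    by rewrite ler_wpM2r ?ler_norm // (semi_ge0 Xs).
  rewrite /M -mulrA ler_wpM2l // (le_trans (phiM _)) // ler_wpM2r ?ler_norm //.
  exact: (semi_ge0 Is).
have [psi [psiM psiA psi_lim]] := @lift_exists R S A q I Y e e1 sigma M M0 sigmaM actYA actYC
  compY d' (fun k => (dI k).2) d_unit d_orth d_sign.
exists psi; first by split; [exists (8 * M) | exact: psiA].
move=> x /=.
have XS := unorm_seminorm e X.
pose sums K : li_type I := \sum_(k < K.*2) li_act (cs_mul A (val x) (d k)) (d' k).
have sums_x : cv (@unorm R S e (ideal_qspace I q)) sums x.
  have c0 := cv_comp (f := double) (fun n => leq_trans (leq_addr n n) (eq_leq (addnn n)))
    (d_unit _ (ideal_mem x)).
  move=> r /c0[n0 hn]; exists n0 => n /hn /=.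
  suff -> : \sum_(k < n.*2) cs_mul A (val x) (cs_mul A (d k) (d k)) = val (sums n).
    by move=> h; have E := unorm_ideal q e1 (sums n - x); move: h; rewrite /= -E.
  rewrite -[RHS]/(li_incl I (sums n)) linear_sum; apply: eq_bigr => k _ /=.
  by rewrite cs_mulA.
have c1 : cv (@unorm R S e X) (phi \o sums) (phi x).
  apply: (cv_lip (M := Mp) (unorm_seminorm e (ideal_qspace I q))) sums_x => y z.
  by rewrite -linearB; exact: (@unorm_cb R S e (ideal_qspace I q) X phi Mp phiM (y - z)).
(* By [tau \o rho = id], the image by [tau] of a partial lift of [x] is the image by
   [phi] of the sum of the [x (d k) (d k)]. *)
have c2 : cv (@unorm R S e X) (fun K => tau (partial_lift sigma d' K.*2 x)) (tau (psi x)).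
  apply: (cv_lip (M := Mt) (unorm_seminorm e Y) (f := tau)) (psi_lim x) => y z.
  by rewrite -linearB; exact: (@unorm_cb R S e Y X tau Mt tauM (y - z)).
apply: (cv_unique XS (@unorm_definite R S e e1 X) c2).
have -> // : (fun K => tau (partial_lift sigma d' K.*2 x)) = phi \o sums.
apply/funext => K; rewrite /= /partial_lift !linear_sum; apply: eq_bigr => k _ /=.
by rewrite /piece tauA /= rhoK phiA.
Qed.
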